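(* For any fixed $u,v$ such that $0<u<v<1$ and for $j=2,3$, the function $S_j(u,v,t)=\dfrac{\theta_j(u/2,t)}{\theta_j(v/2,t)}$ is such that $\dfrac{\partial^3}{\partial t^3}S_j(u,v,t)$ is non-positive for $t\in(0,\infty)$.
   Context: For $t>0$ put $\tau=i\pi t$ and $q=e^{i\pi\tau}=e^{-\pi^2 t}$. The Jacobi theta functions used here, as functions of $u$ and $t>0$, are $$\theta_2(u,t)=2\sum_{n\ge0}q^{(n+1/2)^2}\cos((2n+1)\pi u),\qquad \theta_3(u,t)=1+2\sum_{n\ge1}q^{n^2}\cos(2n\pi u).$$ *)

(* Defs.v *)
From Stdlib Require Import Reals.
From Coquelicot Require Import Coquelicot.
Open Scope R_scope.

(** [q = exp (i PI tau)] at [tau = i PI t]. *)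
Definition nome (t : R) : R := exp (- PI ^ 2 * t).

Definition theta2 (u t : R) : R :=
  2 * Series (fun n : nat =>
    Rpower (nome t) ((INR n + 1 / 2) ^ 2) * cos ((2 * INR n + 1) * PI * u)).

(** The sum runs over [n >= 1], hence the shift to [S n]. *)
Definition theta3 (u t : R) : R :=
  1 + 2 * Series (fun n : nat =>
    nome t ^ (S n ^ 2) * cos (2 * INR (S n) * PI * u)).

(** Meaningful for [j = 2] and [j = 3] only; other indices give [0]. *)
Definition theta (j : nat) (u t : R) : R :=
  match j with
  | 2%nat => theta2 u t
  | 3%nat => theta3 u t
  | _ => 0
  end.

Definition theta_quotient (j : nat) (u v t : R) : R :=
  theta j (u / 2) t / theta j (v / 2) t.

(* Main.v *)
Require Import Defs.
From Stdlib Require Import Reals Lra Lia ZArith.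
From Coquelicot Require Import Coquelicot.
Open Scope R_scope.

(** Write a quotient of theta functions as [exp L]. Its third derivative is
[exp L * (L''' + 3 L'' L' + L'^3)], so it is enough that [L' <= 0], [0 <= L'']
and [L''' <= 0]. The first two signs follow from the third: when [L''' <= 0] on
the half-line, a negative value of [L''] or a positive value of [L'] would make
[L] run off to infinity, whereas [L] converges along a sequence of times that
tends to infinity ([third_deriv_bounded_signs]). And [L''' <= 0], being an
inequality between third differences, survives pointwise limits
([third_deriv_limit_nonpos]), so that it can be read off from any sequence of
elementary functions that tends to [L].

For [theta3] two such sequences are used. With [q = exp (- PI^2 t)], the triple
product shows that [theta3 (u/2) t] is the product of the factors
[1 + 2 q^m cos (PI u) + q^(2m)], [m] odd, times a quantity independent of [u].
The third derivative of the logarithm of a factor is monotone in [cos (PI u)]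
as soon as [cosh (m PI^2 t) >= 5]; since [PI > 3] this holds for all factors
when [t > 10/39] ([factor_d3_decr]).

For small [t] the factors no longer have the right sign one by one. There
Jacobi's imaginary transformation ([theta3_heat]) gives, up to a quantity
independent of [u], [theta3 (u/2) t = sum_k exp (- (k + u/2)^2 / t)], and the
same triple product, with [cosh (u/t)] for [cos (PI u)] and [exp (-1/t)] for
[q], turns the logarithm of the latter into [- u^2 / (4 t)] plus the sum over
odd [m] of [softplus ((m - u)/t) + softplus ((m + u)/t)]. The third derivative
in [t] is monotone in [u] because the contribution of the Gaussian dominates
those of the factors, which decay exponentially; this is the inequality
[d3_sum_le], valid for [t < 5/19]. As [10/39 < 5/19], all times are covered.

Two devices keep the argument elementary. The triple product is stated for any
sequence [c] on the integers with [c (k+1) + c (k-1) = 2 x c k], so that one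
identity serves cosines and hyperbolic cosines alike. The imaginary
transformation is proved by Polya's method: sums of binomial coefficients over
a residue class are evaluated with roots of unity, and in the Gaussian limit
both sides become theta series. The factors independent of [u] are never
computed, because they cancel in the quotients.

For [theta2] the product runs over the even exponents of [q]. An even number is
either twice an odd number or twice an even one, so the quotients satisfy
[S2 t = S2 (2 t) * S3 (2 t)]; hence [ln S2] is a constant plus the sum over
[k >= 1] of [ln (S3 (2^k t))], whose terms have nonpositive third
derivatives. *)

(** * Elementary estimates *)

Lemma exp_le (x y : R) : x <= y -> exp x <= exp y.
Proof. intros [H| ->]; [left; now apply exp_increasing|right; reflexivity]. Qed.

Lemma is_derive_nonneg_le (f df : R -> R) (a b : R) : a <= b ->
  (forall x, a <= x <= b -> is_derive f x (df x)) ->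
  (forall x, a <= x <= b -> 0 <= df x) -> f a <= f b.
Proof.
intros Hab Hd Hp.
destruct (MVT_gen f a b df) as (c & Hc & E).
- intros x; rewrite Rmin_left, Rmax_right by trivial. intros Hx. apply Hd; lra.
- intros x; rewrite Rmin_left, Rmax_right by trivial. intros Hx.
  apply continuity_pt_filterlim, (ex_derive_continuous f x). eexists. now apply Hd.
- rewrite Rmin_left, Rmax_right in Hc by trivial. specialize (Hp c Hc). nra.
Qed.

Lemma exp_pow_INR x n : exp x ^ n = exp (INR n * x).
Proof.
induction n as [|n IH].
- simpl. now rewrite Rmult_0_l, exp_0.
- simpl pow. rewrite IH, S_INR, <- exp_plus. f_equal. ring.
Qed.

(** A lower bound of [1 - y] that multiplies well: it turns products into sums of
exponents. *)
Lemma exp_opp_div_le (y : R) : y < 1 -> exp (- (y / (1 - y))) <= 1 - y.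
Proof.
intros Hy. rewrite exp_Ropp.
replace (1 - y) with (/ (1 + y / (1 - y))) at 2 by (field; lra).
apply Rinv_le_contravar; [|apply exp_ineq1_le].
replace (1 + y / (1 - y)) with (/ (1 - y)) by (field; lra).
apply Rinv_0_lt_compat. lra.
Qed.

Lemma exp_ge_taylor x : 0 <= x ->
  1 + x + x ^ 2 / 2 + x ^ 3 / 6 + x ^ 4 / 24 + x ^ 5 / 120 <= exp x.
Proof.
assert (S : forall p p' : R -> R, (forall y, is_derive p y (p' y)) -> p 0 = 1 ->
  (forall y, 0 <= y -> p' y <= exp y) -> forall y, 0 <= y -> p y <= exp y).
{ intros p p' Hd H0 Hle y Hy.
  assert (H : exp 0 - p 0 <= exp y - p y).
  { apply (is_derive_nonneg_le (fun y => exp y - p y) (fun y => exp y - p' y)); trivial.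
    - intros z _. apply (is_derive_minus (V := R_NormedModule)); trivial.
      apply is_derive_Reals, derivable_pt_lim_exp.
    - intros z Hz. specialize (Hle z). lra. }
  rewrite exp_0, H0 in H. lra. }
revert x.
apply (S (fun x => 1 + x + x ^ 2 / 2 + x ^ 3 / 6 + x ^ 4 / 24 + x ^ 5 / 120)
  (fun x => 1 + x + x ^ 2 / 2 + x ^ 3 / 6 + x ^ 4 / 24)).
{ intros y. auto_derive; trivial. field. } { field. }
apply (S _ (fun x => 1 + x + x ^ 2 / 2 + x ^ 3 / 6)).
{ intros y. auto_derive; trivial. field. } { field. }
apply (S _ (fun x => 1 + x + x ^ 2 / 2)).
{ intros y. auto_derive; trivial. field. } { field. }
apply (S _ (fun x => 1 + x)).
{ intros y. auto_derive; trivial. field. } { field. }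
intros y _. apply exp_ineq1_le.
Qed.

Lemma exp_taylor1 x : Rabs (exp x - 1 - x) <= x ^ 2 * exp (Rabs x).
Proof.
assert (H1 := exp_ineq1_le x). assert (H2 := exp_ineq1_le (- x)).
assert (Hp := exp_pos x).
assert (H3 : exp x * (1 - x) <= 1).
{ rewrite exp_Ropp in H2. apply (Rmult_le_compat_l (exp x)) in H2; [|lra].
  rewrite Rinv_r in H2 by lra. lra. }
rewrite Rabs_pos_eq by lra.
destruct (Rle_dec 0 x) as [Hx|Hx].
- rewrite (Rabs_pos_eq x) by trivial. simpl. nra.
- rewrite (Rabs_left x) by lra.
  assert (1 <= exp (- x)) by lra. assert (0 <= x ^ 2) by apply pow2_ge_0. simpl in *. nra.
Qed.

Lemma mul_exp_le x d : 0 < d -> 0 <= x -> x * exp (- x * d) <= 2 / d * exp (- x * (d / 2)).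
Proof.
intros Hd Hx. replace (- x * d) with (- x * (d / 2) + - (x * d / 2)) by field.
rewrite exp_plus.
assert (H : x * exp (- (x * d / 2)) <= 2 / d).
{ assert (He := exp_ineq1_le (x * d / 2)). rewrite exp_Ropp.
  assert (0 <= x * d / 2) by nra.
  apply (Rmult_le_reg_r (exp (x * d / 2))); [apply exp_pos|].
  rewrite Rmult_assoc, Rinv_l, Rmult_1_r by (assert (P := exp_pos (x * d / 2)); lra).
  apply Rle_trans with (2 / d * (x * d / 2)); [right; field; lra|].
  apply Rmult_le_compat_l; [left; apply Rdiv_lt_0_compat; lra|lra]. }
assert (Hp := exp_pos (- x * (d / 2))).
replace (x * (exp (- x * (d / 2)) * exp (- (x * d / 2)))) with
  (x * exp (- (x * d / 2)) * exp (- x * (d / 2))) by ring.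
now apply Rmult_le_compat_r; [lra|].
Qed.

Lemma INR_le_sqr n : INR n <= INR n ^ 2.
Proof.
destruct n as [|n]; [simpl; lra|].
assert (H : 1 <= INR (S n)) by (rewrite S_INR; assert (P := pos_INR n); lra). rewrite <- Rsqr_pow2. unfold Rsqr. nra.
Qed.

Lemma Rabs_exp_cos_le a b y : a <= b -> Rabs (exp a * cos y) <= exp b.
Proof.
intros H. rewrite Rabs_mult, (Rabs_pos_eq (exp a)) by (left; apply exp_pos).
rewrite <- (Rmult_1_r (exp b)). apply Rmult_le_compat.
- left; apply exp_pos.
- apply Rabs_pos.
- now apply exp_le.
- apply Rabs_le, COS_bound.
Qed.

Lemma pow2_ge_INR k : INR (S k) <= 2 ^ k.
Proof.
induction k as [|k IH]; [simpl; lra|]. rewrite S_INR. simpl pow.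
assert (1 <= 2 ^ k) by (apply pow_R1_Rle; lra). lra.
Qed.

Lemma PI2_gt_9 : 9 < PI ^ 2.
Proof. assert (H := PI2_3_2). simpl. nra. Qed.

(** * Series *)

Lemma ex_series_le_R (a b : nat -> R) :
  (forall n, Rabs (a n) <= b n) -> ex_series b -> ex_series a.
Proof. apply (ex_series_le (K := R_AbsRing) (V := R_CompleteNormedModule)). Qed.

Lemma ex_series_scal_R (c : R) (a : nat -> R) : ex_series a -> ex_series (fun n => c * a n).
Proof. exact (ex_series_scal_l (K := R_AbsRing) c a). Qed.

Lemma is_series_zero : is_series (V := R_NormedModule) (fun _ => 0) 0.
Proof.
apply (is_lim_seq_ext (fun _ => 0) (sum_n (fun _ : nat => 0)) 0); [|apply is_lim_seq_const].
intros n. rewrite sum_n_const. ring.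
Qed.

Lemma Series_nonneg a : (forall n, 0 <= a n) -> ex_series a -> 0 <= Series a.
Proof.
intros Ha He. rewrite <- (is_series_unique _ _ is_series_zero).
apply Series_le; trivial. intros n. split; [lra|apply Ha].
Qed.

(** Tannery's theorem, the discrete form of dominated convergence. *)
Lemma is_lim_seq_Series_dominated (f : nat -> nat -> R) (g M : nat -> R) :
  (forall n k, Rabs (f n k) <= M k) -> ex_series M ->
  (forall k, is_lim_seq (fun n => f n k) (g k)) ->
  is_lim_seq (fun n => Series (f n)) (Series g).
Proof.
intros Hd HM Hl.
assert (Hg : forall k, Rabs (g k) <= M k).
{ intros k.
  apply (is_lim_seq_le (fun n => Rabs (f n k)) (fun _ => M k) (Rabs (g k)) (M k)).
  - intros n; apply Hd.
  - apply (is_lim_seq_abs _ (g k)), Hl.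
  - apply is_lim_seq_const. }
assert (Hga : ex_series (fun k => Rabs (g k))).
{ apply ex_series_le_R with M; trivial. intros k. now rewrite Rabs_Rabsolu. }
assert (Hfa : forall n, ex_series (fun k => Rabs (f n k))).
{ intros n. apply ex_series_le_R with M; trivial. intros k. now rewrite Rabs_Rabsolu. }
apply is_lim_seq_spec. intros eps.
assert (HN : exists N, Series (fun k => M (S N + k)%nat) < eps / 4).
{ destruct HM as [lM HM].
  assert (HM' : is_lim_seq (sum_n M) lM) by exact HM. apply is_lim_seq_spec in HM'.
  assert (He : 0 < eps / 4) by (destruct eps as [e He]; simpl; lra).
  destruct (HM' (mkposreal _ He)) as [N HN]. exists N.
  specialize (HN N (Nat.le_refl _)). simpl in HN.
  assert (Hs := Series_incr_n M (S N) (Nat.lt_0_succ _) (ex_intro _ lM HM)).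
  simpl pred in Hs.
  rewrite (is_series_unique M lM HM) in Hs.
  rewrite <- sum_n_Reals in Hs.
  apply Rabs_def2 in HN. lra. }
destruct HN as [N HN].
assert (Hf : is_lim_seq (fun n => sum_n (fun k => Rabs (f n k - g k)) N) 0).
{ clear - Hl. induction N as [|N IH].
  - apply is_lim_seq_ext with (fun n => Rabs (f n 0%nat - g 0%nat)).
    { intros n. now rewrite sum_O. }
    apply (is_lim_seq_abs_0 (fun n => f n 0%nat - g 0%nat)).
    replace 0 with (g 0%nat - g 0%nat) by ring.
    apply is_lim_seq_minus'; [apply Hl | apply is_lim_seq_const].
  - apply is_lim_seq_ext with (fun n => sum_n (fun k => Rabs (f n k - g k)) N + Rabs (f n (S N) - g (S N))).
    { intros n. now rewrite sum_Sn. }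
    replace (Finite 0) with (Finite (0 + 0)) by (f_equal; ring).
    apply is_lim_seq_plus'; trivial.
    apply (is_lim_seq_abs_0 (fun n => f n (S N) - g (S N))).
    replace 0 with (g (S N) - g (S N)) by ring.
    apply is_lim_seq_minus'; [apply Hl | apply is_lim_seq_const]. }
apply is_lim_seq_spec in Hf.
assert (He : 0 < eps / 4) by (destruct eps as [e He]; simpl; lra).
destruct (Hf (mkposreal _ He)) as [n0 Hn0]. exists n0. intros n Hn.
specialize (Hn0 n Hn). simpl in Hn0. rewrite Rminus_0_r in Hn0. apply Rabs_def2 in Hn0.
rewrite <- Series_minus by (apply ex_series_Rabs; trivial).
assert (Hda : ex_series (fun k => Rabs (f n k - g k))).
{ apply ex_series_le_R with (fun k => 2 * M k); [|now apply ex_series_scal_R].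
  intros k. rewrite Rabs_Rabsolu. eapply Rle_trans; [apply Rabs_triang|]. rewrite Rabs_Ropp.
  specialize (Hd n k). specialize (Hg k). lra. }
eapply Rle_lt_trans; [apply Series_Rabs; trivial|]. cbv beta.
rewrite (Series_incr_n _ (S N) (Nat.lt_0_succ _) Hda). simpl pred.
rewrite <- sum_n_Reals.
assert (Ht : Series (fun k => Rabs (f n (S N + k)%nat - g (S N + k)%nat))
   <= Series (fun k => 2 * M (S N + k)%nat)).
{ apply Series_le.
  - intros k; split; [apply Rabs_pos|].
    eapply Rle_trans; [apply Rabs_triang|]. rewrite Rabs_Ropp.
    specialize (Hd n (S N + k)%nat). specialize (Hg (S N + k)%nat). lra.
  - apply (ex_series_scal_R 2 (fun k => M (S N + k)%nat)). now apply ex_series_incr_n. }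
rewrite Series_scal_l in Ht. lra.
Qed.

Lemma ex_series_geom_exp (s : R) : 0 < s -> ex_series (fun n => exp (- s * INR n)).
Proof.
intros Hs. apply ex_series_ext with (fun n => exp (- s) ^ n).
- intros n. induction n as [|n IH].
  + simpl. now rewrite Rmult_0_r, exp_0.
  + simpl pow. rewrite IH, S_INR, <- exp_plus. f_equal. ring.
- exists (/ (1 - exp (- s))). apply is_series_geom.
  rewrite Rabs_pos_eq by (left; apply exp_pos).
  rewrite <- exp_0. apply exp_increasing. lra.
Qed.

Lemma Series_finite f N : (forall k, (N < k)%nat -> f k = 0) -> Series f = sum_n f N.
Proof.
intros H. apply is_series_unique.
apply (is_lim_seq_ext_loc (fun _ => sum_n f N) (sum_n f) (sum_n f N)); [|apply is_lim_seq_const].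
exists N. intros n Hn. induction Hn as [|n Hn IH]; trivial.
rewrite sum_Sn, <- IH, H by lia. exact (eq_sym (Rplus_0_r _)).
Qed.

(** * Series indexed by the integers *)

(** The two halves of the series converge separately; shifts and reflections of
the index are then rearrangements of finitely many terms. *)
Definition is_bisum (f : Z -> R) (l : R) : Prop :=
  exists l1 l2 : R, is_series (fun n => f (Z.of_nat n)) l1 /\
    is_series (fun n => f (- Z.of_nat (S n))%Z) l2 /\ l = l1 + l2.

Lemma is_bisum_unique f l l' : is_bisum f l -> is_bisum f l' -> l = l'.
Proof.
intros (a & b & Ha & Hb & ->) (a' & b' & Ha' & Hb' & ->).
apply is_series_unique in Ha, Hb, Ha', Hb'. congruence.
Qed.

Lemma is_bisum_ext f g l : (forall k, f k = g k) -> is_bisum f l -> is_bisum g l.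
Proof.
intros E (a & b & Ha & Hb & ->). exists a, b. repeat split; trivial.
- eapply is_series_ext; [|exact Ha]. intros; apply E.
- eapply is_series_ext; [|exact Hb]. intros; apply E.
Qed.

Lemma is_bisum_plus f g l m :
  is_bisum f l -> is_bisum g m -> is_bisum (fun k => f k + g k) (l + m).
Proof.
intros (a & b & Ha & Hb & ->) (a' & b' & Ha' & Hb' & ->).
exists (a + a'), (b + b'). split; [|split; [|ring]].
- exact (is_series_plus _ _ _ _ Ha Ha').
- exact (is_series_plus _ _ _ _ Hb Hb').
Qed.

Lemma is_bisum_scal c f l : is_bisum f l -> is_bisum (fun k => c * f k) (c * l).
Proof.
intros (a & b & Ha & Hb & ->).
exists (c * a), (c * b). split; [|split; [|ring]].
- exact (is_series_scal (K := R_AbsRing) c _ _ Ha).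
- exact (is_series_scal (K := R_AbsRing) c _ _ Hb).
Qed.

Lemma is_bisum_succ f l : is_bisum f l -> is_bisum (fun k => f (k + 1)%Z) l.
Proof.
intros (a & b & Ha & Hb & ->).
exists (a - f 0%Z), (b + f 0%Z). split; [|split; [|ring]].
- apply is_series_ext with (fun n => f (Z.of_nat (S n))).
  { intros n. f_equal; lia. }
  apply (is_series_incr_1 (V := R_NormedModule) (fun n => f (Z.of_nat n))).
  unfold plus; simpl. replace (a - f 0%Z + f 0%Z) with a by ring. exact Ha.
- apply (is_series_decr_1 (V := R_NormedModule)).
  apply is_series_ext with (fun n => f (- Z.of_nat (S n))%Z).
  { intros n. f_equal; lia. }
  unfold plus, opp; simpl.
  change (-1 + 1)%Z with 0%Z. replace (b + f 0%Z + - f 0%Z) with b by ring. exact Hb.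
Qed.

Lemma is_bisum_opp f l : is_bisum f l -> is_bisum (fun k => f (- k)%Z) l.
Proof.
intros (a & b & Ha & Hb & ->).
exists (b + f 0%Z), (a - f 0%Z). split; [|split; [|ring]].
- apply (is_series_decr_1 (V := R_NormedModule)).
  unfold plus, opp; simpl.
  replace (b + f 0%Z + - f 0%Z) with b by ring. exact Hb.
- apply is_series_ext with (fun n => f (Z.of_nat (S n))).
  { intros n. f_equal; lia. }
  apply (is_series_incr_1 (V := R_NormedModule) (fun n => f (Z.of_nat n))).
  unfold plus; simpl. replace (a - f 0%Z + f 0%Z) with a by ring. exact Ha.
Qed.

Lemma is_bisum_pred f l : is_bisum f l -> is_bisum (fun k => f (k - 1)%Z) l.
Proof.
intros H. apply is_bisum_opp, is_bisum_succ, is_bisum_opp in H.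
eapply is_bisum_ext; [|exact H]. intros k; simpl. f_equal. lia.
Qed.

Lemma is_bisum_single f k0 : (forall k, k <> k0 -> f k = 0) -> is_bisum f (f k0).
Proof.
assert (H0 : forall g, (forall k, k <> 0%Z -> g k = 0) -> is_bisum g (g 0%Z)).
{ intros g Hg. exists (g 0%Z), 0. split; [|split; [|ring]].
  - apply (is_series_decr_1 (V := R_NormedModule)).
    unfold plus, opp; simpl. rewrite Rplus_opp_r.
    apply is_series_ext with (fun n => 0).
    { intros n. rewrite Hg; [easy|lia]. }
    exact is_series_zero.
  - apply is_series_ext with (fun n => 0).
    { intros n. rewrite Hg; [easy|lia]. }
    exact is_series_zero. }
assert (HS : forall n f, (forall k, k <> Z.of_nat n -> f k = 0) -> is_bisum f (f (Z.of_nat n))).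
{ induction n as [|n IH]; intros g Hg; [now apply H0|].
  specialize (IH (fun k => g (k + 1)%Z)).
  apply is_bisum_ext with (fun k => g (k - 1 + 1)%Z); [intros k; f_equal; lia|].
  apply is_bisum_pred with (f := fun k => g (k + 1)%Z).
  replace (Z.of_nat (S n)) with (Z.of_nat n + 1)%Z by lia. apply IH.
  intros k Hk. apply Hg. lia. }
intros Hf. destruct (Z_le_gt_dec 0 k0) as [Hk|Hk].
- rewrite <- (Z2Nat.id k0) by trivial. apply HS. intros k Hk'. apply Hf. lia.
- assert (H := HS (Z.to_nat (- k0)) (fun k => f (- k)%Z)).
  apply is_bisum_ext with (fun k => f (- - k)%Z); [intros k; f_equal; lia|].
  apply is_bisum_opp with (f := fun k => f (- k)%Z).
  replace (f k0) with (f (- Z.of_nat (Z.to_nat (- k0)))%Z) by (f_equal; lia).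
  apply H. intros k Hk'. apply Hf. lia.
Qed.

Lemma is_bisum_zero f : (forall k, f k = 0) -> is_bisum f 0.
Proof.
intros H. replace 0 with (f 0%Z) by apply H. apply is_bisum_single. auto.
Qed.

Definition bisummable (f : Z -> R) : Prop :=
  ex_series (fun n => Rabs (f (Z.of_nat n))) /\
  ex_series (fun n => Rabs (f (- Z.of_nat (S n))%Z)).

Lemma bisummable_is_bisum f : bisummable f -> exists l, is_bisum f l.
Proof.
intros [H1 H2]. apply ex_series_Rabs in H1, H2. destruct H1 as [a Ha], H2 as [b Hb].
exists (a + b), a, b. auto.
Qed.

Lemma is_lim_seq_bisum_dominated (f : nat -> Z -> R) (g M : Z -> R) (l : nat -> R) (m : R) :
  (forall n k, Rabs (f n k) <= M k) -> bisummable M ->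
  (forall k, is_lim_seq (fun n => f n k) (g k)) ->
  (forall n, is_bisum (f n) (l n)) -> is_bisum g m -> is_lim_seq l m.
Proof.
intros Hd [HM1 HM2] Hl Hf (a & b & Ha & Hb & ->).
assert (HMp : forall k, M k = Rabs (M k)).
{ intros k. rewrite Rabs_pos_eq; trivial.
  eapply Rle_trans; [apply Rabs_pos|apply (Hd O k)]. }
apply is_lim_seq_ext with (fun n => Series (fun i => f n (Z.of_nat i)) + Series (fun i => f n (- Z.of_nat (S i))%Z)).
{ intros n. destruct (Hf n) as (a' & b' & Ha' & Hb' & E).
  apply is_series_unique in Ha', Hb'. rewrite Ha', Hb'. auto. }
rewrite <- (is_series_unique _ _ Ha), <- (is_series_unique _ _ Hb).
apply is_lim_seq_plus'.
- apply (is_lim_seq_Series_dominated (fun n i => f n (Z.of_nat i)) _ (fun i => M (Z.of_nat i))); auto.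
  eapply ex_series_ext; [|exact HM1]. intros i; symmetry; apply HMp.
- apply (is_lim_seq_Series_dominated (fun n i => f n (- Z.of_nat (S i))%Z) _ (fun i => M (- Z.of_nat (S i))%Z)); auto.
  eapply ex_series_ext; [|exact HM2]. intros i; symmetry; apply HMp.
Qed.

(** * Factorials with weights *)

(** The index runs below [n], so that the empty product is available. *)
Fixpoint prodn (f : nat -> R) (n : nat) : R :=
  match n with O => 1 | S m => prodn f m * f m end.

Lemma prodn_pos f n : (forall i, 0 < f i) -> 0 < prodn f n.
Proof.
intros H. induction n as [|n IH]; simpl; [lra|]. now apply Rmult_lt_0_compat.
Qed.

Definition wfact (W : R -> R) (n : nat) : R := prodn (fun i => W (INR (S i))) n.

(** The reciprocal of the factorial [W 1 * ... * W m], extended by [0] to negative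
[m] as the reciprocal of the Gamma function is. This makes the binomial
coefficients built from it vanish outside their range and satisfy their
recurrences on all of [Z], without boundary cases. The weights [W x = x] and
[W x = 1 - q^(2x)] give the ordinary and the Gaussian binomial coefficients. *)
Definition inv_wfact (W : R -> R) (m : Z) : R :=
  if Z_lt_dec m 0 then 0 else / wfact W (Z.to_nat m).

(** At [m = 0] both sides vanish because [W 0 = 0]; this is what extends the
recurrence of the factorial across zero. *)
Lemma inv_wfact_pred W m : W 0 = 0 -> (forall x, 0 < x -> 0 < W x) ->
  inv_wfact W (m - 1) = W (IZR m) * inv_wfact W m.
Proof.
intros W0 HW. unfold inv_wfact.
destruct (Z_lt_dec (m - 1) 0) as [H1|H1], (Z_lt_dec m 0) as [H2|H2]; try lia.
- ring.
- replace m with 0%Z by lia. rewrite W0. ring.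
- replace (Z.to_nat m) with (S (Z.to_nat (m - 1))) by lia.
  change (wfact W (S (Z.to_nat (m - 1)))) with
    (wfact W (Z.to_nat (m - 1)) * W (INR (S (Z.to_nat (m - 1))))).
  assert (Hm : INR (S (Z.to_nat (m - 1))) = IZR m) by (rewrite INR_IZR_INZ; f_equal; lia).
  rewrite Hm.
  assert (Hp : 0 < IZR m) by (apply IZR_lt; lia).
  assert (Hf : 0 < wfact W (Z.to_nat (m - 1))).
  { apply prodn_pos. intros i. apply HW, lt_0_INR. lia. }
  specialize (HW _ Hp). field. lra.
Qed.

Lemma inv_wfact_neg W m : (m < 0)%Z -> inv_wfact W m = 0.
Proof. intros H. unfold inv_wfact. destruct (Z_lt_dec m 0); [easy|lia]. Qed.

Lemma inv_wfact_nat W n : inv_wfact W (Z.of_nat n) = / wfact W n.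
Proof.
unfold inv_wfact. destruct (Z_lt_dec _ 0); [lia|]. now rewrite Nat2Z.id.
Qed.

(** * The finite triple product *)

Definition qweight (s x : R) : R := 1 - exp (- (2 * s) * x).

Lemma qweight_0 s : qweight s 0 = 0.
Proof. unfold qweight. rewrite Rmult_0_r, exp_0. ring. Qed.

Lemma qweight_pos s x : 0 < s -> 0 < x -> 0 < qweight s x.
Proof.
intros Hs Hx. unfold qweight.
assert (exp (- (2 * s) * x) < 1); [|lra].
rewrite <- exp_0. apply exp_increasing. nra.
Qed.

(** With [q = exp (- s)] this is [q^(k^2 + e k)]: the coefficients of [theta3] for
[e = 0], and those of [theta2], up to the factor [q^(1/4)], for [e = 1]. *)
Definition gauss (s : R) (e : nat) (k : Z) : R :=
  exp (- s * (IZR k ^ 2 + INR e * IZR k)).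

(** The Gaussian binomial coefficient of [2n + e] over [n - k] in base [q^2]. *)
Definition qbinom (s : R) (e n : nat) (k : Z) : R :=
  wfact (qweight s) (2 * n + e) *
  (inv_wfact (qweight s) (Z.of_nat (n + e) + k) * inv_wfact (qweight s) (Z.of_nat n - k)).

Definition qfactor (s : R) (e j : nat) : R := exp (- s * INR (2 * j + 1 + e)).

Definition qprod (s : R) (e : nat) (x : R) (n : nat) : R :=
  prodn (fun j => 1 + 2 * x * qfactor s e j + qfactor s e j ^ 2) n.

Lemma qprod_succ s e x n :
  qprod s e x (S n) = qprod s e x n * (1 + 2 * x * qfactor s e n + qfactor s e n ^ 2).
Proof. reflexivity. Qed.

(** Multiplying by the factor [1 + Q (z + 1/z) + Q^2] of the product combines
three neighbouring coefficients. Up to the powers of [q], it is the Pascal rule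
of the Gaussian binomial coefficients applied twice. *)
Lemma qbinom_succ s e n k : 0 < s ->
  qbinom s e (S n) k * gauss s e k =
  (1 + qfactor s e n ^ 2) * (qbinom s e n k * gauss s e k) +
  qfactor s e n * (qbinom s e n (k - 1) * gauss s e (k - 1)) +
  qfactor s e n * (qbinom s e n (k + 1) * gauss s e (k + 1)).
Proof.
intros Hs. unfold qbinom.
set (W := qweight s). set (f := wfact W (2 * n + e)).
set (m := (Z.of_nat (S n + e) + k)%Z). set (m' := (Z.of_nat (S n) - k)%Z).
assert (P := fun j => inv_wfact_pred W j (qweight_0 s) (fun x => qweight_pos s x Hs)).
replace (Z.of_nat (n + e) + k)%Z with (m - 1)%Z by lia.
replace (Z.of_nat n - k)%Z with (m' - 1)%Z by lia.
replace (Z.of_nat (n + e) + (k - 1))%Z with (m - 1 - 1)%Z by lia.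
replace (Z.of_nat n - (k - 1))%Z with m' by lia.
replace (Z.of_nat (n + e) + (k + 1))%Z with m by lia.
replace (Z.of_nat n - (k + 1))%Z with (m' - 1 - 1)%Z by lia.
rewrite !P.
set (u := inv_wfact W m). set (u' := inv_wfact W m').
replace (2 * S n + e)%nat with (S (S (2 * n + e))) by lia.
change (wfact W (S (S (2 * n + e)))) with
  (f * W (INR (S (2 * n + e))) * W (INR (S (S (2 * n + e))))).
set (al := exp (- (2 * s) * IZR m)). set (be := exp (- (2 * s) * IZR m')).
set (ip := exp (2 * s)).
assert (Em : IZR m = INR n + 1 + INR e + IZR k).
{ unfold m. rewrite plus_IZR, <- INR_IZR_INZ, plus_INR, S_INR. ring. }
assert (Em' : IZR m' = INR n + 1 - IZR k).
{ unfold m'. rewrite minus_IZR, <- INR_IZR_INZ, S_INR. ring. }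
assert (Nr : INR (2 * n + e) = 2 * INR n + INR e).
{ rewrite plus_INR, mult_INR. simpl. ring. }
assert (E1 : W (IZR m) = 1 - al) by reflexivity.
assert (E2 : W (IZR m') = 1 - be) by reflexivity.
assert (E3 : W (IZR (m - 1)) = 1 - al * ip).
{ unfold W, qweight, al, ip. rewrite <- exp_plus, minus_IZR. do 2 f_equal. ring. }
assert (E4 : W (IZR (m' - 1)) = 1 - be * ip).
{ unfold W, qweight, be, ip. rewrite <- exp_plus, minus_IZR. do 2 f_equal. ring. }
assert (E5 : W (INR (S (2 * n + e))) = 1 - al * be * ip).
{ unfold W, qweight, al, be, ip. rewrite <- !exp_plus, S_INR, Nr, Em, Em'. do 2 f_equal. ring. }
assert (E6 : W (INR (S (S (2 * n + e)))) = 1 - al * be).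
{ unfold W, qweight, al, be. rewrite <- !exp_plus, !S_INR, Nr, Em, Em'. do 2 f_equal. ring. }
assert (Qr : INR (2 * n + 1 + e) = 2 * INR n + 1 + INR e).
{ rewrite !plus_INR, mult_INR. simpl. ring. }
assert (E7 : qfactor s e n ^ 2 = al * be * ip).
{ rewrite <- Rsqr_pow2. unfold Rsqr, qfactor, al, be, ip. rewrite <- !exp_plus, Qr, Em, Em'.
  f_equal. ring. }
assert (E8 : qfactor s e n * gauss s e (k - 1) = be * gauss s e k).
{ unfold qfactor, gauss, be. rewrite <- !exp_plus, Qr, Em', minus_IZR. f_equal. ring. }
assert (E9 : qfactor s e n * gauss s e (k + 1) = al * gauss s e k).
{ unfold qfactor, gauss, al. rewrite <- !exp_plus, Qr, Em, plus_IZR. f_equal. ring. }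
rewrite E7.
replace (qfactor s e n * (f * (W (IZR (m - 1)) * (W (IZR m) * u) * u') * gauss s e (k - 1)))
  with (qfactor s e n * gauss s e (k - 1) * (f * (W (IZR (m - 1)) * (W (IZR m) * u) * u'))) by ring.
replace (qfactor s e n * (f * (u * (W (IZR (m' - 1)) * (W (IZR m') * u'))) * gauss s e (k + 1)))
  with (qfactor s e n * gauss s e (k + 1) * (f * (u * (W (IZR (m' - 1)) * (W (IZR m') * u'))))) by ring.
rewrite E8, E9, E1, E2, E3, E4, E5, E6. ring.
Qed.

Lemma qbinom_step s e n (c : Z -> R) l l1 l2 : 0 < s ->
  is_bisum (fun k => qbinom s e n k * gauss s e k * c k) l ->
  is_bisum (fun k => qbinom s e n k * gauss s e k * c (k + 1)%Z) l1 ->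
  is_bisum (fun k => qbinom s e n k * gauss s e k * c (k - 1)%Z) l2 ->
  is_bisum (fun k => qbinom s e (S n) k * gauss s e k * c k)
    ((1 + qfactor s e n ^ 2) * l + qfactor s e n * (l1 + l2)).
Proof.
intros Hs H H1 H2. apply is_bisum_pred in H1. apply is_bisum_succ in H2.
assert (H3 := is_bisum_plus _ _ _ _ (is_bisum_scal (1 + qfactor s e n ^ 2) _ _ H)
  (is_bisum_scal (qfactor s e n) _ _ (is_bisum_plus _ _ _ _ H1 H2))).
eapply is_bisum_ext; [|exact H3]. intros k. cbv beta.
rewrite qbinom_succ by trivial.
replace (k - 1 + 1)%Z with k by lia. replace (k + 1 - 1)%Z with k by lia. ring.
Qed.

(** The sequence [c] stands for the powers of a variable [z] with [z + 1/z = 2 x]: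
the recurrence says that multiplication by [z + 1/z] acts on [c] as [2 x].
Induction on [n] with [qbinom_step] adds one factor at a time. *)
Lemma finite_triple_product s e x (base : (Z -> R) -> R) (c : Z -> R) : 0 < s ->
  (forall c, is_bisum (fun k => qbinom s e 0 k * gauss s e k * c k) (base c)) ->
  (forall k, c (k + 1)%Z + c (k - 1)%Z = 2 * x * c k) ->
  forall n, is_bisum (fun k => qbinom s e n k * gauss s e k * c k) (qprod s e x n * base c).
Proof.
intros Hs Hb Hc n.
assert (Hex : forall n c, exists l, is_bisum (fun k => qbinom s e n k * gauss s e k * c k) l).
{ clear n. induction n as [|n IH]; intros d; [exists (base d); apply Hb|].
  destruct (IH d) as [l Hl], (IH (fun k => d (k + 1)%Z)) as [l1 Hl1],
    (IH (fun k => d (k - 1)%Z)) as [l2 Hl2].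
  eexists. now apply qbinom_step; eassumption. }
induction n as [|n IH].
- unfold qprod; simpl. rewrite Rmult_1_l. apply Hb.
- destruct (Hex n (fun k => c (k + 1)%Z)) as [l1 Hl1], (Hex n (fun k => c (k - 1)%Z)) as [l2 Hl2].
  assert (E : l1 + l2 = 2 * x * (qprod s e x n * base c)).
  { apply is_bisum_unique with (fun k => 2 * x * (qbinom s e n k * gauss s e k * c k)).
    - eapply is_bisum_ext; [|exact (is_bisum_plus _ _ _ _ Hl1 Hl2)]. intros k. cbv beta.
      rewrite <- Rmult_plus_distr_l, Hc. ring.
    - now apply is_bisum_scal. }
  assert (H := qbinom_step s e n c _ _ _ Hs IH Hl1 Hl2). rewrite E in H.
  replace (qprod s e x (S n) * base c) with
    ((1 + qfactor s e n ^ 2) * (qprod s e x n * base c) +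
      qfactor s e n * (2 * x * (qprod s e x n * base c))); [exact H|].
  unfold qprod; simpl prodn. ring.
Qed.

(** The sums of [finite_triple_product] for the empty product. *)
Lemma qbinom_base0 s (c : Z -> R) :
  is_bisum (fun k => qbinom s 0 0 k * gauss s 0 k * c k) (c 0%Z).
Proof.
replace (c 0%Z) with (qbinom s 0 0 0 * gauss s 0 0 * c 0%Z).
- apply (is_bisum_single (fun k => qbinom s 0 0 k * gauss s 0 k * c k) 0).
  intros k Hk. unfold qbinom. destruct (Z_lt_dec k 0).
  + rewrite (inv_wfact_neg _ (_ + k)) by lia. ring.
  + rewrite (inv_wfact_neg _ (_ - k)) by lia. ring.
- unfold qbinom, gauss. simpl. rewrite (inv_wfact_nat _ 0). unfold wfact; simpl.
  replace (- s * (0 * (0 * 1) + 0 * 0)) with 0 by ring. rewrite exp_0. field.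
Qed.

Lemma qbinom_base1 s (c : Z -> R) : 0 < s ->
  is_bisum (fun k => qbinom s 1 0 k * gauss s 1 k * c k) (c 0%Z + c (-1)%Z).
Proof.
intros Hs.
assert (Hw : wfact (qweight s) 1 <> 0).
{ unfold wfact; simpl. assert (H := qweight_pos s 1 Hs ltac:(lra)). lra. }
apply is_bisum_ext with (fun k => (if Z.eq_dec k 0 then c k else 0) + (if Z.eq_dec k (-1) then c k else 0)).
- intros k. destruct (Z.eq_dec k 0) as [->|H0]; [|destruct (Z.eq_dec k (-1)) as [->|H1]].
  + unfold qbinom, gauss. simpl Z.of_nat. simpl Z.add. simpl Z.sub.
    rewrite (inv_wfact_nat _ 0), (inv_wfact_nat _ 1). simpl.
    replace (- s * (0 * (0 * 1) + 1 * 0)) with 0 by ring. rewrite exp_0.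
    change (wfact (qweight s) 0) with 1. field; trivial.
  + unfold qbinom, gauss. simpl Z.of_nat. simpl Z.add. simpl Z.sub.
    rewrite (inv_wfact_nat _ 0), (inv_wfact_nat _ 1). simpl.
    replace (- s * (-1 * (-1 * 1) + 1 * -1)) with 0 by ring. rewrite exp_0.
    change (wfact (qweight s) 0) with 1. field; trivial.
  + unfold qbinom. destruct (Z_lt_dec k 0).
    * rewrite (inv_wfact_neg _ (_ + k)) by lia. ring.
    * rewrite (inv_wfact_neg _ (_ - k)) by lia. ring.
- apply is_bisum_plus.
  + exact (is_bisum_single (fun k => if Z.eq_dec k 0 then c k else 0) 0
      ltac:(intros k Hk; cbv beta; destruct (Z.eq_dec k 0); [contradiction|reflexivity])).
  + exact (is_bisum_single (fun k => if Z.eq_dec k (-1) then c k else 0) (-1)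
      ltac:(intros k Hk; cbv beta; destruct (Z.eq_dec k (-1)); [contradiction|reflexivity])).
Qed.

(** * The limit of the triple product *)

Lemma prodn_le f g n : (forall i, 0 <= f i <= g i) -> 0 <= prodn f n <= prodn g n.
Proof.
intros H. induction n as [|n IH]; simpl; [lra|].
specialize (H n). split; [apply Rmult_le_pos|apply Rmult_le_compat]; lra.
Qed.

(** Bounding each factor below by an exponential leaves a geometric series in the
exponent. *)
Lemma prodn_euler_lower (s : R) : 0 < s ->
  exists B, 0 < B /\ forall n, B <= prodn (fun i => 1 - exp (- s * INR (S i))) n.
Proof.
intros Hs. set (r := exp (- s)).
assert (Hr : 0 < r < 1).
{ split; [apply exp_pos|]. rewrite <- exp_0. apply exp_increasing. lra. }
assert (Er : forall i, exp (- s * INR (S i)) = r ^ (S i)).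
{ induction i as [|i IH].
  - simpl. rewrite !Rmult_1_r. reflexivity.
  - rewrite S_INR, Rmult_plus_distr_l, Rmult_1_r, exp_plus, IH. fold r. simpl; ring. }
exists (exp (- (r / (1 - r) ^ 2))). split; [apply exp_pos|].
assert (H : forall n, exp (- ((r - r ^ (S n)) / (1 - r) ^ 2)) <=
   prodn (fun i => 1 - exp (- s * INR (S i))) n).
{ induction n as [|n IH].
  - simpl. replace (- ((r - r * 1) / ((1 - r) * ((1 - r) * 1)))) with 0 by (field; lra).
    rewrite exp_0. lra.
  - change (prodn (fun i => 1 - exp (- s * INR (S i))) (S n)) with
      (prodn (fun i => 1 - exp (- s * INR (S i))) n * (1 - exp (- s * INR (S n)))).
    replace (- ((r - r ^ S (S n)) / (1 - r) ^ 2)) with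
      (- ((r - r ^ S n) / (1 - r) ^ 2) + - (r ^ S n / (1 - r))) by (simpl; field; lra).
    rewrite exp_plus.
    apply Rmult_le_compat; try (left; apply exp_pos); trivial.
    rewrite Er.
    assert (Hp : 0 < r ^ S n <= r).
    { split; [apply pow_lt; lra|]. simpl. rewrite <- (Rmult_1_r r) at 3.
      apply Rmult_le_compat_l; [lra|]. rewrite <- (pow1 n). apply pow_incr. lra. }
    eapply Rle_trans; [|apply exp_opp_div_le; lra].
    apply exp_le, Ropp_le_contravar, Rmult_le_compat_l; [lra|].
    apply Rinv_le_contravar; lra. }
intros n. eapply Rle_trans; [|apply H].
assert (Hp : 0 < r ^ S n) by (apply pow_lt; lra).
assert (Hd : - (r / (1 - r) ^ 2) < - ((r - r ^ S n) / (1 - r) ^ 2)).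
{ apply Ropp_lt_contravar. apply Rmult_lt_compat_r; [|lra].
  apply Rinv_0_lt_compat, pow_lt. lra. }
left. now apply exp_increasing.
Qed.

Lemma wfact_qweight_le_1 s n : 0 < s -> 0 < wfact (qweight s) n <= 1.
Proof.
intros Hs. unfold wfact. split.
- apply prodn_pos. intros i. apply qweight_pos; trivial. apply lt_0_INR. lia.
- induction n as [|n IH]; [apply Rle_refl|].
  change (prodn (fun i => qweight s (INR (S i))) (S n)) with
    (prodn (fun i => qweight s (INR (S i))) n * qweight s (INR (S n))).
  assert (H := qweight_pos s (INR (S n)) Hs ltac:(apply lt_0_INR; lia)).
  assert (H' : qweight s (INR (S n)) <= 1).
  { unfold qweight. assert (H' := exp_pos (- (2 * s) * INR (S n))). lra. }
  assert (Hp : 0 < prodn (fun i => qweight s (INR (S i))) n).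
  { apply prodn_pos. intros i. apply qweight_pos; trivial. apply lt_0_INR. lia. }
  nra.
Qed.

Lemma wfact_qweight_lim s : 0 < s ->
  exists w, 0 < w /\ is_lim_seq (wfact (qweight s)) w /\ forall n, w <= wfact (qweight s) n.
Proof.
intros Hs. destruct (prodn_euler_lower (2 * s)) as (B & HB & H); [lra|].
assert (Hd : forall n, wfact (qweight s) (S n) <= wfact (qweight s) n).
{ intros n. change (wfact (qweight s) (S n)) with (wfact (qweight s) n * qweight s (INR (S n))).
  destruct (wfact_qweight_le_1 s n Hs).
  unfold qweight at 2. assert (H' := exp_pos (- (2 * s) * INR (S n))). nra. }
destruct (ex_finite_lim_seq_decr (wfact (qweight s)) B Hd H) as [w Hw].
exists w. repeat split; trivial.
- apply Rlt_le_trans with B; trivial.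
  apply (is_lim_seq_le (fun _ => B) (wfact (qweight s)) B w); trivial. apply is_lim_seq_const.
- intros n. apply (is_lim_seq_decr_compare (wfact (qweight s))); trivial.
Qed.

Lemma is_lim_seq_inv_wfact_shift (W : R -> R) (l : R) (d : nat) (k : Z) :
  is_lim_seq (fun n => inv_wfact W (Z.of_nat n)) l ->
  is_lim_seq (fun n => inv_wfact W (Z.of_nat (n + d) + k)) l.
Proof.
intros H. apply (is_lim_seq_incr_n _ (Z.to_nat (Z.abs k))).
apply is_lim_seq_ext with (fun n => inv_wfact W (Z.of_nat (n + Z.to_nat (Z.of_nat d + Z.abs k + k)))).
- intros n. f_equal. lia.
- now apply (is_lim_seq_incr_n (fun n => inv_wfact W (Z.of_nat n))).
Qed.

(** The normalising factors [kap] depend neither on [x] nor on [c]; they cancel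
in quotients, and only their positivity matters. Once normalised, the Gaussian
binomial coefficients lie in [[0, 1]] and tend to [1], so dominated convergence
applies to [finite_triple_product]. *)
Lemma triple_product_limit s e : 0 < s -> exists kap : nat -> R, exists k0, 0 < k0 /\
  (forall n, k0 <= kap n) /\
  forall x base c l,
  (forall c, is_bisum (fun k => qbinom s e 0 k * gauss s e k * c k) (base c)) ->
  (forall k, c (k + 1)%Z + c (k - 1)%Z = 2 * x * c k) ->
  bisummable (fun k => gauss s e k * c k) ->
  is_bisum (fun k => gauss s e k * c k) l ->
  is_lim_seq (fun n => kap n * (qprod s e x n * base c)) l.
Proof.
intros Hs. destruct (wfact_qweight_lim s Hs) as (w & Hw & Hl & Hle).
exists (fun n => w ^ 2 / wfact (qweight s) (2 * n + e)), (w ^ 2).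
assert (Hw2 : 0 < w ^ 2) by now apply pow_lt.
split; [exact Hw2|split].
{ intros n. destruct (wfact_qweight_le_1 s (2 * n + e) Hs) as [Hf0 Hf1].
  unfold Rdiv. rewrite <- (Rmult_1_r (w ^ 2)) at 1. apply Rmult_le_compat_l; [lra|].
  rewrite <- Rinv_1. apply Rinv_le_contravar; lra. }
intros x base c l Hb Hc Hsum Hbis.
assert (Hi : forall m, 0 <= inv_wfact (qweight s) m <= / w).
{ intros m. unfold inv_wfact. destruct (Z_lt_dec m 0).
  - split; [lra|]. left. now apply Rinv_0_lt_compat.
  - split; [left; apply Rinv_0_lt_compat; now apply wfact_qweight_le_1|].
    now apply Rinv_le_contravar. }
assert (Hil : is_lim_seq (fun n => inv_wfact (qweight s) (Z.of_nat n)) (/ w)).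
{ apply is_lim_seq_ext with (fun n => / wfact (qweight s) n).
  - intros n. now rewrite inv_wfact_nat.
  - apply (is_lim_seq_inv _ w); trivial. intros E; injection E; lra. }
apply is_lim_seq_bisum_dominated with
  (f := fun n k => w ^ 2 / wfact (qweight s) (2 * n + e) * (qbinom s e n k * gauss s e k * c k))
  (g := fun k => gauss s e k * c k)
  (M := fun k => Rabs (gauss s e k * c k)); trivial.
- intros n k. unfold qbinom.
  destruct (wfact_qweight_le_1 s (2 * n + e) Hs) as [Hp _].
  set (i1 := inv_wfact _ _). set (i2 := inv_wfact _ _).
  replace (w ^ 2 / _ * _) with ((w * i1) * (w * i2) * (gauss s e k * c k)) by (field; lra).
  rewrite Rabs_mult.
  rewrite <- (Rmult_1_l (Rabs (gauss s e k * c k))) at 2.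
  apply Rmult_le_compat_r; [apply Rabs_pos|].
  assert (A : forall m, 0 <= w * inv_wfact (qweight s) m <= 1).
  { intros m. destruct (Hi m) as [Hi1 Hi2]. split; [apply Rmult_le_pos; lra|].
    replace 1 with (w * / w) by (field; lra). apply Rmult_le_compat_l; lra. }
  assert (A1 := A (Z.of_nat (n + e) + k)%Z). assert (A2 := A (Z.of_nat n - k)%Z).
  fold i1 in A1. fold i2 in A2. rewrite Rabs_pos_eq; nra.
- destruct Hsum as [S1 S2]. split;
    [eapply ex_series_ext; [|exact S1]|eapply ex_series_ext; [|exact S2]];
    intros n; cbv beta; symmetry; apply Rabs_Rabsolu.
- intros k.
  apply is_lim_seq_ext with (fun n => w * w * (inv_wfact (qweight s) (Z.of_nat (n + e) + k) *
     inv_wfact (qweight s) (Z.of_nat (n + 0) + - k)) * (gauss s e k * c k)).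
  + intros n. unfold qbinom. rewrite Nat.add_0_r. change (Z.of_nat n + - k)%Z with (Z.of_nat n - k)%Z.
    destruct (wfact_qweight_le_1 s (2 * n + e) Hs) as [Hp _]. field. lra.
  + replace (Finite (gauss s e k * c k)) with
      (Finite (w * w * (/ w * / w) * (gauss s e k * c k))) by (f_equal; field; lra).
    apply is_lim_seq_mult'; [|apply is_lim_seq_const].
    apply is_lim_seq_mult'; [apply is_lim_seq_const|].
    apply is_lim_seq_mult'; now apply is_lim_seq_inv_wfact_shift.
- intros n. apply is_bisum_scal. now apply finite_triple_product.
Qed.

(** For [x >= -1] each factor is at least [(1 - Q)^2]. The bound is uniform in [n],
so the limit of the product does not vanish. *)
Lemma qprod_lower s e : 0 < s -> exists B, 0 < B /\
  forall x n, -1 <= x -> B <= qprod s e x n.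
Proof.
intros Hs. destruct (prodn_euler_lower s Hs) as (B & HB & H).
exists (B * B). split; [nra|]. intros x n Hx.
assert (H0 := H n).
apply Rle_trans with (prodn (fun i => 1 - exp (- s * INR (S i))) n *
  prodn (fun i => 1 - exp (- s * INR (S i))) n).
{ apply Rmult_le_compat; lra. }
assert (E : forall f m, prodn f m * prodn f m = prodn (fun i => f i * f i) m).
{ intros f m. induction m as [|m IH]; simpl; [ring|]. rewrite <- IH. ring. }
rewrite E. unfold qprod. apply prodn_le. intros i.
assert (Hq : qfactor s e i <= exp (- s * INR (S i))).
{ unfold qfactor. apply exp_le.
  assert (INR (S i) <= INR (2 * i + 1 + e)) by (apply le_INR; lia).
  nra. }
assert (Hq0 : 0 < qfactor s e i) by apply exp_pos.
assert (Hq1 : exp (- s * INR (S i)) < 1).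
{ rewrite <- exp_0. apply exp_increasing. assert (0 < INR (S i)) by (apply lt_0_INR; lia). nra. }
nra.
Qed.

(** * Binomial sums over residue classes *)

(** The binomial coefficient of [2m] over [m + k]. *)
Definition cbinom (m : nat) (k : Z) : R :=
  wfact (fun x => x) (2 * m) *
  (inv_wfact (fun x => x) (Z.of_nat m + k) * inv_wfact (fun x => x) (Z.of_nat m - k)).

Lemma inv_fact_pred m :
  inv_wfact (fun x => x) (m - 1) = IZR m * inv_wfact (fun x => x) m.
Proof. apply inv_wfact_pred; auto. Qed.

(** The Pascal rule applied twice. *)
Lemma cbinom_succ m k :
  cbinom (S m) k = 2 * cbinom m k + cbinom m (k - 1) + cbinom m (k + 1).
Proof.
unfold cbinom. set (I := inv_wfact (fun x => x)).
set (x := (Z.of_nat (S m) + k)%Z). set (y := (Z.of_nat (S m) - k)%Z).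
replace (Z.of_nat m + k)%Z with (x - 1)%Z by lia.
replace (Z.of_nat m - k)%Z with (y - 1)%Z by lia.
replace (Z.of_nat m + (k - 1))%Z with (x - 1 - 1)%Z by lia.
replace (Z.of_nat m - (k - 1))%Z with y by lia.
replace (Z.of_nat m + (k + 1))%Z with x by lia.
replace (Z.of_nat m - (k + 1))%Z with (y - 1 - 1)%Z by lia.
unfold I. rewrite !inv_fact_pred.
replace (2 * S m)%nat with (S (S (2 * m))) by lia.
set (f := wfact (fun x => x) (2 * m)).
change (wfact (fun x => x) (S (S (2 * m)))) with (f * INR (S (2 * m)) * INR (S (S (2 * m)))).
assert (Ex : IZR x = INR m + 1 + IZR k).
{ unfold x. rewrite plus_IZR, <- INR_IZR_INZ, S_INR. ring. }
assert (Ey : IZR y = INR m + 1 - IZR k).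
{ unfold y. rewrite minus_IZR, <- INR_IZR_INZ, S_INR. ring. }
rewrite !S_INR, mult_INR, !minus_IZR, Ex, Ey. simpl (INR 2). ring.
Qed.

Lemma cbinom_ratio m k :
  cbinom m (k + 1) * (INR m + IZR k + 1) = cbinom m k * (INR m - IZR k).
Proof.
unfold cbinom.
replace (Z.of_nat m + k)%Z with (Z.of_nat m + (k + 1) - 1)%Z by lia.
replace (Z.of_nat m - (k + 1))%Z with (Z.of_nat m - k - 1)%Z by lia.
rewrite !inv_fact_pred, !minus_IZR, !plus_IZR, <- !INR_IZR_INZ. ring.
Qed.

Lemma cbinom_opp m k : cbinom m (- k) = cbinom m k.
Proof.
unfold cbinom.
replace (Z.of_nat m + - k)%Z with (Z.of_nat m - k)%Z by lia.
replace (Z.of_nat m - - k)%Z with (Z.of_nat m + k)%Z by lia. ring.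
Qed.

Lemma cbinom_nonneg m k : 0 <= cbinom m k.
Proof.
assert (Hp : forall n, 0 < wfact (fun x => x) n).
{ intros n. apply prodn_pos. intros i. apply lt_0_INR. lia. }
assert (Hi : forall z, 0 <= inv_wfact (fun x => x) z).
{ intros z. unfold inv_wfact. destruct (Z_lt_dec z 0); [lra|].
  left. now apply Rinv_0_lt_compat. }
unfold cbinom. apply Rmult_le_pos; [left; apply Hp|]. now apply Rmult_le_pos.
Qed.

Lemma cbinom_0_pos m : 0 < cbinom m 0.
Proof.
assert (Hp : forall n, 0 < wfact (fun x => x) n).
{ intros n. apply prodn_pos. intros i. apply lt_0_INR. lia. }
unfold cbinom. rewrite Z.add_0_r, Z.sub_0_r, inv_wfact_nat.
apply Rmult_lt_0_compat; [apply Hp|].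
apply Rmult_lt_0_compat; now apply Rinv_0_lt_compat.
Qed.

Lemma cbinom_out m k : (Z.of_nat m < Z.abs k)%Z -> cbinom m k = 0.
Proof.
intros H. unfold cbinom. destruct (Z_lt_dec k 0).
- rewrite (inv_wfact_neg _ (_ + k)) by lia. ring.
- rewrite (inv_wfact_neg _ (_ - k)) by lia. ring.
Qed.

(** The sum of [(2 cos x)^(2m) cos (2 j x)] over [x = PI l / N], [|l| <= M], where
[N = 2M + 1]; terms [l] and [- l] agree, hence the factor [2]. *)
Definition cos_sum (M m : nat) (j : Z) : R :=
  let term := fun l => (2 * cos (PI * INR l / INR (2 * M + 1))) ^ (2 * m) *
    cos (2 * IZR j * (PI * INR l / INR (2 * M + 1))) in
  2 * sum_n term M - term O.

Lemma cos_sum_succ M m j :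
  cos_sum M (S m) j = 2 * cos_sum M m j + cos_sum M m (j - 1) + cos_sum M m (j + 1).
Proof.
unfold cos_sum. cbv zeta.
assert (E : forall x, (2 * cos x) ^ (2 * S m) * cos (2 * IZR j * x) =
  2 * ((2 * cos x) ^ (2 * m) * cos (2 * IZR j * x)) +
  (2 * cos x) ^ (2 * m) * cos (2 * IZR (j - 1) * x) +
  (2 * cos x) ^ (2 * m) * cos (2 * IZR (j + 1) * x)).
{ intros x. replace (2 * S m)%nat with (2 + 2 * m)%nat by lia. rewrite pow_add.
  rewrite minus_IZR, plus_IZR.
  replace (2 * (IZR j - 1) * x) with (2 * IZR j * x - 2 * x) by ring.
  replace (2 * (IZR j + 1) * x) with (2 * IZR j * x + 2 * x) by ring.
  rewrite cos_minus, cos_plus, (cos_2a_cos x). ring. }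
rewrite E.
rewrite (sum_n_ext _ (fun l => plus (plus (scal 2 ((2 * cos (PI * INR l / INR (2 * M + 1))) ^ (2 * m) *
    cos (2 * IZR j * (PI * INR l / INR (2 * M + 1)))))
   ((2 * cos (PI * INR l / INR (2 * M + 1))) ^ (2 * m) *
    cos (2 * IZR (j - 1) * (PI * INR l / INR (2 * M + 1)))))
   ((2 * cos (PI * INR l / INR (2 * M + 1))) ^ (2 * m) *
    cos (2 * IZR (j + 1) * (PI * INR l / INR (2 * M + 1))))))
  by (intros l; apply E).
rewrite !sum_n_plus, sum_n_scal_l.
set (s0 := sum_n _ _). set (s1 := sum_n _ _). set (s2 := sum_n _ _).
change (scal 2 s0) with (2 * s0). change (plus (2 * s0) s1) with (2 * s0 + s1).
change (plus (2 * s0 + s1) s2) with (2 * s0 + s1 + s2). ring.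
Qed.

Lemma dirichlet_kernel x M :
  sin x * (2 * sum_n (fun l => cos (2 * INR l * x)) M - 1) = sin (INR (2 * M + 1) * x).
Proof.
induction M as [|M IH].
- rewrite sum_O. change (INR (2 * 0 + 1)) with 1. change (INR 0) with 0.
  replace (2 * 0 * x) with 0 by ring. rewrite cos_0, Rmult_1_l. ring.
- rewrite sum_Sn. set (S0 := sum_n _ M) in *.
  change (plus S0 (cos (2 * INR (S M) * x))) with (S0 + cos (2 * INR (S M) * x)).
  replace (INR (2 * S M + 1)) with (2 * INR (S M) + 1) by (rewrite plus_INR, mult_INR; simpl (INR 2); simpl (INR 1); ring).
  replace (INR (2 * M + 1)) with (2 * INR (S M) - 1) in IH
    by (rewrite plus_INR, mult_INR, S_INR; simpl (INR 2); simpl (INR 1); ring).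
  replace ((2 * INR (S M) + 1) * x) with (2 * INR (S M) * x + x) by ring.
  replace ((2 * INR (S M) - 1) * x) with (2 * INR (S M) * x - x) in IH by ring.
  rewrite sin_minus in IH. rewrite sin_plus.
  replace (sin x * (2 * (S0 + cos (2 * INR (S M) * x)) - 1)) with
    (sin x * (2 * S0 - 1) + 2 * sin x * cos (2 * INR (S M) * x)) by ring.
  rewrite IH. ring.
Qed.

(** The root of unity filter. Both sides obey the same recurrence in [m], so it
suffices to compare them for [m = 0], where the cosine sum is a Dirichlet
kernel at a multiple of [PI / N]. *)
Lemma residue_binomial_sum M m : forall j,
  is_bisum (fun k => cbinom m (j + k * Z.of_nat (2 * M + 1)))
    (cos_sum M m j / INR (2 * M + 1)).
Proof.
assert (HN : 0 < INR (2 * M + 1)) by (apply lt_0_INR; lia).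
induction m as [|m IH]; intros j.
- assert (E0 : forall k, cbinom 0 k = if Z.eq_dec k 0 then 1 else 0).
  { intros k. destruct (Z.eq_dec k 0) as [->|Hk].
    - unfold cbinom. simpl. rewrite (inv_wfact_nat _ 0). unfold wfact; simpl. field.
    - apply cbinom_out. lia. }
  set (N := Z.of_nat (2 * M + 1)).
  assert (HNi : IZR N = INR (2 * M + 1)) by (unfold N; now rewrite <- INR_IZR_INZ).
  destruct (Z.eq_dec (j mod N) 0) as [Hj|Hj].
  + apply Z.mod_divide in Hj; [|lia]. destruct Hj as [d Hd].
    replace (cos_sum M 0 j / INR (2 * M + 1)) with (cbinom 0 (j + (- d) * N)).
    * apply (is_bisum_single (fun k => cbinom 0 (j + k * N)) (- d)%Z).
      intros k Hk. rewrite E0. destruct (Z.eq_dec _ 0); [|easy]. exfalso. nia.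
    * rewrite E0. destruct (Z.eq_dec (j + - d * N) 0); [|exfalso; nia].
      unfold cos_sum. cbv zeta.
      assert (E1 : forall l, (2 * cos (PI * INR l / INR (2 * M + 1))) ^ (2 * 0) *
         cos (2 * IZR j * (PI * INR l / INR (2 * M + 1))) = 1).
      { intros l. simpl pow. rewrite Hd, mult_IZR, HNi.
        replace (2 * (IZR d * INR (2 * M + 1)) * (PI * INR l / INR (2 * M + 1)))
          with (2 * IZR (d * Z.of_nat l) * PI)
          by (rewrite mult_IZR, <- INR_IZR_INZ; field; lra).
        rewrite Rmult_1_l. rewrite Rmult_assoc, cos_2a.
        assert (S0 : sin (IZR (d * Z.of_nat l) * PI) = 0) by (apply sin_eq_0_1; now exists (d * Z.of_nat l)%Z).
        assert (SC := sin2_cos2 (IZR (d * Z.of_nat l) * PI)). unfold Rsqr in SC. nra. }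
      rewrite E1, (sum_n_ext _ (fun _ => 1)) by apply E1.
      rewrite sum_n_const. rewrite S_INR, plus_INR, mult_INR. simpl (INR 2). simpl (INR 1).
      field. rewrite plus_INR, mult_INR in HN. simpl (INR 2) in HN. simpl (INR 1) in HN. lra.
  + replace (cos_sum M 0 j / INR (2 * M + 1)) with 0.
    * apply is_bisum_zero. intros k. rewrite E0. destruct (Z.eq_dec _ 0) as [E|]; [|easy].
      exfalso. apply Hj. replace j with (- k * N)%Z by lia. apply Z.mod_mul. lia.
    * unfold cos_sum. cbv zeta.
      set (x := PI * IZR j / INR (2 * M + 1)).
      assert (E1 : forall l, (2 * cos (PI * INR l / INR (2 * M + 1))) ^ (2 * 0) *
         cos (2 * IZR j * (PI * INR l / INR (2 * M + 1))) = cos (2 * INR l * x)).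
      { intros l. simpl pow. rewrite Rmult_1_l. f_equal. unfold x. field. lra. }
      rewrite E1, (sum_n_ext _ (fun l => cos (2 * INR l * x))) by apply E1.
      simpl (INR 0). rewrite Rmult_0_r, Rmult_0_l, cos_0.
      assert (D := dirichlet_kernel x M).
      replace (INR (2 * M + 1) * x) with (IZR j * PI) in D by (unfold x; field; lra).
      rewrite (sin_eq_0_1 (IZR j * PI)) in D by now exists j.
      apply Rmult_integral in D. destruct D as [D|D].
      -- exfalso. apply sin_eq_0_0 in D. destruct D as [k Hk].
         apply Hj. assert (Ejk : j = (k * N)%Z).
         { apply eq_IZR. rewrite mult_IZR, HNi. unfold x in Hk.
           apply (Rmult_eq_reg_r PI); [|apply PI_neq0].
           replace (IZR k * INR (2 * M + 1) * PI) with (IZR k * PI * INR (2 * M + 1)) by ring.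
           rewrite <- Hk. field. lra. }
         rewrite Ejk. apply Z.mod_mul. lia.
      -- rewrite D. field. lra.
- assert (H := is_bisum_plus _ _ _ _ (is_bisum_plus _ _ _ _ (is_bisum_scal 2 _ _ (IH j)) (IH (j - 1)%Z)) (IH (j + 1)%Z)).
  replace (cos_sum M (S m) j / INR (2 * M + 1)) with
   (2 * (cos_sum M m j / INR (2 * M + 1)) + cos_sum M m (j - 1) / INR (2 * M + 1) +
    cos_sum M m (j + 1) / INR (2 * M + 1)) by (rewrite cos_sum_succ; field; lra).
  eapply is_bisum_ext; [|exact H]. intros k. cbv beta. rewrite cbinom_succ.
  set (N := Z.of_nat (2 * M + 1)).
  replace (j - 1 + k * N)%Z with (j + k * N - 1)%Z by ring.
  replace (j + 1 + k * N)%Z with (j + k * N + 1)%Z by ring. reflexivity.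
Qed.

(** * Central binomial coefficients are nearly Gaussian *)

Definition ncbinom (m : nat) (k : Z) : R := cbinom m k / cbinom m 0.

Lemma ncbinom_0 m : ncbinom m 0 = 1.
Proof. unfold ncbinom. assert (H := cbinom_0_pos m). field. lra. Qed.

Lemma ncbinom_nonneg m k : 0 <= ncbinom m k.
Proof.
unfold ncbinom. apply Rmult_le_pos; [apply cbinom_nonneg|].
left. apply Rinv_0_lt_compat, cbinom_0_pos.
Qed.

Lemma ncbinom_abs m k : ncbinom m k = ncbinom m (Z.of_nat (Z.abs_nat k)).
Proof.
unfold ncbinom. f_equal. destruct (Z_le_gt_dec 0 k).
- f_equal. lia.
- rewrite <- cbinom_opp. f_equal. lia.
Qed.

Lemma ncbinom_succ m k : (k <= m)%nat ->
  ncbinom m (Z.of_nat (S k)) = ncbinom m (Z.of_nat k) * ((INR m - INR k) / (INR m + INR k + 1)).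
Proof.
intros Hk. assert (H := cbinom_ratio m (Z.of_nat k)). rewrite <- INR_IZR_INZ in H.
replace (Z.of_nat k + 1)%Z with (Z.of_nat (S k)) in H by lia.
assert (H0 := cbinom_0_pos m). assert (Hm := pos_INR m). assert (Hk' := pos_INR k).
unfold ncbinom. apply (Rmult_eq_reg_r ((INR m + INR k + 1) * cbinom m 0)); [|nra].
transitivity (cbinom m (Z.of_nat (S k)) * (INR m + INR k + 1)); [field; lra|].
rewrite H. field. lra.
Qed.

(** The ratio of consecutive coefficients is [1 - (2k+1)/(m+k+1)], at most
[exp (- (2k+1)/(m+k+1))], and the odd numbers [2k+1] add up to a square. The
bound [K] freezes the denominator during the induction. *)
Lemma ncbinom_upper_aux m K : (K <= m)%nat -> forall k, (k <= K)%nat ->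
  ncbinom m (Z.of_nat k) <= exp (- (INR k ^ 2 / (INR m + INR K))).
Proof.
intros HK. induction k as [|k IH]; intros Hk.
- change (Z.of_nat 0) with 0%Z. rewrite ncbinom_0. change (INR 0) with 0.
  replace (0 ^ 2 / (INR m + INR K)) with 0 by (unfold Rdiv; ring).
  rewrite Ropp_0, exp_0. lra.
- rewrite ncbinom_succ by lia.
  assert (HKr : INR K <= INR m) by now apply le_INR.
  assert (Hkr : INR (S k) <= INR K) by now apply le_INR.
  assert (Hk0 := pos_INR k). rewrite S_INR in *.
  replace (- ((INR k + 1) ^ 2 / (INR m + INR K))) with
    (- (INR k ^ 2 / (INR m + INR K)) + - ((2 * INR k + 1) / (INR m + INR K))) by (field; lra).
  rewrite exp_plus. apply Rmult_le_compat.
  + apply ncbinom_nonneg.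
  + apply Rmult_le_pos; [lra|]. left. apply Rinv_0_lt_compat. lra.
  + apply IH. lia.
  + apply Rle_trans with (exp (- ((2 * INR k + 1) / (INR m + INR k + 1)))).
    * eapply Rle_trans; [|apply exp_ineq1_le]. right. field. lra.
    * apply exp_le, Ropp_le_contravar, Rmult_le_compat_l; [lra|].
      apply Rinv_le_contravar; lra.
Qed.

Lemma ncbinom_lower_aux m K : (K < m)%nat -> forall k, (k <= K)%nat ->
  exp (- (INR k ^ 2 / (INR m - INR K))) <= ncbinom m (Z.of_nat k).
Proof.
intros HK. induction k as [|k IH]; intros Hk.
- change (Z.of_nat 0) with 0%Z. rewrite ncbinom_0. change (INR 0) with 0.
  replace (0 ^ 2 / (INR m - INR K)) with 0 by (unfold Rdiv; ring).
  rewrite Ropp_0, exp_0. lra.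
- rewrite ncbinom_succ by lia.
  assert (HKr : INR K < INR m) by now apply lt_INR.
  assert (Hkr : INR (S k) <= INR K) by now apply le_INR.
  assert (Hk0 := pos_INR k). rewrite S_INR in *.
  replace (- ((INR k + 1) ^ 2 / (INR m - INR K))) with
    (- (INR k ^ 2 / (INR m - INR K)) + - ((2 * INR k + 1) / (INR m - INR K))) by (field; lra).
  rewrite exp_plus. apply Rmult_le_compat; try (left; apply exp_pos).
  + apply IH. lia.
  + apply Rle_trans with (exp (- ((2 * INR k + 1) / (INR m - INR k)))).
    * apply exp_le, Ropp_le_contravar, Rmult_le_compat_l; [lra|].
      apply Rinv_le_contravar; lra.
    * rewrite exp_Ropp.
      replace ((INR m - INR k) / (INR m + INR k + 1)) with
        (/ (1 + (2 * INR k + 1) / (INR m - INR k))) by (field; lra).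
      apply Rinv_le_contravar; [|apply exp_ineq1_le].
      assert (0 < (2 * INR k + 1) / (INR m - INR k)); [|lra].
      apply Rdiv_lt_0_compat; lra.
Qed.

Lemma IZR_abs_nat k : INR (Z.abs_nat k) = Rabs (IZR k).
Proof. rewrite INR_IZR_INZ, <- abs_IZR. f_equal. lia. Qed.

Lemma ncbinom_upper m k : (Z.abs k <= Z.of_nat m)%Z ->
  ncbinom m k <= exp (- (IZR k ^ 2 / (INR m + Rabs (IZR k)))).
Proof.
intros H. rewrite ncbinom_abs, <- IZR_abs_nat, <- (pow2_abs (IZR k)), <- IZR_abs_nat.
apply ncbinom_upper_aux; lia.
Qed.

Lemma ncbinom_lower m k : (Z.abs k < Z.of_nat m)%Z ->
  exp (- (IZR k ^ 2 / (INR m - Rabs (IZR k)))) <= ncbinom m k.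
Proof.
intros H. rewrite ncbinom_abs, <- IZR_abs_nat, <- (pow2_abs (IZR k)), <- IZR_abs_nat.
apply ncbinom_lower_aux; lia.
Qed.

(** A bound for all [k] at once, as dominated convergence requires; it depends on
[m] only through an upper bound of [m]. *)
Lemma ncbinom_dominated m k T : INR m <= T -> 0 < T ->
  ncbinom m k <= exp (- (IZR k ^ 2 / (2 * T))).
Proof.
intros Hm HT. destruct (Z_lt_le_dec (Z.of_nat m) (Z.abs k)) as [H|H].
- unfold ncbinom. rewrite cbinom_out by trivial. unfold Rdiv. rewrite Rmult_0_l.
  left; apply exp_pos.
- destruct (Z.eq_dec k 0) as [->|Hk].
  + rewrite ncbinom_0. replace (0 ^ 2 / (2 * T)) with 0 by (field; lra).
    rewrite Ropp_0, exp_0. lra.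
  + eapply Rle_trans; [apply ncbinom_upper; trivial|].
    assert (Hkm : Rabs (IZR k) <= INR m).
    { rewrite <- IZR_abs_nat. apply le_INR. lia. }
    assert (H0 : 0 < Rabs (IZR k)) by (apply Rabs_pos_lt; now apply eq_IZR_contrapositive).
    apply exp_le, Ropp_le_contravar, Rmult_le_compat_l; [apply pow2_ge_0|].
    apply Rinv_le_contravar; lra.
Qed.

(** * Gaussian bounds for the cosine *)

Lemma cos_ge_quadratic x : 1 - x ^ 2 / 2 <= cos x.
Proof.
replace x with (2 * (x / 2)) at 2 by field. rewrite cos_2a_sin.
assert (H : forall y, 0 <= y -> sin y <= y).
{ intros y [Hy| <-]; [left; now apply sin_lt_x|]. rewrite sin_0. lra. }
assert (H2 : sin (x / 2) ^ 2 <= (x / 2) ^ 2).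
{ rewrite <- !Rsqr_pow2. apply Rsqr_le_abs_1.
  destruct (Rle_dec 0 (x / 2)) as [Hx|Hx].
  - rewrite (Rabs_pos_eq (x / 2)) by trivial. apply Rabs_le. split; [|now apply H].
    destruct (Rle_dec (x / 2) PI) as [Hp|Hp].
    + assert (0 <= sin (x / 2)) by now apply sin_ge_0. lra.
    + assert (B := SIN_bound (x / 2)). assert (P := PI2_1). lra.
  - rewrite (Rabs_left (x / 2)) by lra. rewrite <- Rabs_Ropp, <- sin_neg.
    assert (Hy : 0 <= - (x / 2)) by lra. apply Rabs_le. split; [|now apply H].
    destruct (Rle_dec (- (x / 2)) PI) as [Hp|Hp].
    + assert (0 <= sin (- (x / 2))) by now apply sin_ge_0. lra.
    + assert (B := SIN_bound (- (x / 2))). assert (P := PI2_1). lra. }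
simpl in H2 |- *. nra.
Qed.

(** [exp (x^2/2) cos x] decreases because [x cos x <= sin x]. *)
Lemma cos_le_gauss x : 0 <= x <= PI / 2 -> cos x <= exp (- (x ^ 2 / 2)).
Proof.
intros [H0 H1].
assert (Hs : forall y, 0 <= y <= PI / 2 -> 0 <= sin y - y * cos y).
{ intros y [Hy0 Hy1].
  replace 0 with (sin 0 - 0 * cos 0) by (rewrite sin_0; ring).
  apply (is_derive_nonneg_le (fun y => sin y - y * cos y) (fun y => y * sin y) 0 y); trivial.
  - intros z _. auto_derive; trivial. ring.
  - intros z Hz. apply Rmult_le_pos; [lra|]. apply sin_ge_0; lra. }
assert (H : - (exp (0 * 0 / 2) * cos 0) <= - (exp (x * x / 2) * cos x)).
{ apply (is_derive_nonneg_le (fun y => - (exp (y * y / 2) * cos y))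
    (fun y => exp (y * y / 2) * (sin y - y * cos y)) 0 x); trivial.
  - intros z _. auto_derive; trivial. unfold Rdiv. field.
  - intros z Hz. apply Rmult_le_pos; [left; apply exp_pos|]. apply Hs. lra. }
replace (0 * 0 / 2) with 0 in H by field. replace (x * x) with (x ^ 2) in H by ring. rewrite exp_0, cos_0 in H.
rewrite exp_Ropp. assert (Hp := exp_pos (x ^ 2 / 2)).
apply (Rmult_le_reg_l (exp (x ^ 2 / 2))); trivial.
rewrite Rinv_r by lra. lra.
Qed.

(** * Integer parts *)

Definition nat_floor (x : R) : nat := Z.to_nat (Int_part x).

Lemma nat_floor_spec x : 0 <= x -> x - 1 < INR (nat_floor x) <= x.
Proof.
intros Hx. destruct (base_Int_part x) as [H1 H2].
unfold nat_floor. rewrite INR_IZR_INZ, Z2Nat.id; [lra|].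
assert (-1 < Int_part x)%Z by (apply lt_IZR; lra). lia.
Qed.

Lemma theta3_term z t k :
  nome t ^ (k ^ 2) * cos (2 * INR k * PI * z) =
  exp (- (PI ^ 2 * t) * INR k ^ 2) * cos (2 * (PI * INR k) * z).
Proof.
unfold nome. rewrite exp_pow_INR, pow_INR. f_equal; f_equal; ring.
Qed.

Lemma ex_series_theta s y : 0 < s ->
  ex_series (fun l => Rabs (exp (- s * INR l ^ 2) * cos (y l))).
Proof.
intros Hs.
apply ex_series_le_R with (fun n => exp (- s * INR n)); [|now apply ex_series_geom_exp].
intros n. rewrite Rabs_Rabsolu. apply Rabs_exp_cos_le. assert (H := INR_le_sqr n). nra.
Qed.

Lemma theta3_alt z t : 0 < t ->
  theta3 z t = 2 * Series (fun l => exp (- (PI ^ 2 * t) * INR l ^ 2) * cos (2 * (PI * INR l) * z)) - 1.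
Proof.
intros Ht. unfold theta3.
rewrite (Series_incr_1 (fun l => exp (- (PI ^ 2 * t) * INR l ^ 2) * cos (2 * (PI * INR l) * z))).
- rewrite (Series_ext (fun n => nome t ^ (S n ^ 2) * cos (2 * INR (S n) * PI * z)) _
    (fun n => theta3_term z t (S n))).
  change (INR 0) with 0. replace (- (PI ^ 2 * t) * 0 ^ 2) with 0 by ring.
  replace (2 * (PI * 0) * z) with 0 by ring. rewrite exp_0, cos_0. ring.
- apply ex_series_Rabs, ex_series_theta. apply Rmult_lt_0_compat; trivial.
  apply pow_lt, PI_RGT_0.
Qed.

(** * Jacobi's imaginary transformation *)

(** Polya's parameters: the modulus [polya_N] is odd and tends to infinity, the
order [polya_m] of the binomial coefficients is about [t N^2], and the residue
[polya_j] about [z N]. The starting value of [polya_M] ensures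
[polya_m >= t N^2 / 2] from the outset. *)
Definition polya_M (t : R) (n : nat) : nat := n + S (nat_floor (1 / t)).
Definition polya_N (t : R) (n : nat) : nat := 2 * polya_M t n + 1.
Definition polya_m (t : R) (n : nat) : nat := nat_floor (t * INR (polya_N t n) ^ 2).

Lemma polya_N_pos t n : 0 < INR (polya_N t n).
Proof. apply lt_0_INR. unfold polya_N. lia. Qed.

Lemma polya_N_large t n : 0 < t -> 2 <= t * INR (polya_N t n).
Proof.
intros Ht. assert (Hp : 0 < 1 / t) by (apply Rdiv_lt_0_compat; lra).
destruct (nat_floor_spec (1 / t)) as [H1 H2]; [lra|].
assert (H : 2 * INR (S (nat_floor (1 / t))) <= INR (polya_N t n)).
{ replace 2 with (INR 2) by reflexivity. rewrite <- mult_INR. apply le_INR. unfold polya_N, polya_M. lia. }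
rewrite S_INR in H.
replace 2 with (t * (2 * (1 / t))) by (field; lra). apply Rmult_le_compat_l; lra.
Qed.

Lemma polya_N_ge_1 t n : 1 <= INR (polya_N t n).
Proof. replace 1 with (INR 1) by reflexivity. apply le_INR. unfold polya_N. lia. Qed.

Lemma polya_m_spec t n : 0 < t -> t * INR (polya_N t n) ^ 2 - 1 < INR (polya_m t n) <= t * INR (polya_N t n) ^ 2.
Proof.
intros Ht. apply nat_floor_spec. apply Rmult_le_pos; [lra|]. apply pow2_ge_0.
Qed.

Lemma polya_m_lower t n : 0 < t -> t * INR (polya_N t n) ^ 2 / 2 <= INR (polya_m t n).
Proof.
intros Ht. assert (H := polya_m_spec t n Ht). assert (H1 := polya_N_large t n Ht). assert (H2 := polya_N_ge_1 t n).
simpl in *. nra.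
Qed.

Lemma polya_N_lim t : is_lim_seq (fun n => / INR (polya_N t n)) 0.
Proof.
apply (is_lim_seq_inv (fun n => INR (polya_N t n)) p_infty); [|easy].
apply is_lim_seq_le_p_loc with INR; [|apply is_lim_seq_INR].
exists 0%nat. intros n _. apply le_INR. unfold polya_N, polya_M. lia.
Qed.

Lemma polya_m_lim t : 0 < t -> is_lim_seq (fun n => INR (polya_m t n) / INR (polya_N t n) ^ 2) t.
Proof.
intros Ht. apply is_lim_seq_le_le with (fun n => t - / INR (polya_N t n) * / INR (polya_N t n)) (fun _ => t).
- intros n. assert (H := polya_m_spec t n Ht). assert (Hp := polya_N_pos t n).
  assert (Hp2 : 0 < INR (polya_N t n) ^ 2) by now apply pow_lt. split.
  + apply (Rmult_le_reg_r (INR (polya_N t n) ^ 2)); trivial.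
    unfold Rdiv. rewrite Rmult_assoc, Rinv_l, Rmult_1_r by lra.
    replace ((t - / INR (polya_N t n) * / INR (polya_N t n)) * INR (polya_N t n) ^ 2) with (t * INR (polya_N t n) ^ 2 - 1)
      by (field; lra). lra.
  + apply (Rmult_le_reg_r (INR (polya_N t n) ^ 2)); trivial.
    unfold Rdiv. rewrite Rmult_assoc, Rinv_l, Rmult_1_r by lra. lra.
- replace (Finite t) with (Finite (t - 0 * 0)) by (f_equal; ring).
  apply is_lim_seq_minus'; [apply is_lim_seq_const|].
  apply is_lim_seq_mult'; apply polya_N_lim.
- apply is_lim_seq_const.
Qed.

Definition polya_j (t z : R) (n : nat) : nat := nat_floor (z * INR (polya_N t n)).

Lemma polya_j_spec t z n : 0 <= z -> z * INR (polya_N t n) - 1 < INR (polya_j t z n) <= z * INR (polya_N t n).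
Proof. intros Hz. apply nat_floor_spec. apply Rmult_le_pos; [lra|]. left; apply polya_N_pos. Qed.

Lemma polya_j_range t z n : 0 <= z <= / 2 -> 0 <= INR (polya_j t z n) / INR (polya_N t n) <= / 2.
Proof.
intros Hz. assert (H := polya_j_spec t z n ltac:(lra)). assert (Hp := polya_N_pos t n). assert (H0 := pos_INR (polya_j t z n)). split.
- apply Rmult_le_pos; trivial. left; now apply Rinv_0_lt_compat.
- apply (Rmult_le_reg_r (INR (polya_N t n))); trivial.
  unfold Rdiv. rewrite Rmult_assoc, Rinv_l, Rmult_1_r by lra. nra.
Qed.

Lemma polya_j_lim t z : 0 <= z -> is_lim_seq (fun n => INR (polya_j t z n) / INR (polya_N t n)) z.
Proof.
intros Hz. apply is_lim_seq_le_le with (fun n => z - / INR (polya_N t n)) (fun _ => z).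
- intros n. assert (H := polya_j_spec t z n ltac:(lra)). assert (Hp := polya_N_pos t n). split;
  apply (Rmult_le_reg_r (INR (polya_N t n))); trivial; unfold Rdiv;
  rewrite (Rmult_assoc (INR (polya_j t z n))), Rinv_l, Rmult_1_r by lra; [|lra].
  rewrite Rmult_minus_distr_r, Rinv_l by lra. lra.
- replace (Finite z) with (Finite (z - 0)) by (f_equal; ring).
  apply is_lim_seq_minus'; [apply is_lim_seq_const|apply polya_N_lim].
- apply is_lim_seq_const.
Qed.

(** The cosine is squeezed between [1 - x^2/2] and [exp (- x^2/2)]. *)
Lemma polya_cos_lim t l : 0 < t ->
  is_lim_seq (fun n => cos (PI * INR l / INR (polya_N t n)) ^ (2 * polya_m t n)) (exp (- (PI ^ 2 * t) * INR l ^ 2)).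
Proof.
intros Ht. assert (Hx : is_lim_seq (fun n => PI * INR l / INR (polya_N t n)) 0).
{ replace (Finite 0) with (Finite (PI * INR l * 0)) by (f_equal; ring).
  apply is_lim_seq_mult'; [apply is_lim_seq_const|apply polya_N_lim]. }
set (x := fun n => PI * INR l / INR (polya_N t n)) in *.
assert (Hmx : is_lim_seq (fun n => INR (polya_m t n) * x n ^ 2) (t * (PI * INR l) ^ 2)).
{ apply is_lim_seq_ext with (fun n => INR (polya_m t n) / INR (polya_N t n) ^ 2 * (PI * INR l) ^ 2).
  - intros n. unfold x. assert (Hp := polya_N_pos t n). field. lra.
  - apply is_lim_seq_mult'; [now apply polya_m_lim|apply is_lim_seq_const]. }
assert (Hx2 : is_lim_seq (fun n => x n ^ 2 / 2) 0).
{ replace (Finite 0) with (Finite (0 * (0 * 1) * / 2)) by (f_equal; ring).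
  apply is_lim_seq_mult'; [|apply is_lim_seq_const].
  apply is_lim_seq_mult'; trivial. apply is_lim_seq_mult'; trivial. apply is_lim_seq_const. }
assert (Hev : eventually (fun n => x n ^ 2 / 2 < 1 / 2)).
{ apply is_lim_seq_spec in Hx2. destruct (Hx2 (mkposreal (1 / 2) ltac:(lra))) as [n0 H].
  exists n0. intros n Hn. specialize (H n Hn). simpl in H. apply Rabs_def2 in H. simpl. lra. }
assert (Hxpos : forall n, 0 <= x n).
{ intros n. unfold x. apply Rmult_le_pos; [|left; apply Rinv_0_lt_compat, polya_N_pos].
  apply Rmult_le_pos; [left; apply PI_RGT_0|apply pos_INR]. }
apply is_lim_seq_le_le_loc with
  (fun n => exp (- (INR (polya_m t n) * x n ^ 2 / (1 - x n ^ 2 / 2))))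
  (fun n => exp (- (INR (polya_m t n) * x n ^ 2))).
- destruct Hev as [n0 Hev]. exists n0. intros n Hn. specialize (Hev n Hn).
  fold (x n). specialize (Hxpos n).
  assert (Hc := cos_ge_quadratic (x n)).
  assert (Hq : exp (- (x n ^ 2 / 2 / (1 - x n ^ 2 / 2))) <= cos (x n)).
  { eapply Rle_trans; [|exact Hc]. apply exp_opp_div_le. lra. }
  assert (Hx1 : x n <= PI / 2).
  { assert (P := PI2_1). simpl in Hev. nra. }
  assert (Hu := cos_le_gauss (x n) (conj Hxpos Hx1)).
  assert (Hm : INR (2 * polya_m t n) = 2 * INR (polya_m t n)) by (rewrite mult_INR; reflexivity).
  split.
  + replace (exp (- (INR (polya_m t n) * x n ^ 2 / (1 - x n ^ 2 / 2)))) with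
      (exp (- (x n ^ 2 / 2 / (1 - x n ^ 2 / 2))) ^ (2 * polya_m t n)).
    * apply pow_incr. split; trivial. left; apply exp_pos.
    * rewrite exp_pow_INR, Hm. f_equal. field. lra.
  + replace (exp (- (INR (polya_m t n) * x n ^ 2))) with (exp (- (x n ^ 2 / 2)) ^ (2 * polya_m t n)).
    * apply pow_incr. split; trivial. eapply Rle_trans; [|exact Hq]. left; apply exp_pos.
    * rewrite exp_pow_INR, Hm. f_equal. field.
- replace (- (PI ^ 2 * t) * INR l ^ 2) with (- (t * (PI * INR l) ^ 2 / (1 - 0))) by field.
  apply (is_lim_seq_continuous exp (fun n => - (INR (polya_m t n) * x n ^ 2 / (1 - x n ^ 2 / 2)))).
  { apply derivable_continuous, derivable_exp. }
  apply (is_lim_seq_opp (fun n => INR (polya_m t n) * x n ^ 2 / (1 - x n ^ 2 / 2)) (t * (PI * INR l) ^ 2 / (1 - 0))).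
  apply is_lim_seq_div'; trivial; [|lra].
  apply is_lim_seq_minus'; trivial. apply is_lim_seq_const.
- replace (- (PI ^ 2 * t) * INR l ^ 2) with (- (t * (PI * INR l) ^ 2)) by ring.
  apply (is_lim_seq_continuous exp (fun n => - (INR (polya_m t n) * x n ^ 2))).
  { apply derivable_continuous, derivable_exp. }
  apply (is_lim_seq_opp (fun n => INR (polya_m t n) * x n ^ 2) (t * (PI * INR l) ^ 2)). trivial.
Qed.

(** The powers of cosines become the coefficients [q^(l^2)], which gives the theta
series on the side of the roots of unity. *)
Lemma polya_theta_lim t z : 0 < t -> 0 <= z <= / 2 ->
  is_lim_seq (fun n => cos_sum (polya_M t n) (polya_m t n) (Z.of_nat (polya_j t z n)) / 2 ^ (2 * polya_m t n)) (theta3 z t).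
Proof.
intros Ht Hz. (* the finite cosine sums as series with eventually vanishing terms *)
set (f := fun n l => if le_dec l (polya_M t n) then cos (PI * INR l / INR (polya_N t n)) ^ (2 * polya_m t n) *
   cos (2 * INR (polya_j t z n) * (PI * INR l / INR (polya_N t n))) else 0).
assert (HP := PI_RGT_0).
rewrite theta3_alt by trivial.
apply is_lim_seq_ext with (fun n => 2 * Series (f n) - 1).
{ intros n. rewrite (Series_finite (f n) (polya_M t n)).
  2:{ intros k Hk. unfold f. destruct (le_dec k (polya_M t n)); [lia|easy]. }
  unfold cos_sum. cbv zeta. fold (polya_N t n).
  set (g := fun l => (2 * cos (PI * INR l / INR (polya_N t n))) ^ (2 * polya_m t n) *
      cos (2 * IZR (Z.of_nat (polya_j t z n)) * (PI * INR l / INR (polya_N t n)))).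
  assert (E : sum_n (f n) (polya_M t n) = / 2 ^ (2 * polya_m t n) * sum_n g (polya_M t n)).
  { transitivity (sum_n (fun l => mult (/ 2 ^ (2 * polya_m t n)) (g l)) (polya_M t n)).
    2:{ apply (sum_n_mult_l (K := R_Ring)). }
    apply sum_n_ext_loc. intros l Hl. unfold f, g. destruct (le_dec l (polya_M t n)); [|lia].
    rewrite Rpow_mult_distr, <- INR_IZR_INZ.
    match goal with |- ?a = mult ?b ?c => change (@eq R a (b * c)) end. field.
    apply pow_nonzero. lra. }
  rewrite E. set (s1 := sum_n g _).
  change (INR 0) with 0. replace (PI * 0 / INR (polya_N t n)) with 0 by (unfold Rdiv; ring).
  rewrite Rmult_0_r, cos_0, Rmult_1_r, Rmult_1_r. field. apply pow_nonzero. lra. }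
apply is_lim_seq_minus'; [|apply is_lim_seq_const].
apply is_lim_seq_mult'; [apply is_lim_seq_const|].
apply (is_lim_seq_Series_dominated f _ (fun l => exp (- (PI ^ 2 * t / 2) * INR l))).
- intros n l. unfold f. destruct (le_dec l (polya_M t n)) as [Hl|Hl].
  2:{ rewrite Rabs_R0. left; apply exp_pos. }
  assert (Hp := polya_N_pos t n). set (x := PI * INR l / INR (polya_N t n)).
  assert (Hx0 : 0 <= x).
  { unfold x. apply Rmult_le_pos; [|left; now apply Rinv_0_lt_compat].
    apply Rmult_le_pos; [lra|apply pos_INR]. }
  assert (Hx1 : x <= PI / 2).
  { unfold x. apply (Rmult_le_reg_r (INR (polya_N t n))); trivial.
    unfold Rdiv at 1. rewrite Rmult_assoc, Rinv_l, Rmult_1_r by lra.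
    assert (HN : 2 * INR l <= INR (polya_N t n)).
    { replace 2 with (INR 2) by reflexivity. rewrite <- mult_INR. apply le_INR. unfold polya_N. lia. }
    unfold Rdiv. nra. }
  rewrite Rabs_mult.
  rewrite <- (Rmult_1_r (exp _)). apply Rmult_le_compat; try apply Rabs_pos; [|apply Rabs_le, COS_bound].
  rewrite Rabs_pos_eq by (apply pow_le, cos_ge_0; lra).
  apply Rle_trans with (exp (- (x ^ 2 / 2)) ^ (2 * polya_m t n)).
  { apply pow_incr. split; [apply cos_ge_0; lra|]. apply cos_le_gauss; lra. }
  rewrite exp_pow_INR. apply exp_le. rewrite mult_INR. change (INR 2) with 2.
  assert (Hm := polya_m_lower t n Ht). assert (Hl2 := INR_le_sqr l).
  assert (E : INR (polya_N t n) ^ 2 * x ^ 2 = PI ^ 2 * INR l ^ 2) by (unfold x; field; lra).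
  assert (H1 : t * INR (polya_N t n) ^ 2 / 2 * x ^ 2 <= INR (polya_m t n) * x ^ 2)
    by (apply Rmult_le_compat_r; [apply pow2_ge_0|trivial]).
  assert (H2 : t * PI ^ 2 / 2 * INR l <= t * PI ^ 2 / 2 * INR l ^ 2).
  { apply Rmult_le_compat_l; trivial. assert (0 < PI ^ 2) by now apply pow_lt. nra. }
  replace (t * INR (polya_N t n) ^ 2 / 2 * x ^ 2) with (t / 2 * (INR (polya_N t n) ^ 2 * x ^ 2)) in H1 by field.
  rewrite E in H1. lra.
- apply ex_series_geom_exp. assert (0 < PI ^ 2) by now apply pow_lt. nra.
- intros l.
  apply is_lim_seq_ext_loc with (fun n => cos (PI * INR l / INR (polya_N t n)) ^ (2 * polya_m t n) *
   cos (2 * (PI * INR l) * (INR (polya_j t z n) / INR (polya_N t n)))).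
  { exists l. intros n Hn. unfold f. destruct (le_dec l (polya_M t n)) as [_|H].
    - do 2 f_equal. field. assert (Hp := polya_N_pos t n). lra.
    - exfalso. apply H. unfold polya_M. lia. }
  apply is_lim_seq_mult'; [now apply polya_cos_lim|].
  apply (is_lim_seq_continuous cos (fun n => 2 * (PI * INR l) * (INR (polya_j t z n) / INR (polya_N t n)))).
  { apply derivable_continuous, derivable_cos. }
  apply is_lim_seq_mult'; [apply is_lim_seq_const|apply polya_j_lim; lra].
Qed.

Lemma ncbinom_gauss_lim t z k : 0 < t -> 0 <= z <= / 2 ->
  is_lim_seq (fun n => ncbinom (polya_m t n) (Z.of_nat (polya_j t z n) + k * Z.of_nat (polya_N t n)))
    (exp (- ((z + IZR k) ^ 2 / t))).
Proof.
intros Ht Hz.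
set (K := fun n => (Z.of_nat (polya_j t z n) + k * Z.of_nat (polya_N t n))%Z).
set (y := fun n => INR (polya_j t z n) / INR (polya_N t n) + IZR k).
set (mu := fun n => INR (polya_m t n) / INR (polya_N t n) ^ 2).
assert (Hy : is_lim_seq y (z + IZR k)).
{ apply is_lim_seq_plus'; [apply polya_j_lim; lra|apply is_lim_seq_const]. }
assert (EK : forall n, IZR (K n) = y n * INR (polya_N t n)).
{ intros n. unfold K, y. rewrite plus_IZR, mult_IZR, <- !INR_IZR_INZ.
  assert (Hp := polya_N_pos t n). field. lra. }
assert (EA : forall n, Rabs (IZR (K n)) = Rabs (y n) * INR (polya_N t n)).
{ intros n. rewrite EK, Rabs_mult. f_equal. apply Rabs_pos_eq. left; apply polya_N_pos. }
assert (Hnu : is_lim_seq (fun n => Rabs (y n) * / INR (polya_N t n)) 0).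
{ replace (Finite 0) with (Finite (Rabs (z + IZR k) * 0)) by (f_equal; ring).
  apply is_lim_seq_mult'; [|apply polya_N_lim].
  now apply (is_lim_seq_abs y (z + IZR k)). }
assert (Hmu := polya_m_lim t Ht : is_lim_seq mu t).
assert (Hy2 : is_lim_seq (fun n => y n ^ 2) ((z + IZR k) ^ 2)).
{ simpl. apply is_lim_seq_mult'; trivial. apply is_lim_seq_mult'; trivial. apply is_lim_seq_const. }
assert (Hd : is_lim_seq (fun n => mu n - Rabs (y n) * / INR (polya_N t n)) (t - 0))
  by now apply is_lim_seq_minus'.
assert (Hev : eventually (fun n => 0 < mu n - Rabs (y n) * / INR (polya_N t n))).
{ apply is_lim_seq_spec in Hd. destruct (Hd (mkposreal t Ht)) as [n0 H].
  exists n0. intros n Hn. specialize (H n Hn). simpl in H. apply Rabs_def2 in H. lra. }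
apply is_lim_seq_le_le_loc with
  (fun n => exp (- (y n ^ 2 / (mu n - Rabs (y n) * / INR (polya_N t n)))))
  (fun n => exp (- (y n ^ 2 / (mu n + Rabs (y n) * / INR (polya_N t n))))).
- destruct Hev as [n0 Hev]. exists n0. intros n Hn. specialize (Hev n Hn).
  assert (Hp := polya_N_pos t n). assert (Hm0 := polya_m_lower t n Ht).
  assert (Hp2 : 0 < INR (polya_N t n) ^ 2) by now apply pow_lt.
  assert (Hlt : Rabs (IZR (K n)) < INR (polya_m t n)).
  { rewrite EA. unfold mu in Hev.
    apply (Rmult_lt_reg_r (/ INR (polya_N t n) ^ 2)); [now apply Rinv_0_lt_compat|].
    replace (Rabs (y n) * INR (polya_N t n) * / INR (polya_N t n) ^ 2) with (Rabs (y n) * / INR (polya_N t n)) by (field; lra).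
    unfold Rdiv in Hev. lra. }
  assert (HltZ : (Z.abs (K n) < Z.of_nat (polya_m t n))%Z).
  { apply lt_IZR. now rewrite abs_IZR, <- INR_IZR_INZ. }
  assert (Hy0 := Rabs_pos (y n)).
  fold (K n). split.
  + eapply Rle_trans; [|now apply ncbinom_lower].
    rewrite EA, EK. rewrite EA in Hlt. apply exp_le, Ropp_le_contravar. right. unfold mu.
    replace (INR (polya_m t n) / INR (polya_N t n) ^ 2 - Rabs (y n) * / INR (polya_N t n)) with
      ((INR (polya_m t n) - Rabs (y n) * INR (polya_N t n)) / INR (polya_N t n) ^ 2) by (field; lra).
    field. lra.
  + eapply Rle_trans; [apply ncbinom_upper; lia|].
    rewrite EA, EK. apply exp_le, Ropp_le_contravar. right. unfold mu.
    replace (INR (polya_m t n) / INR (polya_N t n) ^ 2 + Rabs (y n) * / INR (polya_N t n)) with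
      ((INR (polya_m t n) + Rabs (y n) * INR (polya_N t n)) / INR (polya_N t n) ^ 2) by (field; lra).
    assert (0 <= Rabs (y n) * INR (polya_N t n)) by (apply Rmult_le_pos; lra).
    assert (0 < t * INR (polya_N t n) ^ 2) by (apply Rmult_lt_0_compat; lra).
    field. lra.
- replace ((z + IZR k) ^ 2 / t) with ((z + IZR k) ^ 2 / (t - 0)) by (field; lra).
  apply (is_lim_seq_continuous exp (fun n => - (y n ^ 2 / (mu n - Rabs (y n) * / INR (polya_N t n))))).
  { apply derivable_continuous, derivable_exp. }
  apply (is_lim_seq_opp _ ((z + IZR k) ^ 2 / (t - 0))).
  apply is_lim_seq_div'; trivial. lra.
- replace ((z + IZR k) ^ 2 / t) with ((z + IZR k) ^ 2 / (t + 0)) by (field; lra).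
  apply (is_lim_seq_continuous exp (fun n => - (y n ^ 2 / (mu n + Rabs (y n) * / INR (polya_N t n))))).
  { apply derivable_continuous, derivable_exp. }
  apply (is_lim_seq_opp _ ((z + IZR k) ^ 2 / (t + 0))).
  apply is_lim_seq_div'; trivial; [|lra]. now apply is_lim_seq_plus'.
Qed.

(** Dominates all the terms [exp (- (z + k)^2 / t)] with [0 <= z <= 1/2], and is
even in [k]. *)
Definition heat_bound (t : R) (k : Z) : R := exp (- ((Rabs (IZR k) - 1) / (2 * t))).

Lemma heat_bound_summable t : 0 < t -> bisummable (heat_bound t).
Proof.
intros Ht.
assert (Hg : ex_series (fun n => exp (1 / (2 * t)) * exp (- (1 / (2 * t)) * INR n))).
{ apply (ex_series_scal_l (K := R_AbsRing) (exp (1 / (2 * t))) (fun n => exp (- (1 / (2 * t)) * INR n))), ex_series_geom_exp.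
  apply Rdiv_lt_0_compat; lra. }
split.
- eapply ex_series_ext; [|exact Hg]. intros n. unfold heat_bound.
  rewrite (Rabs_pos_eq (exp _)) by (left; apply exp_pos).
  rewrite <- INR_IZR_INZ, (Rabs_pos_eq (INR n)) by apply pos_INR.
  rewrite <- exp_plus. f_equal. field. lra.
- apply ex_series_incr_1 in Hg. eapply ex_series_ext; [|exact Hg].
  intros n. unfold heat_bound.
  rewrite (Rabs_pos_eq (exp _)) by (left; apply exp_pos).
  rewrite opp_IZR, Rabs_Ropp, <- INR_IZR_INZ, (Rabs_pos_eq (INR (S n))) by apply pos_INR.
  rewrite <- exp_plus. f_equal. field. lra.
Qed.

Lemma sqr_shift_ge z k : 0 <= z <= / 2 -> Rabs (IZR k) - 1 <= (z + IZR k) ^ 2.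
Proof.
intros Hz. destruct (Z_lt_le_dec k 0) as [Hk|Hk].
- assert (H : IZR k <= -1) by (apply IZR_le; lia).
  rewrite Rabs_left by lra. nra.
- assert (H : 0 <= IZR k) by (apply IZR_le; lia).
  rewrite Rabs_pos_eq by lra. nra.
Qed.

Lemma exp_sqr_le_heat_bound t z k : 0 < t -> 0 <= z <= / 2 ->
  exp (- ((z + IZR k) ^ 2 / (2 * t))) <= heat_bound t k.
Proof.
intros Ht Hz. apply exp_le, Ropp_le_contravar, Rmult_le_compat_r.
- left; apply Rinv_0_lt_compat; lra.
- now apply sqr_shift_ge.
Qed.

Lemma heat_summable t z : 0 < t -> 0 <= z <= / 2 ->
  bisummable (fun k => exp (- ((z + IZR k) ^ 2 / t))).
Proof.
intros Ht Hz.
assert (H : forall k, exp (- ((z + IZR k) ^ 2 / t)) <= heat_bound t k).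
{ intros k. eapply Rle_trans; [|now apply exp_sqr_le_heat_bound].
  apply exp_le, Ropp_le_contravar, Rmult_le_compat_l; [apply pow2_ge_0|].
  apply Rinv_le_contravar; lra. }
destruct (heat_bound_summable t Ht) as [H1 H2].
split; [apply ex_series_le_R with (2 := H1)|apply ex_series_le_R with (2 := H2)]; intros n;
  rewrite Rabs_Rabsolu, !Rabs_pos_eq by (left; apply exp_pos); apply H.
Qed.

(** The same quantity, seen as a sum of binomial coefficients over a residue class,
becomes the Gaussian series, up to a factor that does not depend on [z]. *)
Lemma heat_lim t z h : 0 < t -> 0 <= z <= / 2 ->
  is_bisum (fun k => exp (- ((z + IZR k) ^ 2 / t))) h ->
  is_lim_seq (fun n => cos_sum (polya_M t n) (polya_m t n) (Z.of_nat (polya_j t z n)) /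
     (INR (polya_N t n) * cbinom (polya_m t n) 0)) h.
Proof.
intros Ht Hz Hh.
apply is_lim_seq_bisum_dominated with
  (f := fun n k => ncbinom (polya_m t n) (Z.of_nat (polya_j t z n) + k * Z.of_nat (polya_N t n)))
  (g := fun k => exp (- ((z + IZR k) ^ 2 / t))) (M := heat_bound t); trivial.
- intros n k. rewrite Rabs_pos_eq by apply ncbinom_nonneg.
  assert (Hp := polya_N_pos t n).
  assert (Hp2 : 0 < INR (polya_N t n) ^ 2) by now apply pow_lt.
  eapply Rle_trans.
  { apply (ncbinom_dominated _ _ (t * INR (polya_N t n) ^ 2)); [now apply polya_m_spec|].
    now apply Rmult_lt_0_compat. }
  eapply Rle_trans; [|apply (exp_sqr_le_heat_bound t (INR (polya_j t z n) / INR (polya_N t n))); trivial;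
    now apply polya_j_range].
  apply exp_le, Ropp_le_contravar. right.
  rewrite plus_IZR, mult_IZR, <- !INR_IZR_INZ. field. lra.
- now apply heat_bound_summable.
- intros k. now apply ncbinom_gauss_lim.
- intros n. assert (H := residue_binomial_sum (polya_M t n) (polya_m t n) (Z.of_nat (polya_j t z n))).
  apply (is_bisum_scal (/ cbinom (polya_m t n) 0)) in H. fold (polya_N t n) in H.
  replace (cos_sum (polya_M t n) (polya_m t n) (Z.of_nat (polya_j t z n)) / (INR (polya_N t n) * cbinom (polya_m t n) 0))
    with (/ cbinom (polya_m t n) 0 * (cos_sum (polya_M t n) (polya_m t n) (Z.of_nat (polya_j t z n)) / INR (polya_N t n))).
  + eapply is_bisum_ext; [|exact H]. intros k. unfold ncbinom. unfold Rdiv. apply Rmult_comm.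
  + field. split; [assert (H0 := cbinom_0_pos (polya_m t n)); lra|assert (H0 := polya_N_pos t n); lra].
Qed.

Lemma heat_bisum_pos t z h : 0 < t -> 0 <= z <= / 2 ->
  is_bisum (fun k => exp (- ((z + IZR k) ^ 2 / t))) h -> 0 < h.
Proof.
intros Ht Hz (a & b & Ha & Hb & ->).
assert (Hp : forall f l, (forall n : nat, 0 < f n) -> is_series f l -> 0 < l).
{ intros f l Hf Hl. apply Rlt_le_trans with (f O); trivial.
  assert (Hl' : is_lim_seq (sum_n f) l) by exact Hl.
  rewrite <- (sum_O f : _ = f O).
  apply (is_lim_seq_incr_compare (sum_n f)); trivial.
  intros n. rewrite sum_Sn. specialize (Hf (S n)).
  change (plus (sum_n f n) (f (S n))) with (sum_n f n + f (S n)). lra. }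
assert (0 < a) by (apply (Hp _ _ (fun n => exp_pos _) Ha)).
assert (0 < b) by (apply (Hp _ _ (fun n => exp_pos _) Hb)). lra.
Qed.

Lemma theta3_0_pos t : 0 < t -> 0 < theta3 0 t.
Proof.
intros Ht. unfold theta3.
assert (H : 0 <= Series (fun n : nat => nome t ^ (S n ^ 2) * cos (2 * INR (S n) * PI * 0))); [|lra].
apply Series_nonneg.
- intros n. rewrite !Rmult_0_r, cos_0, Rmult_1_r. left. apply pow_lt, exp_pos.
- apply ex_series_ext with (fun n => exp (- (PI ^ 2 * t) * INR (S n) ^ 2) * cos (2 * (PI * INR (S n)) * 0)).
  + intros n. now rewrite theta3_term.
  + apply (ex_series_incr_1 (fun n => exp (- (PI ^ 2 * t) * INR n ^ 2) * cos (2 * (PI * INR n) * 0))).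
    apply ex_series_Rabs, (ex_series_theta (PI ^ 2 * t) (fun n => 2 * (PI * INR n) * 0)).
    apply Rmult_lt_0_compat; trivial. apply pow_lt, PI_RGT_0.
Qed.

(** Jacobi's imaginary transformation with an unspecified constant. Evaluating at
[z = 0] shows that the factor relating the two limits converges to a positive
number. Positivity of [theta3] comes with it. *)
Theorem theta3_heat t : 0 < t -> exists C, 0 < C /\ forall z, 0 <= z <= / 2 ->
  is_bisum (fun k => exp (- ((z + IZR k) ^ 2 / t))) (C * theta3 z t) /\ 0 < theta3 z t.
Proof.
intros Ht.
destruct (bisummable_is_bisum _ (heat_summable t 0 Ht ltac:(lra))) as [h0 Hh0].
assert (P0 := heat_bisum_pos t 0 h0 Ht ltac:(lra) Hh0).
assert (T0 := theta3_0_pos t Ht).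
assert (HD : is_lim_seq (fun n => INR (polya_N t n) * cbinom (polya_m t n) 0 / 2 ^ (2 * polya_m t n)) (theta3 0 t / h0)).
{ assert (L1 := polya_theta_lim t 0 Ht ltac:(lra)).
  assert (L2 := heat_lim t 0 h0 Ht ltac:(lra) Hh0).
  assert (L3 := is_lim_seq_div' _ _ _ _ L1 L2 ltac:(lra)).
  assert (Hev : eventually (fun n => cos_sum (polya_M t n) (polya_m t n) (Z.of_nat (polya_j t 0 n)) <> 0)).
  { apply is_lim_seq_spec in L1. destruct (L1 (mkposreal _ T0)) as [n0 H]. exists n0.
    intros n Hn E. specialize (H n Hn). simpl in H. rewrite E in H. unfold Rdiv in H.
    rewrite Rmult_0_l in H. apply Rabs_def2 in H. lra. }
  destruct Hev as [n0 Hev].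
  eapply is_lim_seq_ext_loc; [|exact L3]. exists n0. intros n Hn. specialize (Hev n Hn).
  assert (H1 := cbinom_0_pos (polya_m t n)). assert (H2 := polya_N_pos t n).
  assert (H3 : 0 < 2 ^ (2 * polya_m t n)) by (apply pow_lt; lra).
  field. repeat split; trivial; lra. }
exists (h0 / theta3 0 t). split; [now apply Rdiv_lt_0_compat|].
intros z Hz.
destruct (bisummable_is_bisum _ (heat_summable t z Ht Hz)) as [h Hh].
assert (Ph := heat_bisum_pos t z h Ht Hz Hh).
assert (E : theta3 z t = theta3 0 t / h0 * h).
{ assert (L1 := polya_theta_lim t z Ht Hz).
  assert (L2 := heat_lim t z h Ht Hz Hh).
  assert (L3 := is_lim_seq_mult' _ _ _ _ HD L2).
  apply is_lim_seq_unique in L1.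
  assert (F : Finite (theta3 z t) = Finite (theta3 0 t / h0 * h)); [|now injection F].
  rewrite <- L1. apply is_lim_seq_unique. eapply is_lim_seq_ext; [|exact L3].
  intros n. assert (H1 := cbinom_0_pos (polya_m t n)). assert (H2 := polya_N_pos t n).
  assert (H3 : 0 < 2 ^ (2 * polya_m t n)) by (apply pow_lt; lra).
  cbv beta. field. repeat split; lra. }
split.
- replace (h0 / theta3 0 t * theta3 z t) with h; trivial. rewrite E. field. lra.
- rewrite E. apply Rmult_lt_0_compat; trivial. now apply Rdiv_lt_0_compat.
Qed.

(** * Smooth functions on the positive half-line *)

Lemma locally_pos (P : R -> Prop) t : (forall s, 0 < s -> P s) -> 0 < t -> locally t P.
Proof.
intros HP Ht. exists (mkposreal t Ht). intros y Hy. apply HP.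
apply Rabs_def2 in Hy. simpl in Hy. unfold minus, plus, opp in Hy; simpl in Hy. lra.
Qed.

(** Differentiability as an iterated existence of derivatives, which makes closure
under the usual operations an induction on [k]. *)
Fixpoint smooth (k : nat) (f : R -> R) : Prop :=
  match k with
  | O => True
  | S k' => exists f', (forall t, 0 < t -> is_derive f t (f' t)) /\ smooth k' f'
  end.

Lemma smooth_ext k f g : (forall t, 0 < t -> f t = g t) -> smooth k f -> smooth k g.
Proof.
destruct k as [|k]; trivial. intros E (f' & H & Hs). exists f'. split; trivial.
intros t Ht. apply is_derive_ext_loc with f; [|now apply H].
now apply locally_pos.
Qed.

Lemma smooth_pred k f : smooth (S k) f -> smooth k f.
Proof.
revert f. induction k as [|k IH]; intros f; [easy|].
intros (f' & H & Hs). exists f'. split; trivial. now apply IH.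
Qed.

Lemma smooth_plus k f g : smooth k f -> smooth k g -> smooth k (fun t => f t + g t).
Proof.
revert f g. induction k as [|k IH]; intros f g; [easy|].
intros (f' & Hf & Hsf) (g' & Hg & Hsg). exists (fun t => f' t + g' t). split; [|now apply IH].
intros t Ht. apply (is_derive_plus (V := R_NormedModule)); auto.
Qed.

Lemma smooth_const k c : smooth k (fun _ => c).
Proof.
revert c. induction k as [|k IH]; intros c; [easy|]. exists (fun _ => 0).
split; [|apply IH]. intros t _. apply (is_derive_const (V := R_NormedModule)).
Qed.

Lemma smooth_mult k f g : smooth k f -> smooth k g -> smooth k (fun t => f t * g t).
Proof.
revert f g. induction k as [|k IH]; intros f g; [easy|].
intros Hf Hg. assert (Hf' := smooth_pred _ _ Hf). assert (Hg' := smooth_pred _ _ Hg).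
destruct Hf as (f' & Hf & Hsf), Hg as (g' & Hg & Hsg).
exists (fun t => f' t * g t + f t * g' t). split; [|now apply smooth_plus; apply IH].
intros t Ht. apply (is_derive_mult f g t (f' t) (g' t)); auto.
intros; apply Rmult_comm.
Qed.

Lemma smooth_scal k c f : smooth k f -> smooth k (fun t => c * f t).
Proof. intros H. apply smooth_mult; trivial. apply smooth_const. Qed.

Lemma smooth_inv k f : (forall t, 0 < t -> f t <> 0) -> smooth k f -> smooth k (fun t => / f t).
Proof.
intros Hnz. revert f Hnz. induction k as [|k IH]; intros f Hnz; [easy|].
intros Hf. assert (Hf' := smooth_pred _ _ Hf). destruct Hf as (f' & Hf & Hsf).
exists (fun t => (-1 * f' t) * (/ f t * / f t)). split.
- intros t Ht. replace (-1 * f' t * (/ f t * / f t)) with (- f' t / f t ^ 2).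
  + apply is_derive_inv; auto.
  + specialize (Hnz t Ht). field. trivial.
- apply smooth_mult; [now apply smooth_scal|]. apply smooth_mult; now apply IH.
Qed.

Lemma smooth_ln k f : (forall t, 0 < t -> 0 < f t) -> smooth k f -> smooth k (fun t => ln (f t)).
Proof.
intros Hp Hf. destruct k as [|k]; [easy|].
assert (Hf' := smooth_pred _ _ Hf). destruct Hf as (f' & Hf & Hsf).
exists (fun t => f' t * / f t). split.
- intros t Ht. apply (is_derive_comp ln f t (/ f t) (f' t)); [|now apply Hf].
  apply is_derive_Reals, derivable_pt_lim_ln. auto.
- apply smooth_mult; trivial. apply smooth_inv; trivial. intros t Ht. specialize (Hp t Ht). lra.
Qed.

Lemma smooth_Derive_n i k f : smooth (i + k) f ->
  exists g, smooth k g /\ forall t, 0 < t -> Derive_n f i t = g t.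
Proof.
revert k. induction i as [|i IH]; intros k Hf; [now exists f|].
rewrite Nat.add_succ_comm in Hf. destruct (IH _ Hf) as (g & (g' & Hg & Hs) & E).
exists g'. split; trivial. intros t Ht. simpl Derive_n. apply is_derive_unique.
apply is_derive_ext_loc with g; [|now apply Hg].
apply locally_pos; trivial. intros s Hs'. symmetry. now apply E.
Qed.

Lemma smooth_ex_derive_n i k f t : smooth k f -> (i <= k)%nat -> 0 < t -> ex_derive_n f i t.
Proof.
intros Hf Hi Ht. destruct i as [|i]; [easy|].
replace k with (i + S (k - S i))%nat in Hf by lia.
destruct (smooth_Derive_n _ _ _ Hf) as (g & (g' & Hg & _) & E).
exists (g' t). apply is_derive_ext_loc with g; [|now apply Hg].
apply locally_pos; trivial. intros s Hs. symmetry. now apply E.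
Qed.

(** * Dirichlet series *)

(** Stable under multiplication of the coefficients by [lam], since [x exp (- x d)]
is bounded by a multiple of [exp (- x d / 2)]. *)
Definition dirichlet_summable (c lam : nat -> R) : Prop :=
  forall d, 0 < d -> ex_series (fun n => Rabs (c n) * exp (- lam n * d)).

Lemma dirichlet_summable_deriv c lam : (forall n, 0 <= lam n) ->
  dirichlet_summable c lam -> dirichlet_summable (fun n => - lam n * c n) lam.
Proof.
intros Hl H d Hd.
apply ex_series_le_R with (fun n => 2 / d * (Rabs (c n) * exp (- lam n * (d / 2)))).
- intros n. rewrite Rabs_pos_eq.
  2:{ apply Rmult_le_pos; [apply Rabs_pos|left; apply exp_pos]. }
  rewrite Rabs_mult, Rabs_Ropp, (Rabs_pos_eq (lam n)) by apply Hl.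
  assert (Hm := mul_exp_le (lam n) d Hd (Hl n)). assert (Hc := Rabs_pos (c n)). nra.
- apply (ex_series_scal_l (K := R_AbsRing) (2 / d) (fun n => Rabs (c n) * exp (- lam n * (d / 2)))).
  apply H. lra.
Qed.

Lemma dirichlet_ex_series c lam t : dirichlet_summable c lam -> 0 < t ->
  ex_series (fun n => c n * exp (- lam n * t)).
Proof.
intros H Ht. apply ex_series_le_R with (2 := H t Ht).
intros n. rewrite Rabs_mult, (Rabs_pos_eq (exp _)) by (left; apply exp_pos). lra.
Qed.

(** Each term differs from its linear part by at most [h^2] times the term of a
convergent series, so the remainder is quadratic in [h]. *)
Lemma is_derive_dirichlet c lam t : (forall n, 0 <= lam n) -> dirichlet_summable c lam -> 0 < t ->
  is_derive (fun t => Series (fun n => c n * exp (- lam n * t))) t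
    (Series (fun n => - lam n * c n * exp (- lam n * t))).
Proof.
intros Hl H Ht. apply is_derive_Reals. intros eps Heps.
assert (H1 := dirichlet_summable_deriv c lam Hl H).
assert (H2 := dirichlet_summable_deriv _ lam Hl H1).
(* for [|h| < t/2] the point [t + h] stays above [t/2], where the series of
   second derivatives converges absolutely *)
assert (E2 := H2 (t / 2) ltac:(lra)). cbv beta in E2.
set (B := Series (fun n => Rabs (- lam n * (- lam n * c n)) * exp (- lam n * (t / 2)))).
assert (HB : 0 <= B).
{ apply Series_nonneg; trivial. intros n.
  apply Rmult_le_pos; [apply Rabs_pos|left; apply exp_pos]. }
assert (Hd : 0 < Rmin (t / 2) (eps / (B + 1))).
{ apply Rmin_pos; [lra|apply Rdiv_lt_0_compat; lra]. }
exists (mkposreal _ Hd). simpl. intros h Hh0 Hh.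
assert (Hh1 := Rlt_le_trans _ _ _ Hh (Rmin_l _ _)).
assert (Hh2 := Rlt_le_trans _ _ _ Hh (Rmin_r _ _)).
assert (Hth : 0 < t + h) by (apply Rabs_def2 in Hh1; lra).
rewrite <- Series_minus; [|now apply dirichlet_ex_series..].
set (D := Series (fun n => c n * exp (- lam n * (t + h)) - c n * exp (- lam n * t))).
set (L := Series (fun n => - lam n * c n * exp (- lam n * t))).
assert (Hq : Rabs (D - h * L) <= h ^ 2 * B).
{ unfold D, L. rewrite <- Series_scal_l, <- Series_minus.
  2:{ apply (ex_series_minus (V := R_NormedModule)); now apply dirichlet_ex_series. }
  2:{ apply (ex_series_scal_l (K := R_AbsRing) h (fun n => - lam n * c n * exp (- lam n * t))).
      now apply dirichlet_ex_series. }
  assert (Hterm : forall n, Rabs (c n * exp (- lam n * (t + h)) - c n * exp (- lam n * t) -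
     h * (- lam n * c n * exp (- lam n * t))) <=
     h ^ 2 * (Rabs (- lam n * (- lam n * c n)) * exp (- lam n * (t / 2)))).
  { intros n.
    replace (c n * exp (- lam n * (t + h)) - c n * exp (- lam n * t) -
     h * (- lam n * c n * exp (- lam n * t))) with
     (c n * exp (- lam n * t) * (exp (- lam n * h) - 1 - - lam n * h)).
    2:{ rewrite Rmult_plus_distr_l, exp_plus. ring. }
    rewrite !Rabs_mult, (Rabs_pos_eq (exp _)) by (left; apply exp_pos).
    rewrite !Rabs_Ropp, (Rabs_pos_eq (lam n)) by apply Hl.
    apply Rle_trans with (Rabs (c n) * exp (- lam n * t) * ((- lam n * h) ^ 2 * exp (Rabs (- lam n * h)))).
    { apply Rmult_le_compat_l; [|apply exp_taylor1].
      apply Rmult_le_pos; [apply Rabs_pos|left; apply exp_pos]. }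
    replace (Rabs (c n) * exp (- lam n * t) * ((- lam n * h) ^ 2 * exp (Rabs (- lam n * h)))) with
      (h ^ 2 * (lam n * (lam n * Rabs (c n)) * exp (- lam n * t + Rabs (- lam n * h)))).
    2:{ rewrite exp_plus. ring. }
    apply Rmult_le_compat_l; [apply pow2_ge_0|].
    apply Rmult_le_compat_l.
    { specialize (Hl n). assert (P := Rabs_pos (c n)). apply Rmult_le_pos; trivial. now apply Rmult_le_pos. }
    apply exp_le. rewrite Rabs_mult, Rabs_Ropp, (Rabs_pos_eq (lam n)) by apply Hl.
    specialize (Hl n). nra. }
  eapply Rle_trans; [apply Series_Rabs|].
  - apply ex_series_le_R with (fun n => h ^ 2 * (Rabs (- lam n * (- lam n * c n)) * exp (- lam n * (t / 2)))).
    + intros n. rewrite Rabs_Rabsolu. apply Hterm.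
    + now apply ex_series_scal_R.
  - unfold B. rewrite <- Series_scal_l. apply Series_le.
    + intros n. split; [apply Rabs_pos|apply Hterm].
    + now apply ex_series_scal_R. }
replace (D / h - L) with ((D - h * L) / h) by (field; trivial).
unfold Rdiv. rewrite Rabs_mult, Rabs_inv.
assert (Hha : 0 < Rabs h) by now apply Rabs_pos_lt.
apply (Rmult_lt_reg_r (Rabs h)); trivial.
rewrite Rmult_assoc, Rinv_l, Rmult_1_r by lra.
eapply Rle_lt_trans; [exact Hq|].
rewrite <- (pow2_abs h).
assert (Rabs h * (B + 1) < eps).
{ apply (Rmult_lt_compat_r (B + 1)) in Hh2; [|lra].
  unfold Rdiv in Hh2. rewrite Rmult_assoc, Rinv_l, Rmult_1_r in Hh2 by lra. trivial. }
simpl. nra.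
Qed.

Lemma smooth_dirichlet k c lam : (forall n, 0 <= lam n) -> dirichlet_summable c lam ->
  smooth k (fun t => Series (fun n => c n * exp (- lam n * t))).
Proof.
intros Hl. revert c. induction k as [|k IH]; intros c H; [easy|].
exists (fun t => Series (fun n => (- lam n * c n) * exp (- lam n * t))). split.
- intros t Ht. now apply is_derive_dirichlet.
- now apply IH, dirichlet_summable_deriv.
Qed.

(** * Third derivatives and pointwise limits *)

(** Monotonicity, applied to three successive differences. *)
Lemma third_difference_le f f1 f2 f3 a h : 0 <= h ->
  (forall s, a <= s <= a + 3 * h -> is_derive f s (f1 s) /\ is_derive f1 s (f2 s) /\ is_derive f2 s (f3 s)) ->
  (forall s, a <= s <= a + 3 * h -> f3 s <= 0) ->
  f (a + 3 * h) - 3 * f (a + 2 * h) + 3 * f (a + h) - f a <= 0.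
Proof.
intros Hh Hd Hn.
assert (S : forall (g : R -> R) g' d s, is_derive g (s + d) (g' (s + d)) -> is_derive (fun x => g (x + d)) s (g' (s + d))).
{ intros g g' d s H. rewrite <- (Rmult_1_l (g' (s + d))).
  apply (is_derive_comp g (fun x => x + d) s (g' (s + d)) 1); trivial.
  auto_derive; trivial. }
(* each differencing lowers the order of the derivative whose sign is used *)
assert (D2 : forall s, a <= s <= a + 2 * h -> 0 <= f2 s - f2 (s + h)).
{ intros s Hs. assert (- f2 s <= - f2 (s + h)); [|lra].
  apply (is_derive_nonneg_le (fun x => - f2 x) (fun x => - f3 x)); [lra| |].
  - intros x Hx. apply (is_derive_opp f2). apply Hd. lra.
  - intros x Hx. specialize (Hn x). lra. }
assert (D1 : forall s, a <= s <= a + h -> 0 <= - (f1 s - 2 * f1 (s + h) + f1 (s + 2 * h))).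
{ intros s Hs.
  assert (f1 s - f1 (s + h) <= f1 (s + h) - f1 (s + h + h)).
  { apply (is_derive_nonneg_le (fun x => f1 x - f1 (x + h)) (fun x => f2 x - f2 (x + h))); [lra| |].
    - intros x Hx. apply (is_derive_minus (V := R_NormedModule)); [apply Hd; lra|].
      apply S. apply Hd. lra.
    - intros x Hx. apply D2. lra. }
  replace (s + 2 * h) with (s + h + h) by ring. lra. }
assert (- (f a - 2 * f (a + h) + f (a + 2 * h)) <=
   - (f (a + h) - 2 * f (a + h + h) + f (a + h + 2 * h))).
{ apply (is_derive_nonneg_le (fun x => - (f x - 2 * f (x + h) + f (x + 2 * h)))
    (fun x => - (f1 x - 2 * f1 (x + h) + f1 (x + 2 * h)))); [lra| |].
  - intros x Hx. apply (is_derive_opp (fun x => f x - 2 * f (x + h) + f (x + 2 * h))).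
    apply (is_derive_plus (V := R_NormedModule)); [|apply S, Hd; lra].
    apply (is_derive_minus (V := R_NormedModule)); [apply Hd; lra|].
    apply (is_derive_scal (fun x => f (x + h))), S, Hd. lra.
  - intros x Hx. apply D1. lra. }
replace (a + 3 * h) with (a + h + 2 * h) by ring.
replace (a + h + h) with (a + 2 * h) in * by ring. lra.
Qed.

Definition third_deriv_on (lo hi : R) (f f3 : R -> R) : Prop :=
  exists f1 f2, forall s, lo < s < hi ->
    is_derive f s (f1 s) /\ is_derive f1 s (f2 s) /\ is_derive f2 s (f3 s).

(** If [f3] were positive at [s], it would exceed some [e > 0] nearby and the third
difference of [f] with a small step [h] would be at least [e h^3]; but the third
differences of the [fn] are nonpositive and pass to the limit. *)
Lemma third_deriv_limit_nonpos lo hi (fn fn3 : nat -> R -> R) (f f3 : R -> R) :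
  (forall n, third_deriv_on lo hi (fn n) (fn3 n)) ->
  (forall n s, lo < s < hi -> fn3 n s <= 0) ->
  (forall s, lo < s < hi -> is_lim_seq (fun n => fn n s) (f s)) ->
  third_deriv_on lo hi f f3 ->
  (forall s, lo < s < hi -> continuous f3 s) ->
  forall s, lo < s < hi -> f3 s <= 0.
Proof.
intros Hn3 Hneg Hlim Hf Hc s Hs.
destruct (Rle_lt_dec (f3 s) 0) as [|Hpos]; trivial. exfalso.
set (e := f3 s / 2).
assert (Hloc : locally s (fun y => e < f3 y)).
{ assert (Hcs := Hc s Hs).
  apply (Hcs (fun y => e < y)).
  exists (mkposreal e ltac:(unfold e; lra)). intros y Hy.
  apply Rabs_def2 in Hy. simpl in Hy. unfold minus, plus, opp in Hy; simpl in Hy. unfold e in *. lra. }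
destruct Hloc as [d Hd].
set (h := Rmin (d / 4) ((hi - s) / 4)).
assert (Hh : 0 < h).
{ unfold h. apply Rmin_pos; [destruct d as [d Hd0]; simpl; lra|lra]. }
assert (Hh1 : h <= d / 4) by apply Rmin_l.
assert (Hh2 : h <= (hi - s) / 4) by apply Rmin_r.
set (T := fun g : R -> R => g (s + 3 * h) - 3 * g (s + 2 * h) + 3 * g (s + h) - g s).
assert (Tn : T f <= 0).
{ apply (is_lim_seq_le (fun n => T (fn n)) (fun _ => 0) (T f) 0).
  - intros n. destruct (Hn3 n) as (g1 & g2 & Hg).
    apply (third_difference_le (fn n) g1 g2 (fn3 n) s h); [lra| |].
    + intros x Hx. apply Hg. lra.
    + intros x Hx. apply Hneg. lra.
  - unfold T. apply is_lim_seq_minus'; [|apply Hlim; lra].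
    apply is_lim_seq_plus'; [apply is_lim_seq_minus'; [apply Hlim; lra|]|];
      (apply is_lim_seq_mult'; [apply is_lim_seq_const|apply Hlim; lra]).
  - apply is_lim_seq_const. }
destruct Hf as (f1 & f2 & Hf).
assert (Tp : e * h ^ 3 - T f <= 0).
{ assert (H := third_difference_le (fun x => e * x ^ 3 / 6 - f x) (fun x => e * x ^ 2 / 2 - f1 x)
    (fun x => e * x - f2 x) (fun x => e - f3 x) s h ltac:(lra)).
  replace (e * h ^ 3 - T f) with
   ((e * (s + 3 * h) ^ 3 / 6 - f (s + 3 * h)) - 3 * (e * (s + 2 * h) ^ 3 / 6 - f (s + 2 * h)) +
    3 * (e * (s + h) ^ 3 / 6 - f (s + h)) - (e * s ^ 3 / 6 - f s)) by (unfold T; field).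
  apply H.
  - intros x Hx. destruct (Hf x) as (A1 & A2 & A3); [lra|]. split; [|split].
    + apply (is_derive_minus (V := R_NormedModule)); trivial.
      auto_derive; trivial. field.
    + apply (is_derive_minus (V := R_NormedModule)); trivial.
      auto_derive; trivial. field.
    + apply (is_derive_minus (V := R_NormedModule)); trivial.
      auto_derive; trivial. ring.
  - intros x Hx. assert (e < f3 x); [|lra]. apply Hd.
    unfold ball; simpl; unfold AbsRing_ball, abs, minus, plus, opp; simpl.
    rewrite Rabs_pos_eq; lra. }
assert (0 < e * h ^ 3).
{ apply Rmult_lt_0_compat; [unfold e; lra|]. now apply pow_lt. }
lra.
Qed.

(** If [f2 a < 0] then [f] lies below a downward parabola after [a]; given
[0 <= f2], if [f1 s > 0] then [f] lies above an increasing line after [s]. Both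
contradict the convergence of [f] along [tk]. *)
Lemma third_deriv_bounded_signs (f f1 f2 f3 : R -> R) (tk : nat -> R) (l : R) :
  (forall s, 0 < s -> is_derive f s (f1 s) /\ is_derive f1 s (f2 s) /\ is_derive f2 s (f3 s)) ->
  (forall s, 0 < s -> f3 s <= 0) ->
  is_lim_seq tk p_infty -> is_lim_seq (fun k => f (tk k)) l ->
  forall s, 0 < s -> f1 s <= 0 /\ 0 <= f2 s.
Proof.
intros Hd H3 Htk Hl.
assert (Hev : forall X, exists k, X < tk k /\ l - 1 < f (tk k) < l + 1).
{ intros X. apply is_lim_seq_spec in Htk, Hl.
  destruct (Htk X) as [num1 H1]. destruct (Hl (mkposreal 1 Rlt_0_1)) as [num2 H2].
  exists (num1 + num2)%nat. specialize (H1 (num1 + num2)%nat ltac:(lia)). specialize (H2 (num1 + num2)%nat ltac:(lia)).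
  simpl in H2. apply Rabs_def2 in H2. split; [trivial|lra]. }
assert (P2 : forall s, 0 < s -> 0 <= f2 s).
{ intros a Ha. destruct (Rle_lt_dec 0 (f2 a)) as [|Hneg]; trivial. exfalso.
  assert (A2 : forall s, a <= s -> f2 s <= f2 a).
  { intros s Hs. assert (- f2 a <= - f2 s); [|lra].
    apply (is_derive_nonneg_le (fun x => - f2 x) (fun x => - f3 x)); trivial.
    - intros x Hx. apply (is_derive_opp f2). apply Hd. lra.
    - intros x Hx. specialize (H3 x). lra. }
  assert (A1 : forall s, a <= s -> f1 s <= f1 a + f2 a * (s - a)).
  { intros s Hs.
    assert (f2 a * (a - a) - f1 a <= f2 a * (s - a) - f1 s); [|lra].
    apply (is_derive_nonneg_le (fun x => f2 a * (x - a) - f1 x) (fun x => f2 a - f2 x)); trivial.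
    - intros x Hx. apply (is_derive_minus (V := R_NormedModule)); [|apply Hd; lra].
      auto_derive; trivial. ring.
    - intros x Hx. specialize (A2 x). lra. }
  assert (A0 : forall s, a <= s -> f s <= f a + f1 a * (s - a) + f2 a * (s - a) ^ 2 / 2).
  { intros s Hs.
    assert (f1 a * (a - a) + f2 a * (a - a) ^ 2 / 2 - f a <= f1 a * (s - a) + f2 a * (s - a) ^ 2 / 2 - f s); [|simpl in *; lra].
    apply (is_derive_nonneg_le (fun x => f1 a * (x - a) + f2 a * (x - a) ^ 2 / 2 - f x)
      (fun x => f1 a + f2 a * (x - a) - f1 x)); trivial.
    - intros x Hx. apply (is_derive_minus (V := R_NormedModule)); [|apply Hd; lra].
      auto_derive; trivial. field.
    - intros x Hx. specialize (A1 x). lra. }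
  set (b := Rabs (f1 a) + Rabs (f a) + Rabs l + 2).
  assert (Hb : 0 < b).
  { unfold b. assert (Q1 := Rabs_pos (f1 a)). assert (Q2 := Rabs_pos (f a)). assert (Q3 := Rabs_pos l). lra. }
  destruct (Hev (a + 1 + 2 * b / - f2 a)) as (k & Hk & Hk2 & _).
  assert (Hq : 0 < 2 * b / - f2 a) by (apply Rdiv_lt_0_compat; lra).
  set (x := tk k - a). assert (Hx1 : 1 < x) by (unfold x; lra).
  assert (Hx2 : 2 * b < - f2 a * x).
  { assert (2 * b / - f2 a < x) by (unfold x; lra).
    apply (Rmult_lt_compat_l (- f2 a)) in H; [|lra].
    replace (- f2 a * (2 * b / - f2 a)) with (2 * b) in H by (field; lra). lra. }
  specialize (A0 (tk k) ltac:(lra)). fold x in A0.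
  assert (B1 := Rle_abs (f1 a)). assert (B2 := Rle_abs (f a)). assert (B3 := Rle_abs (- l)).
  rewrite Rabs_Ropp in B3.
  assert (f2 a * x ^ 2 / 2 < - b * x) by (simpl; nra).
  assert (b * x >= Rabs (f1 a) * x + Rabs (f a) + Rabs l + 2).
  { unfold b. assert (Q1 := Rabs_pos (f1 a)). assert (Q2 := Rabs_pos (f a)). assert (Q3 := Rabs_pos l). nra. }
  assert (f1 a * x <= Rabs (f1 a) * x) by (apply Rmult_le_compat_r; lra).
  lra. }
intros s Hs. split; [|now apply P2].
destruct (Rle_lt_dec (f1 s) 0) as [|Hpos]; trivial. exfalso.
assert (A1 : forall x, s <= x -> f1 s <= f1 x).
{ intros x Hx. apply (is_derive_nonneg_le f1 f2); trivial.
  - intros y Hy. apply Hd. lra.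
  - intros y Hy. apply P2. lra. }
destruct (Hev (s + (Rabs l + Rabs (f s) + 2) / f1 s)) as (k & Hk & _ & Hk2).
assert (0 < (Rabs l + Rabs (f s) + 2) / f1 s).
{ apply Rdiv_lt_0_compat; trivial. assert (Q2 := Rabs_pos (f s)). assert (Q3 := Rabs_pos l). lra. }
assert (A0 : f s - f1 s * s <= f (tk k) - f1 s * tk k).
{ apply (is_derive_nonneg_le (fun x => f x - f1 s * x) (fun x => f1 x - f1 s)); [lra| |].
  - intros x Hx. apply (is_derive_minus (V := R_NormedModule)); [apply Hd; lra|].
    auto_derive; trivial. ring.
  - intros x Hx. specialize (A1 x). lra. }
assert (Rabs l + Rabs (f s) + 2 < f1 s * (tk k - s)).
{ assert ((Rabs l + Rabs (f s) + 2) / f1 s < tk k - s) as Hx by lra.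
  apply (Rmult_lt_compat_l (f1 s)) in Hx; trivial.
  replace (f1 s * ((Rabs l + Rabs (f s) + 2) / f1 s)) with (Rabs l + Rabs (f s) + 2) in Hx by (field; lra).
  trivial. }
assert (B2 := Rle_abs (- f s)). assert (B3 := Rle_abs l). rewrite Rabs_Ropp in B2. lra.
Qed.

Lemma third_deriv_exp_nonpos (S f f1 f2 f3 : R -> R) t :
  (forall s, 0 < s -> is_derive f s (f1 s) /\ is_derive f1 s (f2 s) /\ is_derive f2 s (f3 s)) ->
  (forall s, 0 < s -> S s = exp (f s)) -> 0 < t ->
  f1 t <= 0 -> 0 <= f2 t -> f3 t <= 0 -> Derive_n S 3 t <= 0.
Proof.
intros Hd HS Ht H1 H2 H3.
assert (E1 : forall s, 0 < s -> is_derive (fun s => exp (f s)) s (f1 s * exp (f s))).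
{ intros s Hs. apply (is_derive_comp exp f s (exp (f s)) (f1 s)); [|now apply Hd].
  apply is_derive_Reals, derivable_pt_lim_exp. }
assert (M : forall a b a' b' s, is_derive a s a' -> is_derive b s b' ->
  is_derive (fun s => a s * b s) s (a' * b s + a s * b')).
{ intros a b a' b' s Ha Hb. apply (is_derive_mult a b s a' b'); trivial. intros; apply Rmult_comm. }
assert (D1 : forall s, 0 < s -> Derive_n S 1 s = f1 s * exp (f s)).
{ intros s Hs. simpl. apply is_derive_unique.
  apply is_derive_ext_loc with (fun s => exp (f s)); [|now apply E1].
  apply locally_pos; trivial. intros; symmetry; auto. }
assert (D2 : forall s, 0 < s -> Derive_n S 2 s = (f2 s + f1 s * f1 s) * exp (f s)).
{ intros s Hs. change (Derive (Derive_n S 1) s = (f2 s + f1 s * f1 s) * exp (f s)).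
  apply is_derive_unique.
  apply is_derive_ext_loc with (fun s => f1 s * exp (f s)).
  - apply locally_pos; trivial. intros; symmetry; auto.
  - replace ((f2 s + f1 s * f1 s) * exp (f s)) with (f2 s * exp (f s) + f1 s * (f1 s * exp (f s))) by ring.
    apply (M f1 (fun s => exp (f s))); [now apply Hd|now apply E1]. }
assert (D3 : Derive_n S 3 t = (f3 t + 3 * (f2 t * f1 t) + f1 t ^ 3) * exp (f t)).
{ change (Derive (Derive_n S 2) t = (f3 t + 3 * (f2 t * f1 t) + f1 t ^ 3) * exp (f t)).
  apply is_derive_unique.
  apply is_derive_ext_loc with (fun s => (f2 s + f1 s * f1 s) * exp (f s)).
  - apply locally_pos; trivial. intros; symmetry; auto.
  - replace ((f3 t + 3 * (f2 t * f1 t) + f1 t ^ 3) * exp (f t)) with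
     ((f3 t + (f2 t * f1 t + f1 t * f2 t)) * exp (f t) + (f2 t + f1 t * f1 t) * (f1 t * exp (f t))) by ring.
    apply (M (fun s => f2 s + f1 s * f1 s) (fun s => exp (f s))); [|now apply E1].
    apply (is_derive_plus (V := R_NormedModule)); [now apply Hd|].
    apply (M f1 f1); now apply Hd. }
rewrite D3. assert (Hp := exp_pos (f t)).
assert (f2 t * f1 t <= 0) by nra. assert (f1 t ^ 3 <= 0) by (simpl; nra). nra.
Qed.

Lemma third_deriv_on_plus lo hi f g f3 g3 : third_deriv_on lo hi f f3 -> third_deriv_on lo hi g g3 ->
  third_deriv_on lo hi (fun t => f t + g t) (fun t => f3 t + g3 t).
Proof.
intros (f1 & f2 & Hf) (g1 & g2 & Hg).
exists (fun t => f1 t + g1 t), (fun t => f2 t + g2 t). intros s Hs.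
destruct (Hf s Hs) as (A1 & A2 & A3), (Hg s Hs) as (B1 & B2 & B3).
split; [|split]; now apply (is_derive_plus (V := R_NormedModule)).
Qed.

Lemma third_deriv_on_scal lo hi c f f3 : third_deriv_on lo hi f f3 ->
  third_deriv_on lo hi (fun t => c * f t) (fun t => c * f3 t).
Proof.
intros (f1 & f2 & Hf).
exists (fun t => c * f1 t), (fun t => c * f2 t). intros s Hs.
destruct (Hf s Hs) as (A1 & A2 & A3).
split; [|split]; now apply is_derive_scal.
Qed.

Lemma third_deriv_on_minus lo hi f g f3 g3 : third_deriv_on lo hi f f3 -> third_deriv_on lo hi g g3 ->
  third_deriv_on lo hi (fun t => f t - g t) (fun t => f3 t - g3 t).
Proof.
intros (f1 & f2 & Hf) (g1 & g2 & Hg).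
exists (fun t => f1 t - g1 t), (fun t => f2 t - g2 t). intros s Hs.
destruct (Hf s Hs) as (A1 & A2 & A3), (Hg s Hs) as (B1 & B2 & B3).
split; [|split]; now apply (is_derive_minus (V := R_NormedModule)).
Qed.

Lemma third_deriv_on_sum lo hi (f f3 : nat -> R -> R) n :
  (forall j, third_deriv_on lo hi (f j) (f3 j)) ->
  third_deriv_on lo hi (fun t => sum_n (fun j => f j t) n) (fun t => sum_n (fun j => f3 j t) n).
Proof.
intros H.
assert (E : forall (h : nat -> R -> R) n s, sum_n (fun j => h j s) (S n) = sum_n (fun j => h j s) n + h (S n) s).
{ intros h m s. exact (sum_Sn (fun j => h j s) m). }
induction n as [|n IH].
- destruct (H O) as (f1 & f2 & Hf). exists f1, f2. intros s Hs.
  rewrite sum_O. destruct (Hf s Hs) as (A1 & A2 & A3). split; [|split]; trivial.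
  eapply is_derive_ext; [|exact A1]. intros t; simpl. now rewrite sum_O.
- destruct (third_deriv_on_plus _ _ _ _ _ _ IH (H (S n))) as (f1 & f2 & Hf).
  exists f1, f2. intros s Hs. rewrite E. destruct (Hf s Hs) as (A1 & A2 & A3). split; [|split]; trivial.
  eapply is_derive_ext; [|exact A1]. intros t. cbv beta. now rewrite E.
Qed.

Lemma third_deriv_on_ext lo hi f g f3 g3 : (forall t, lo < t < hi -> f t = g t) ->
  (forall t, lo < t < hi -> f3 t = g3 t) -> third_deriv_on lo hi f f3 -> third_deriv_on lo hi g g3.
Proof.
intros E E3 (f1 & f2 & Hf). exists f1, f2. intros s Hs. rewrite <- E3 by trivial.
destruct (Hf s Hs) as (A1 & A2 & A3). split; [|split]; trivial.
eapply is_derive_ext_loc; [|exact A1].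
assert (Hd : 0 < Rmin (s - lo) (hi - s)) by (apply Rmin_pos; lra).
exists (mkposreal _ Hd). intros y Hy. apply E.
apply Rabs_def2 in Hy. simpl in Hy. unfold minus, plus, opp in Hy; simpl in Hy.
assert (M1 := Rmin_l (s - lo) (hi - s)). assert (M2 := Rmin_r (s - lo) (hi - s)). lra.
Qed.

(** * The logistic kernel *)

Definition sig (x : R) : R := / (1 + exp x).

Lemma sig_range x : 0 < sig x < 1.
Proof.
assert (Hp := exp_pos x). unfold sig. split; [apply Rinv_0_lt_compat; lra|].
rewrite <- Rinv_1. apply Rinv_lt_contravar; lra.
Qed.

Lemma is_derive_sig x : is_derive sig x (- (sig x * (1 - sig x))).
Proof.
assert (Hp := exp_pos x). unfold sig. auto_derive; [lra|]. field. lra.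
Qed.

Lemma sig_half x : 0 <= x -> sig x <= / 2.
Proof.
intros Hx. unfold sig. assert (H := exp_ineq1_le x). apply Rinv_le_contravar; lra.
Qed.

(** The second derivative of [x^3 sig x], written as a polynomial in [x] and
[sig x]. Since [- sig] is the derivative of [softplus], the third derivative of
[softplus (k / t)] in [t] is this function at [k / t], divided by [t^3]. *)
Definition d2_cube (x : R) : R :=
  let s := sig x in
  6 * x * s - 6 * x ^ 2 * (s * (1 - s)) + x ^ 3 * (s * (1 - s) * (1 - 2 * s)).

(** One sixth of the third derivative of [x^3 sig x]; the normalisation makes the
value at [0] equal to [1/2]. *)
Definition d3_cube (x : R) : R :=
  let s := sig x in
  s - 3 * x * (s * (1 - s)) + 3 / 2 * x ^ 2 * (s * (1 - s) * (1 - 2 * s)) -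
  x ^ 3 / 6 * (s * (1 - s) * (1 - 6 * (s * (1 - s)))).

(** One sixth of the fourth derivative of [x^3 sig x]. *)
Definition d4_cube (x : R) : R :=
  let s := sig x in
  - 4 * (s * (1 - s)) + 6 * x * (s * (1 - s) * (1 - 2 * s)) -
  2 * x ^ 2 * (s * (1 - s) * (1 - 6 * (s * (1 - s)))) +
  x ^ 3 / 6 * (s * (1 - s) * (1 - 2 * s) * (1 - 12 * (s * (1 - s)))).

Lemma is_derive_d2_cube x : is_derive d2_cube x (6 * d3_cube x).
Proof.
assert (H := is_derive_sig x). unfold d2_cube, d3_cube. cbv zeta.
assert (He : ex_derive (fun x => sig x) x) by (eexists; exact H).
auto_derive; [repeat split; exact He|].
replace (Derive (fun x => sig x) x) with (- (sig x * (1 - sig x))) by (symmetry; apply is_derive_unique, H).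
field.
Qed.

Lemma is_derive_d3_cube x : is_derive d3_cube x (d4_cube x).
Proof.
assert (H := is_derive_sig x). unfold d4_cube, d3_cube. cbv zeta.
assert (He : ex_derive (fun x => sig x) x) by (eexists; exact H).
auto_derive; [repeat split; exact He|].
replace (Derive (fun x => sig x) x) with (- (sig x * (1 - sig x))) by (symmetry; apply is_derive_unique, H).
field.
Qed.

(** With a minus sign in the exponent, so that it decays at infinity. Each factor of
the dual product splits into two factors [1 + exp (- x)]. *)
Definition softplus (x : R) : R := ln (1 + exp (- x)).

Lemma third_deriv_softplus k : exists f1 f2, forall t, 0 < t ->
  is_derive (fun t => softplus (k / t)) t (f1 t) /\ is_derive f1 t (f2 t) /\
  is_derive f2 t (d2_cube (k / t) / t ^ 3).
Proof.
exists (fun t => k / t ^ 2 * sig (k / t)).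
exists (fun t => k ^ 2 / t ^ 4 * (sig (k / t) * (1 - sig (k / t))) - 2 * k / t ^ 3 * sig (k / t)).
intros t Ht.
assert (Hs := is_derive_sig (k / t)).
assert (He : ex_derive (fun x => sig x) (k * / t)) by (eexists; exact Hs).
assert (HD : Derive (fun x => sig x) (k * / t) = - (sig (k / t) * (1 - sig (k / t))))
  by (apply is_derive_unique; exact Hs).
split; [|split].
- unfold softplus, sig. assert (Hp := exp_pos (- (k / t))).
  assert (E : exp (k / t) = / exp (- (k / t))) by (rewrite exp_Ropp, Rinv_inv; reflexivity).
  rewrite E. auto_derive.
  + split; [lra|]. split; [|easy]. unfold Rdiv in Hp. lra.
  + fold (k / t). field. repeat split; lra.
- auto_derive.
  + repeat split; trivial; repeat apply Rmult_integral_contrapositive_currified; lra.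
  + rewrite HD. fold (k / t). field. lra.
- unfold d2_cube. cbv zeta. auto_derive.
  + repeat split; trivial; repeat apply Rmult_integral_contrapositive_currified; lra.
  + rewrite HD. fold (k / t). field. lra.
Qed.

(** * Bounds for the logistic kernel *)

Lemma exp_step l h e r e' : 0 <= h -> 0 <= e <= exp l -> r = l + h ->
  e' <= e * (1 + h + h ^ 2 / 2 + h ^ 3 / 6 + h ^ 4 / 24 + h ^ 5 / 120) -> e' <= exp r.
Proof.
intros Hh He -> He'. eapply Rle_trans; [exact He'|]. rewrite exp_plus.
assert (H := exp_ge_taylor h Hh).
assert (0 <= h ^ 2 /\ 0 <= h ^ 3 /\ 0 <= h ^ 4 /\ 0 <= h ^ 5) by (repeat split; now apply pow_le).
apply Rmult_le_compat; lra.
Qed.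

Lemma exp_values :
  27 <= exp (33 / 10) /\ 44.5 <= exp (38 / 10) /\ 73.3 <= exp (43 / 10) /\ 120.8 <= exp (48 / 10) /\
  199 <= exp (53 / 10) /\ 328 <= exp (58 / 10) /\ 890 <= exp (68 / 10) /\ 3000 <= exp (83 / 10).
Proof.
assert (H0 := exp_0).
assert (3.001 <= exp (11 / 10)) by (apply (exp_step 0 (11 / 10) 1); lra).
assert (9.006 <= exp (22 / 10)) by (apply (exp_step (11 / 10) (11 / 10) 3.001); lra).
assert (27 <= exp (33 / 10)) by (apply (exp_step (22 / 10) (11 / 10) 9.006); lra).
assert (44.5 <= exp (38 / 10)) by (apply (exp_step (33 / 10) (1 / 2) 27); lra).
assert (73.3 <= exp (43 / 10)) by (apply (exp_step (38 / 10) (1 / 2) 44.5); lra).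
assert (120.8 <= exp (48 / 10)) by (apply (exp_step (43 / 10) (1 / 2) 73.3); lra).
assert (199 <= exp (53 / 10)) by (apply (exp_step (48 / 10) (1 / 2) 120.8); lra).
assert (328 <= exp (58 / 10)) by (apply (exp_step (53 / 10) (1 / 2) 199); lra).
assert (890 <= exp (68 / 10)) by (apply (exp_step (58 / 10) 1 328); lra).
assert (3000 <= exp (83 / 10)) by (apply (exp_step (68 / 10) (3 / 2) 890); lra).
repeat split; assumption.
Qed.

(** Coefficients of the numerator of [d4_cube] as a polynomial in [exp x], see
[d4_cube_alt]. *)
Definition num1 (x : R) := 4 - 6 * x + 2 * x ^ 2 - x ^ 3 / 6.
Definition num2 (x : R) := 12 - 6 * x - 6 * x ^ 2 + 11 / 6 * x ^ 3.
Definition num3 (x : R) := 12 + 6 * x - 6 * x ^ 2 - 11 / 6 * x ^ 3.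
Definition num4 (x : R) := 4 + 6 * x + 2 * x ^ 2 + x ^ 3 / 6.

Lemma d4_cube_alt x : d4_cube x = - (exp x * (exp x ^ 3 * num1 x + exp x ^ 2 * num2 x + exp x * num3 x + num4 x))
  / (1 + exp x) ^ 5.
Proof.
assert (Hp := exp_pos x). unfold d4_cube, sig, num1, num2, num3, num4. field. lra.
Qed.

(** A polynomial of degree at most five with nonnegative coefficients in the
Bernstein basis of [[0, w]] is nonnegative there. With these products at hand
linear arithmetic finds the coefficients. *)
Lemma bernstein_facts d w : 0 <= d <= w ->
  0 <= (w - d) ^ 5 /\ 0 <= d * (w - d) ^ 4 /\ 0 <= d ^ 2 * (w - d) ^ 3 /\
  0 <= d ^ 3 * (w - d) ^ 2 /\ 0 <= d ^ 4 * (w - d) /\ 0 <= d ^ 5.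
Proof.
intros [H1 H2]. assert (H3 : 0 <= w - d) by lra.
repeat split; repeat apply Rmult_le_pos; try apply pow_le; trivial; lra.
Qed.

(** On a short interval [[l, l + w]] the exponential is replaced by a lower bound
[e] of [exp l] times a Taylor polynomial, and the lower-order term by its value
for [exp x = e]; there remain two polynomial inequalities in [x - l]. *)
Lemma d4_piece l w e x : 1 <= e <= exp l -> l <= x <= l + w ->
  0 <= 13 / 20 * e * (1 + (x - l) + (x - l) ^ 2 / 2 + (x - l) ^ 3 / 6) + 13 / 4 - x ^ 2 * num1 x ->
  0 <= 13 / 20 * e * (1 + (x - l) + (x - l) ^ 2 / 2 + (x - l) ^ 3 / 6) + 13 / 4 - x ^ 2 * num1 x -
    (x ^ 2 * num2 x - 13 / 2) / e ->
  x ^ 2 * (exp x * num1 x + num2 x) <= 13 / 20 * (exp x ^ 2 + 5 * exp x + 10).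
Proof.
intros He Hx H1 H2. set (d := x - l) in *.
set (A := x ^ 2 * num1 x) in *. set (B := x ^ 2 * num2 x - 13 / 2) in *.
set (T := e * (1 + d + d ^ 2 / 2 + d ^ 3 / 6)) in *.
assert (Hd : 0 <= d) by (unfold d; lra).
assert (HT : T <= exp x).
{ assert (H := exp_ge_taylor d Hd). assert (0 <= d ^ 4) by now apply pow_le. assert (0 <= d ^ 5) by now apply pow_le.
  assert (0 <= d ^ 2) by now apply pow_le. assert (0 <= d ^ 3) by now apply pow_le.
  replace x with (l + d) by (unfold d; ring). rewrite exp_plus. unfold T.
  apply Rmult_le_compat; lra. }
assert (HeE : e <= exp x).
{ apply Rle_trans with (exp l); [lra|]. apply exp_le. lra. }
set (E := exp x) in *.
assert (K1 : 0 <= 13 / 20 * E + 13 / 4 - A) by (unfold T in *; lra).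
assert (K2 : B <= E * (13 / 20 * E + 13 / 4 - A)).
{ destruct (Rle_dec B 0) as [HB|HB].
  - apply Rle_trans with 0; trivial. apply Rmult_le_pos; lra.
  - assert (K3 : B / e <= 13 / 20 * E + 13 / 4 - A) by (unfold T in *; lra).
    assert (K4 : 0 <= B / e) by (left; apply Rdiv_lt_0_compat; lra).
    apply Rle_trans with (e * (B / e)); [right; field; lra|].
    apply Rmult_le_compat; lra. }
replace (x ^ 2 * (E * num1 x + num2 x)) with (E * A + B + 13 / 2) by (unfold A, B; ring).
nra.
Qed.

Ltac bernstein d w :=
  let H := fresh in
  assert (H := bernstein_facts d w ltac:(unfold d; lra));
  destruct H as (? & ? & ? & ? & ? & ?).

Ltac d4_piece_at l w e x :=
  apply (d4_piece l w e x); [lra|lra| |];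
  (replace x with (l + (x - l)) by ring; unfold num1, num2;
   replace (l + (x - l) - l) with (x - l) by ring;
   let d := fresh in set (d := x - l);
   bernstein d w; lra).

(** The critical region is around [x = 4.8], where [- x^2 * d4_cube x] reaches
about [0.586]; the subdivision is fine enough for the constant [13/20]. *)
Lemma d4_key x : 9 / 4 <= x ->
  x ^ 2 * (exp x * num1 x + num2 x) <= 13 / 20 * (exp x ^ 2 + 5 * exp x + 10).
Proof.
intros Hx. assert (V := exp_values). assert (Hp := exp_pos x).
(* up to 3.3 the left side is nonpositive, and beyond 8.3 its leading term is *)
destruct (Rle_dec x (33 / 10)) as [H1|H1].
{ assert (N1 : num1 x <= 0).
  { unfold num1. replace x with (9 / 4 + (x - 9 / 4)) by ring. set (d := x - 9 / 4).
    bernstein d (21 / 20). lra. }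
  assert (N2 : num2 x <= 0).
  { unfold num2. replace x with (9 / 4 + (x - 9 / 4)) by ring. set (d := x - 9 / 4).
    bernstein d (21 / 20). lra. }
  assert (0 <= x ^ 2) by apply pow2_ge_0.
  assert (exp x * num1 x <= 0) by nra.
  apply Rle_trans with 0; nra. }
destruct (Rle_dec x (38 / 10)) as [H2|H2]; [d4_piece_at (33 / 10) (1 / 2) 27 x|].
destruct (Rle_dec x (43 / 10)) as [H3|H3]; [d4_piece_at (38 / 10) (1 / 2) 44.5 x|].
destruct (Rle_dec x (48 / 10)) as [H4|H4]; [d4_piece_at (43 / 10) (1 / 2) 73.3 x|].
destruct (Rle_dec x (53 / 10)) as [H5|H5]; [d4_piece_at (48 / 10) (1 / 2) 120.8 x|].
destruct (Rle_dec x (58 / 10)) as [H6|H6]; [d4_piece_at (53 / 10) (1 / 2) 199 x|].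
destruct (Rle_dec x (68 / 10)) as [H7|H7]; [d4_piece_at (58 / 10) 1 328 x|].
destruct (Rle_dec x (83 / 10)) as [H8|H8]; [d4_piece_at (68 / 10) (3 / 2) 890 x|].
assert (N1 : num1 x <= 0).
{ unfold num1. replace x with (83 / 10 + (x - 83 / 10)) by ring. set (d := x - 83 / 10).
  assert (0 <= d) by (unfold d; lra). assert (0 <= d ^ 2) by now apply pow_le. assert (0 <= d ^ 3) by now apply pow_le. lra. }
assert (HE : 3000 <= exp x).
{ apply Rle_trans with (exp (83 / 10)); [lra|]. apply exp_le. lra. }
assert (HT := exp_ge_taylor x ltac:(lra)).
assert (0 <= x ^ 2) by (apply pow_le; lra). assert (0 <= x ^ 3) by (apply pow_le; lra).
assert (0 <= x ^ 4) by (apply pow_le; lra). assert (0 <= x ^ 5) by (apply pow_le; lra).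
assert (N2 : x ^ 2 * num2 x <= 11 / 6 * x ^ 5 + 12 * x ^ 2).
{ unfold num2. replace (x ^ 2 * (12 - 6 * x - 6 * x ^ 2 + 11 / 6 * x ^ 3)) with
    (12 * x ^ 2 - 6 * x ^ 3 - 6 * x ^ 4 + 11 / 6 * x ^ 5) by ring. lra. }
assert (N3 : x ^ 2 * (exp x * num1 x) <= 0).
{ assert (exp x * num1 x <= 0) by nra. nra. }
nra.
Qed.

(** A bound of the form [c / x^2] is chosen because it integrates to [c / x], whose
differences telescope over the arguments [(m - w) a] and [(m + w) a]. The
constant [13/20] is compatible with [d3_sum_far]. *)
Lemma d4_cube_lower x : 9 / 4 <= x -> - (13 / 20 / x ^ 2) <= d4_cube x.
Proof.
intros Hx. assert (Hk := d4_key x Hx). rewrite d4_cube_alt. assert (Hp := exp_pos x).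
assert (HE : 9 <= exp x).
{ assert (HT := exp_ge_taylor x ltac:(lra)).
  assert (0 <= x - 9 / 4) by lra.
  assert (9 / 4 * (9 / 4) <= x ^ 2) by (simpl; nra).
  assert (9 / 4 * (9 / 4) * (9/4) <= x ^ 3) by (simpl in *; nra).
  assert (9 / 4 * (9 / 4) * (9/4) * (9 / 4) <= x ^ 4) by (simpl in *; nra).
  assert (9 / 4 * (9 / 4) * (9/4) * (9 / 4) * (9 / 4) <= x ^ 5) by (simpl in *; nra).
  lra. }
assert (N3 : exp x * num3 x + num4 x <= 0).
{ assert (num3 x <= - 25).
  { unfold num3. replace x with (9 / 4 + (x - 9 / 4)) by ring. set (d := x - 9 / 4).
    assert (0 <= d) by (unfold d; lra). assert (0 <= d ^ 2) by now apply pow_le. assert (0 <= d ^ 3) by now apply pow_le. lra. }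
  assert (9 * num3 x + num4 x <= 0).
  { unfold num3, num4. replace x with (9 / 4 + (x - 9 / 4)) by ring. set (d := x - 9 / 4).
    assert (0 <= d) by (unfold d; lra). assert (0 <= d ^ 2) by now apply pow_le. assert (0 <= d ^ 3) by now apply pow_le. lra. }
  nra. }
set (E := exp x) in *.
assert (Hx2 : 0 < x ^ 2) by (apply pow_lt; lra).
assert (H5 : 0 < (1 + E) ^ 5) by (apply pow_lt; lra).
assert (Hfin : x ^ 2 * (E * (E ^ 3 * num1 x + E ^ 2 * num2 x + E * num3 x + num4 x)) <= 13 / 20 * (1 + E) ^ 5).
{ apply Rle_trans with (E ^ 3 * (x ^ 2 * (E * num1 x + num2 x))).
  - replace (x ^ 2 * (E * (E ^ 3 * num1 x + E ^ 2 * num2 x + E * num3 x + num4 x))) with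
     (E ^ 3 * (x ^ 2 * (E * num1 x + num2 x)) + x ^ 2 * E * (E * num3 x + num4 x)) by ring.
    assert (0 <= x ^ 2 * E) by (apply Rmult_le_pos; lra). nra.
  - apply Rle_trans with (E ^ 3 * (13 / 20 * (E ^ 2 + 5 * E + 10))).
    + apply Rmult_le_compat_l; trivial. apply pow_le. lra.
    + assert (0 <= E ^ 2) by apply pow2_ge_0.
      replace (13 / 20 * (1 + E) ^ 5) with (E ^ 3 * (13 / 20 * (E ^ 2 + 5 * E + 10)) + 13 / 20 * (1 + 5 * E + 10 * E ^ 2)) by field. lra. }
unfold Rdiv. rewrite Ropp_mult_distr_l_reverse. apply Ropp_le_contravar.
apply (Rmult_le_reg_r ((1 + E) ^ 5 * x ^ 2)); [now apply Rmult_lt_0_compat|].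
replace (E * (E ^ 3 * num1 x + E ^ 2 * num2 x + E * num3 x + num4 x) * / (1 + E) ^ 5 * ((1 + E) ^ 5 * x ^ 2))
  with (x ^ 2 * (E * (E ^ 3 * num1 x + E ^ 2 * num2 x + E * num3 x + num4 x))) by (field; lra).
replace (13 * / 20 * / x ^ 2 * ((1 + E) ^ 5 * x ^ 2)) with (13 / 20 * (1 + E) ^ 5) by (field; lra).
trivial.
Qed.

Lemma d4_cube_upper x : 21 / 4 <= x -> d4_cube x <= 13 / 20 / x ^ 2.
Proof.
intros Hx. rewrite d4_cube_alt. assert (Hp := exp_pos x).
set (d := x - 21 / 4). assert (Hd : 0 <= d) by (unfold d; lra).
assert (Ed : x = 21 / 4 + d) by (unfold d; ring).
assert (Hd2 : 0 <= d ^ 2) by now apply pow_le. assert (Hd3 : 0 <= d ^ 3) by now apply pow_le.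
assert (Hd4 : 0 <= d ^ 4) by now apply pow_le. assert (Hd5 : 0 <= d ^ 5) by now apply pow_le.
assert (N2 : 0 <= num2 x) by (unfold num2; rewrite Ed; lra).
assert (N4 : 0 <= num4 x) by (unfold num4; rewrite Ed; lra).
assert (HE : 120.8 * (1 + d + d ^ 2 / 2 + d ^ 3 / 6 + d ^ 4 / 24 + d ^ 5 / 120) <= exp x).
{ rewrite Ed, exp_plus. apply Rmult_le_compat; [lra|lra| |now apply exp_ge_taylor].
  apply Rle_trans with (exp (48 / 10)); [apply exp_values|apply exp_le; lra]. }
set (E := exp x) in *.
assert (M1 : - (x ^ 2 * num1 x) <= 1 / 2 * E) by (unfold num1; rewrite Ed; lra).
assert (M3 : - (x ^ 2 * num3 x) <= 150 * E) by (unfold num3; rewrite Ed; lra).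
assert (HE2 : 120 <= E) by lra.
assert (Hx2 : 0 < x ^ 2) by (apply pow_lt; lra).
assert (H5 : 0 < (1 + E) ^ 5) by (apply pow_lt; lra).
assert (E2 : 0 <= E ^ 2) by apply pow2_ge_0. assert (E3 : 0 <= E ^ 3) by (apply pow_le; lra).
assert (E4 : 0 <= E ^ 4) by (apply pow_le; lra).
assert (Hfin : x ^ 2 * (E * - (E ^ 3 * num1 x + E ^ 2 * num2 x + E * num3 x + num4 x)) <= 13 / 20 * (1 + E) ^ 5).
{ replace (x ^ 2 * (E * - (E ^ 3 * num1 x + E ^ 2 * num2 x + E * num3 x + num4 x))) with
   (E ^ 4 * - (x ^ 2 * num1 x) + E ^ 2 * - (x ^ 2 * num3 x) - x ^ 2 * E ^ 3 * num2 x - x ^ 2 * E * num4 x) by ring.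
  assert (E ^ 4 * - (x ^ 2 * num1 x) <= E ^ 4 * (1 / 2 * E)) by (now apply Rmult_le_compat_l).
  assert (E ^ 2 * - (x ^ 2 * num3 x) <= E ^ 2 * (150 * E)) by (now apply Rmult_le_compat_l).
  assert (0 <= x ^ 2 * E ^ 3 * num2 x) by (repeat apply Rmult_le_pos; lra).
  assert (0 <= x ^ 2 * E * num4 x) by (repeat apply Rmult_le_pos; lra).
  assert (120 * E ^ 3 <= E ^ 4) by (simpl in *; nra).
  replace (13 / 20 * (1 + E) ^ 5) with (13 / 20 * (E ^ 4 * E) + 13 / 4 * E ^ 4 + 13 / 2 * E ^ 3 + 13 / 2 * E ^ 2 + 13 / 4 * E + 13 / 20) by field.
  assert (0 <= E ^ 4 * E) by (apply Rmult_le_pos; lra). lra. }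
apply (Rmult_le_reg_r ((1 + E) ^ 5 * x ^ 2)); [now apply Rmult_lt_0_compat|].
replace (- (E * (E ^ 3 * num1 x + E ^ 2 * num2 x + E * num3 x + num4 x)) / (1 + E) ^ 5 * ((1 + E) ^ 5 * x ^ 2))
  with (x ^ 2 * (E * - (E ^ 3 * num1 x + E ^ 2 * num2 x + E * num3 x + num4 x))) by (field; lra).
replace (13 / 20 / x ^ 2 * ((1 + E) ^ 5 * x ^ 2)) with (13 / 20 * (1 + E) ^ 5) by (field; lra).
trivial.
Qed.

Lemma d3_cube_diff_le p q : 9 / 4 <= p <= q -> d3_cube p - d3_cube q <= 13 / 20 * (/ p - / q).
Proof.
intros [Hp Hq].
assert (H : d3_cube p - 13 / 20 * / p <= d3_cube q - 13 / 20 * / q); [|lra].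
apply (is_derive_nonneg_le (fun x => d3_cube x - 13 / 20 * / x) (fun x => d4_cube x + 13 / 20 / x ^ 2)); trivial.
- intros x Hx. replace (d4_cube x + 13 / 20 / x ^ 2) with (d4_cube x - - (13 / 20 / x ^ 2)) by ring.
  apply (is_derive_minus (V := R_NormedModule)); [apply is_derive_d3_cube|].
  auto_derive; [lra|]. field. lra.
- intros x Hx. assert (H := d4_cube_lower x ltac:(lra)). lra.
Qed.

Lemma d3_cube_diff_ge p q : 21 / 4 <= p <= q -> d3_cube q - d3_cube p <= 13 / 20 * (/ p - / q).
Proof.
intros [Hp Hq].
assert (H : - (13 / 20 * / p) - d3_cube p <= - (13 / 20 * / q) - d3_cube q); [|lra].
apply (is_derive_nonneg_le (fun x => - (13 / 20 * / x) - d3_cube x) (fun x => 13 / 20 / x ^ 2 - d4_cube x)); trivial.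
- intros x Hx.
  apply (is_derive_minus (V := R_NormedModule)); [|apply is_derive_d3_cube].
  auto_derive; [lra|]. field. lra.
- intros x Hx. assert (H := d4_cube_upper x ltac:(lra)). lra.
Qed.

(** With [T = tanh (x/2) = 1 - 2 sig x], the difference [1 - 2 * d3_cube x] is [T] plus
a nonnegative quantity, and [T] is at least [0.354 x] up to [x = 9/4]. *)
Lemma d3_cube_near_0 x : 0 <= x <= 9 / 4 -> d3_cube x <= / 2 - 177 / 1000 * x.
Proof.
intros Hx. set (T := 1 - 2 * sig x).
assert (ET : d3_cube x = / 2 - / 2 * (T + (1 - T ^ 2) * (x * (3 / 2 - 3 / 4 * (x * T) - x ^ 2 / 24 + (x * T) ^ 2 / 8)))).
{ unfold d3_cube, T. cbv zeta. field. }
assert (HT : 354 / 1000 * x <= T).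
{ unfold T, sig. assert (Hp := exp_pos x).
  assert (HE : (1 + 354 / 1000 * x) <= exp x * (1 - 354 / 1000 * x)).
  { assert (H := exp_ge_taylor x ltac:(lra)).
    apply Rle_trans with ((1 + x + x ^ 2 / 2 + x ^ 3 / 6 + x ^ 4 / 24 + x ^ 5 / 120) * (1 - 354 / 1000 * x)).
    - assert (B := bernstein_facts x (9 / 4) ltac:(lra)).
      destruct B as (B0 & B1 & B2 & B3 & B4 & B5).
      apply (Rmult_le_compat_l x) in B0; [|lra]. apply (Rmult_le_compat_l x) in B1; [|lra].
      apply (Rmult_le_compat_l x) in B2; [|lra]. apply (Rmult_le_compat_l x) in B3; [|lra].
      apply (Rmult_le_compat_l x) in B4; [|lra]. apply (Rmult_le_compat_l x) in B5; [|lra].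
      lra.
    - apply Rmult_le_compat_r; lra. }
  apply (Rmult_le_reg_r (1 + exp x)); [lra|].
  replace ((1 - 2 * / (1 + exp x)) * (1 + exp x)) with (exp x - 1) by (field; lra). lra. }
assert (Hs := sig_range x).
assert (H1 : 0 <= 1 - T ^ 2) by (unfold T; simpl; nra).
assert (H2 : 0 <= 3 / 2 - 3 / 4 * (x * T) - x ^ 2 / 24 + (x * T) ^ 2 / 8).
{ assert (x ^ 2 <= 81 / 16) by (simpl; nra). assert (0 <= (x * T - 3) ^ 2) by apply pow2_ge_0. lra. }
assert (H3 : 0 <= (1 - T ^ 2) * (x * (3 / 2 - 3 / 4 * (x * T) - x ^ 2 / 24 + (x * T) ^ 2 / 8))).
{ apply Rmult_le_pos; trivial. apply Rmult_le_pos; lra. }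
rewrite ET. lra.
Qed.

Lemma d3_cube_lower x : 0 < x -> - (10 / x) <= d3_cube x.
Proof.
intros Hx. assert (Hs := sig_range x). assert (Hh := sig_half x ltac:(lra)).
assert (HT := exp_ge_taylor x ltac:(lra)).
assert (0 < x ^ 2) by now apply pow_lt. assert (0 < x ^ 3) by now apply pow_lt.
assert (0 < x ^ 4) by now apply pow_lt. assert (0 < x ^ 5) by now apply pow_lt.
assert (S2 : x ^ 2 * sig x <= 2).
{ unfold sig. apply (Rmult_le_reg_r (1 + exp x)); [assert (P := exp_pos x); lra|].
  rewrite Rmult_assoc, Rinv_l by (assert (P := exp_pos x); lra). lra. }
assert (S4 : x ^ 4 * sig x <= 24).
{ unfold sig. apply (Rmult_le_reg_r (1 + exp x)); [assert (P := exp_pos x); lra|].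
  rewrite Rmult_assoc, Rinv_l by (assert (P := exp_pos x); lra). lra. }
apply (Rmult_le_reg_r x); trivial.
replace (- (10 / x) * x) with (-10) by (field; lra).
unfold d3_cube. cbv zeta. set (s := sig x) in *.
assert (V : 0 <= s * (1 - s) <= s) by nra.
set (v := s * (1 - s)) in *.
assert (W1 : 0 <= 3 / 2 * x ^ 3 * (v * (1 - 2 * s))).
{ apply Rmult_le_pos; [lra|]. apply Rmult_le_pos; lra. }
assert (W2 : x ^ 2 * v <= x ^ 2 * s) by (apply Rmult_le_compat_l; lra).
assert (W3 : x ^ 4 * (v * (1 - 6 * v)) <= x ^ 4 * s) by (apply Rmult_le_compat_l; [lra|nra]).
replace ((s - 3 * x * v + 3 / 2 * x ^ 2 * (v * (1 - 2 * s)) - x ^ 3 / 6 * (v * (1 - 6 * v))) * x)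
  with (s * x - 3 * (x ^ 2 * v) + 3 / 2 * x ^ 3 * (v * (1 - 2 * s)) - x ^ 4 * (v * (1 - 6 * v)) / 6) by field.
assert (0 <= s * x) by (apply Rmult_le_pos; lra). lra.
Qed.

(** * The kernel inequality on the dual side *)

Definition d3_sum (a w : R) (n : nat) : R :=
  sum_n (fun j => d3_cube ((INR (2 * j + 1) - w) * a) - d3_cube ((INR (2 * j + 1) + w) * a)) n.

Lemma INR_odd j : INR (2 * j + 1) = 2 * INR j + 1.
Proof. rewrite plus_INR, mult_INR. simpl (INR 2). simpl (INR 1). ring. Qed.

(** When the nearest argument [(1 - w) a] is at least [9/4], every difference is
bounded by [d3_cube_diff_le]; the terms after the first are at most multiples
of [1/(m^2 - 1)], which telescope. *)
Lemma d3_sum_far a w n : 38 / 10 < a -> 0 <= w -> 9 / 4 <= (1 - w) * a -> d3_sum a w n <= w / 2.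
Proof.
intros Ha Hw Hx.
assert (Hw1 : w < 1) by nra.
assert (H0 : d3_cube ((1 - w) * a) - d3_cube ((1 + w) * a) <= 13 / 20 * (2 * w / (a * (1 - w ^ 2)))).
{ eapply Rle_trans; [apply d3_cube_diff_le; split; nra|].
  right. f_equal. field. repeat split; try lra. nra. }
assert (H1 : d3_sum a w n <= 13 / 20 * (2 * w / (a * (1 - w ^ 2))) + 13 / 20 * (2 * w / a) * (/ 4 * (1 - / (INR n + 1)))).
{ induction n as [|n IH].
  - unfold d3_sum. rewrite sum_O. change (INR (2 * 0 + 1)) with 1. change (INR 0) with 0.
    replace (/ (0 + 1)) with 1 by field. lra.
  - unfold d3_sum in *. rewrite sum_Sn. set (S0 := sum_n _ n) in *.
    change (plus S0 ?y) with (S0 + y).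
    rewrite INR_odd. set (m := INR (S n)).
    assert (Hm : 1 <= m) by (unfold m; rewrite S_INR; assert (P := pos_INR n); lra).
    assert (Em : INR n + 1 = m) by (unfold m; now rewrite S_INR).
    assert (Hd : d3_cube ((2 * m + 1 - w) * a) - d3_cube ((2 * m + 1 + w) * a) <=
      13 / 20 * (2 * w / a) * (/ 4 * (/ m - / (m + 1)))).
    { eapply Rle_trans; [apply d3_cube_diff_le; split; nra|].
      rewrite (Rmult_assoc (13 / 20)). apply Rmult_le_compat_l; [lra|].
      replace (/ ((2 * m + 1 - w) * a) - / ((2 * m + 1 + w) * a)) with
        (2 * w / a * / ((2 * m + 1) ^ 2 - w ^ 2)).
      2:{ field. repeat split; try lra. nra. }
      replace (/ 4 * (/ m - / (m + 1))) with (/ (4 * m * (m + 1))) by (field; lra).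
      apply Rmult_le_compat_l; [apply Rmult_le_pos; [lra|left; apply Rinv_0_lt_compat; lra]|].
      apply Rinv_le_contravar; nra. }
    rewrite Em in IH. lra. }
assert (Hn : 0 < / (INR n + 1)) by (apply Rinv_0_lt_compat; assert (P := pos_INR n); lra).
(* [(1 - w) a (1 + w)] is smallest at [(1 - w) a = 9/4], where [w] is about 0.408 *)
assert (H2 : 3.167 <= a * (1 - w ^ 2)).
{ replace (a * (1 - w ^ 2)) with ((1 - w) * a * (1 + w)) by ring.
  destruct (Rle_dec (403 / 1000) w) as [Hww|Hww].
  - assert (9 / 4 * (1403 / 1000) <= (1 - w) * a * (1 + w)) by (apply Rmult_le_compat; lra).
    destruct (Rle_dec (408 / 1000) w) as [Hw3|Hw3].
    + assert (9 / 4 * (1408 / 1000) <= (1 - w) * a * (1 + w)) by (apply Rmult_le_compat; lra). lra.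
    + nra.
  - nra. }
assert (H3 : 2 * w / (a * (1 - w ^ 2)) <= 2 * w / 3.167).
{ apply Rmult_le_compat_l; [lra|]. apply Rinv_le_contravar; lra. }
assert (H4 : 2 * w / a * (/ 4 * (1 - / (INR n + 1))) <= 2 * w / 3.8 * / 4).
{ apply Rmult_le_compat.
  - apply Rmult_le_pos; [lra|left; apply Rinv_0_lt_compat; lra].
  - apply Rmult_le_pos; [lra|]. assert (/ (INR n + 1) <= 1); [|lra].
    rewrite <- Rinv_1. apply Rinv_le_contravar; [lra|]. assert (P := pos_INR n). lra.
  - apply Rmult_le_compat_l; [lra|]. apply Rinv_le_contravar; lra.
  - lra. }
lra.
Qed.

(** When [x = (1 - w) a] is small the first argument is near [0], where
[d3_cube] is about [1/2] and equality holds in the limit. The other terms are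
regrouped as [d3_cube (2ka + x) - d3_cube (2ka - x)], which leaves a single
unpaired term at the far end; the summand [20/(n+1)] pays for it. *)
Lemma d3_sum_near a w n : 38 / 10 < a -> w <= 1 -> (1 - w) * a <= 9 / 4 ->
  d3_sum a w n <= (1 + 20 / (INR n + 1)) * w / 2.
Proof.
intros Ha Hw Hx. set (x := (1 - w) * a) in *.
assert (Hx0 : 0 <= x) by (unfold x; apply Rmult_le_pos; lra).
assert (Ew : w = 1 - x / a) by (unfold x; field; lra).
assert (H1 : d3_sum a w n <= d3_cube x + 13 / 20 * (x / a ^ 2) * (1 - / (2 * INR n + 1)) -
   d3_cube (2 * (INR n + 1) * a - x)).
{ induction n as [|n IH].
  - unfold d3_sum. rewrite sum_O. change (INR (2 * 0 + 1)) with 1. change (INR 0) with 0.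
    replace ((1 + w) * a) with (2 * (0 + 1) * a - x) by (unfold x; ring). fold x.
    replace (/ (2 * 0 + 1)) with 1 by field. lra.
  - unfold d3_sum in *. rewrite sum_Sn. set (S0 := sum_n _ n) in *.
    change (plus S0 ?y) with (S0 + y).
    rewrite INR_odd. set (m := INR (S n)) in *.
    assert (Hm : 1 <= m) by (unfold m; rewrite S_INR; assert (P := pos_INR n); lra).
    assert (Em : INR n + 1 = m) by (unfold m; now rewrite S_INR).
    rewrite Em in IH. replace (INR n) with (m - 1) in IH by lra.
    replace ((2 * m + 1 - w) * a) with (2 * m * a + x) by (unfold x; ring).
    replace ((2 * m + 1 + w) * a) with (2 * (m + 1) * a - x) by (unfold x; ring).
    assert (Hma : 38 / 10 <= m * a) by nra.
    assert (Hd : d3_cube (2 * m * a + x) - d3_cube (2 * m * a - x) <=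
      13 / 20 * (x / a ^ 2) * (/ (2 * m - 1) - / (2 * m + 1))).
    { eapply Rle_trans; [apply d3_cube_diff_ge; lra|].
      rewrite (Rmult_assoc (13 / 20)). apply Rmult_le_compat_l; [lra|].
      assert (Ha2 : 0 < a ^ 2) by (apply pow_lt; lra).
      assert (Hq : a ^ 2 * ((2 * m) ^ 2 - 1) <= (2 * m * a) ^ 2 - x ^ 2).
      { replace ((2 * m * a) ^ 2 - x ^ 2) with (a ^ 2 * ((2 * m) ^ 2 - 1) + (a ^ 2 - x ^ 2)) by ring.
        nra. }
      assert (Hq0 : 0 < a ^ 2 * ((2 * m) ^ 2 - 1)) by (apply Rmult_lt_0_compat; nra).
      replace (/ (2 * m * a - x) - / (2 * m * a + x)) with (2 * x * / ((2 * m * a) ^ 2 - x ^ 2)).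
      2:{ field. repeat split; try lra. }
      replace (x / a ^ 2 * (/ (2 * m - 1) - / (2 * m + 1))) with (2 * x * / (a ^ 2 * ((2 * m) ^ 2 - 1))).
      2:{ field. repeat split; try lra. nra. }
      apply Rmult_le_compat_l; [lra|]. now apply Rinv_le_contravar. }
    replace (2 * (m - 1) + 1) with (2 * m - 1) in IH by ring. lra. }
assert (Pn := pos_INR n).
assert (H2 := d3_cube_near_0 x (conj Hx0 Hx)).
assert (H3 : - d3_cube (2 * (INR n + 1) * a - x) <= 20 / (INR n + 1) * w / 2).
{ assert (Hna : a <= (INR n + 1) * a) by nra.
  assert (Hl := d3_cube_lower (2 * (INR n + 1) * a - x) ltac:(lra)).
  assert (10 / (2 * (INR n + 1) * a - x) <= 10 / ((INR n + 1) * a)).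
  { apply Rmult_le_compat_l; [lra|]. apply Rinv_le_contravar; lra. }
  assert (10 / ((INR n + 1) * a) <= 20 / (INR n + 1) * w / 2); [|lra].
  replace (20 / (INR n + 1) * w / 2) with (10 / ((INR n + 1) * a) * (w * a)) by (field; lra).
  rewrite <- (Rmult_1_r (10 / ((INR n + 1) * a))) at 1.
  apply Rmult_le_compat_l; [|unfold x in Hx; lra].
  left. apply Rdiv_lt_0_compat; [lra|]. apply Rmult_lt_0_compat; lra. }
assert (H4 : 13 / 20 * (x / a ^ 2) * (1 - / (2 * INR n + 1)) <= 451 / 10000 * x).
{ apply Rle_trans with (13 / 20 * (x / a ^ 2) * 1).
  - apply Rmult_le_compat_l.
    + apply Rmult_le_pos; [lra|]. apply Rmult_le_pos; trivial. left. apply Rinv_0_lt_compat, pow_lt. lra.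
    + assert (0 < / (2 * INR n + 1)) by (apply Rinv_0_lt_compat; lra). lra.
  - rewrite Rmult_1_r. replace (451 / 10000 * x) with (13 / 20 * (x * (451 / 6500))) by field.
    apply Rmult_le_compat_l; [lra|]. apply Rmult_le_compat_l; trivial.
    replace (451 / 6500) with (/ (6500 / 451)) by field. apply Rinv_le_contravar; [lra|]. simpl; nra. }
assert (H5 : x / a <= x / 3.8).
{ apply Rmult_le_compat_l; trivial. apply Rinv_le_contravar; lra. }
replace ((1 + 20 / (INR n + 1)) * w / 2) with (w / 2 + 20 / (INR n + 1) * w / 2) by (field; lra).
lra.
Qed.

(** The inequality behind the regime of small times: the left side comes from the
factors of the dual product and [w/2] from the Gaussian prefactor. The excess
[20/(n+1)] makes it true for partial sums and disappears in the limit. *)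
Lemma d3_sum_le a w n : 38 / 10 < a -> 0 <= w <= 1 -> d3_sum a w n <= (1 + 20 / (INR n + 1)) * w / 2.
Proof.
intros Ha Hw. destruct (Rle_dec (9 / 4) ((1 - w) * a)) as [H|H].
- eapply Rle_trans; [apply d3_sum_far; trivial; lra|].
  assert (0 < 20 / (INR n + 1)) by (apply Rdiv_lt_0_compat; [lra|assert (P := pos_INR n); lra]).
  set (e := 20 / (INR n + 1)) in *. nra.
- apply d3_sum_near; lra.
Qed.

Lemma ln_prodn f n : (forall i, 0 < f i) -> ln (prodn f (S n)) = sum_n (fun j => ln (f j)) n.
Proof.
intros Hf. induction n as [|n IH].
- rewrite sum_O. simpl. now rewrite Rmult_1_l.
- rewrite sum_Sn, <- IH. simpl prodn. rewrite (ln_mult (prodn f n * f n)); trivial.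
  apply Rmult_lt_0_compat; trivial. now apply prodn_pos.
Qed.

Lemma is_lim_seq_ln_quotient (k A B : nat -> R) (a b : R) :
  (forall n, 0 < k n) -> (forall n, 0 < A n) -> (forall n, 0 < B n) -> 0 < a -> 0 < b ->
  is_lim_seq (fun n => k n * A n) a -> is_lim_seq (fun n => k n * B n) b ->
  is_lim_seq (fun n => ln (A n) - ln (B n)) (ln a - ln b).
Proof.
intros Hk HA HB Ha Hb La Lb.
(* the common factor cancels under the logarithms *)
apply is_lim_seq_ext with (fun n => ln (k n * A n) - ln (k n * B n)).
{ intros n. rewrite !ln_mult by trivial. ring. }
assert (C : forall x, 0 < x -> continuity_pt ln x).
{ intros x Hx. apply derivable_continuous_pt. exists (/ x). now apply derivable_pt_lim_ln. }
apply is_lim_seq_minus'.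
- now apply (is_lim_seq_continuous ln (fun n => k n * A n)); [apply C|].
- now apply (is_lim_seq_continuous ln (fun n => k n * B n)); [apply C|].
Qed.

(** * Small times *)

(** The logarithm of the partial dual product together with that of the Gaussian
prefactor, the latter enlarged by the factor [1 + 20/(n+1)] that [d3_sum_le]
calls for. *)
Definition dual_log (n : nat) (w t : R) : R :=
  sum_n (fun j => softplus ((INR (2 * j + 1) - w) / t) + softplus ((INR (2 * j + 1) + w) / t)) n -
  (1 + 20 / (INR n + 1)) * w ^ 2 / 4 * / t.

(** The third derivative of [dual_log] in [t], multiplied by [t^3], at [t = 1/a]. *)
Definition dual_log3 (n : nat) (w a : R) : R :=
  sum_n (fun j => d2_cube ((INR (2 * j + 1) - w) * a) + d2_cube ((INR (2 * j + 1) + w) * a)) n +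
  (1 + 20 / (INR n + 1)) * w ^ 2 / 4 * (6 * a).

(** The derivative in [w] is [6 a] times the difference of the two sides of
[d3_sum_le]. *)
Lemma dual_log3_incr n a u v : 38 / 10 < a -> 0 <= u -> u <= v -> v <= 1 ->
  dual_log3 n u a <= dual_log3 n v a.
Proof.
intros Ha Hu Huv Hv. unfold dual_log3.
set (e := 1 + 20 / (INR n + 1)).
apply (is_derive_nonneg_le
  (fun w => sum_n (fun j => d2_cube ((INR (2 * j + 1) - w) * a) + d2_cube ((INR (2 * j + 1) + w) * a)) n +
     e * w ^ 2 / 4 * (6 * a))
  (fun w => sum_n (fun j => 6 * a * - (d3_cube ((INR (2 * j + 1) - w) * a) - d3_cube ((INR (2 * j + 1) + w) * a))) n +
     6 * a * (e * w / 2))); trivial.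
- intros w Hw. apply (is_derive_plus (V := R_NormedModule)).
  + apply (is_derive_sum_n (V := R_NormedModule)
      (fun j w => d2_cube ((INR (2 * j + 1) - w) * a) + d2_cube ((INR (2 * j + 1) + w) * a))).
    intros j _. set (m := INR (2 * j + 1)).
    replace (6 * a * - (d3_cube ((m - w) * a) - d3_cube ((m + w) * a))) with
      (- a * (6 * d3_cube ((m - w) * a)) + a * (6 * d3_cube ((m + w) * a))) by ring.
    apply (is_derive_plus (V := R_NormedModule)).
    * apply (is_derive_comp d2_cube (fun w => (m - w) * a) w); [apply is_derive_d2_cube|].
      auto_derive; trivial. ring.
    * apply (is_derive_comp d2_cube (fun w => (m + w) * a) w); [apply is_derive_d2_cube|].
      auto_derive; trivial. ring.
  + auto_derive; trivial. field.
- intros w Hw. assert (K := d3_sum_le a w n Ha ltac:(lra)). fold e in K. unfold d3_sum in K.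
  rewrite (sum_n_ext _ (fun j => mult (- (6 * a)) (d3_cube ((INR (2 * j + 1) - w) * a) - d3_cube ((INR (2 * j + 1) + w) * a)))).
  2:{ intros j. unfold mult; simpl. ring. }
  rewrite (sum_n_mult_l (K := R_Ring)).
  set (S0 := sum_n _ n) in *. change (mult (- (6 * a)) S0) with (- (6 * a) * S0). nra.
Qed.

Lemma third_deriv_dual_log n w hi : third_deriv_on 0 hi (dual_log n w) (fun t => dual_log3 n w (/ t) / t ^ 3).
Proof.
set (e := (1 + 20 / (INR n + 1)) * w ^ 2 / 4).
apply third_deriv_on_ext with
  (f := fun t => sum_n (fun j => softplus ((INR (2 * j + 1) - w) / t) + softplus ((INR (2 * j + 1) + w) / t)) n - e * / t)
  (f3 := fun t => sum_n (fun j => d2_cube ((INR (2 * j + 1) - w) / t) / t ^ 3 + d2_cube ((INR (2 * j + 1) + w) / t) / t ^ 3) n - e * (- 6 / t ^ 4)).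
- intros t _. reflexivity.
- intros t Ht. unfold dual_log3. fold e.
  rewrite (sum_n_ext _ (fun j => mult (/ t ^ 3) (d2_cube ((INR (2 * j + 1) - w) * / t) + d2_cube ((INR (2 * j + 1) + w) * / t)))).
  2:{ intros j. unfold mult; simpl. unfold Rdiv. ring. }
  rewrite (sum_n_mult_l (K := R_Ring)).
  set (S0 := sum_n _ n) in *. change (mult (/ t ^ 3) S0) with (/ t ^ 3 * S0). field. lra.
- apply third_deriv_on_minus.
  + apply (third_deriv_on_sum 0 hi (fun j t => softplus ((INR (2 * j + 1) - w) / t) + softplus ((INR (2 * j + 1) + w) / t))
      (fun j t => d2_cube ((INR (2 * j + 1) - w) / t) / t ^ 3 + d2_cube ((INR (2 * j + 1) + w) / t) / t ^ 3)).
    intros j. apply third_deriv_on_plus.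
    * destruct (third_deriv_softplus (INR (2 * j + 1) - w)) as (f1 & f2 & H). exists f1, f2. intros s Hs. apply H. lra.
    * destruct (third_deriv_softplus (INR (2 * j + 1) + w)) as (f1 & f2 & H). exists f1, f2. intros s Hs. apply H. lra.
  + apply third_deriv_on_scal. exists (fun t => - / t ^ 2), (fun t => 2 / t ^ 3). intros s Hs.
    split; [|split]; (auto_derive; [repeat split; trivial; repeat apply Rmult_integral_contrapositive_currified; lra|field; lra]).
Qed.

Lemma dual_log_nonpos n u v t : 0 <= u -> u <= v -> v <= 1 -> 0 < t < 5 / 19 ->
  dual_log3 n u (/ t) / t ^ 3 - dual_log3 n v (/ t) / t ^ 3 <= 0.
Proof.
intros Hu Huv Hv Ht.
assert (Ha : 38 / 10 < / t).
{ replace (38 / 10) with (/ (5 / 19)) by field. apply Rinv_lt_contravar; nra. }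
assert (H := dual_log3_incr n (/ t) u v Ha Hu Huv Hv).
assert (Ht3 : 0 < / t ^ 3) by (apply Rinv_0_lt_compat, pow_lt; lra).
unfold Rdiv. nra.
Qed.

(** * Large times *)

(** The part that depends on [k] in the third derivative of
[ln (1 + 2 k Q + Q^2)] in [t], for [Q = exp (- c t)]. *)
Definition factor_core (Q k : R) : R :=
  (2 * Q * k ^ 2 - k * (1 + Q ^ 2) - 4 * Q) / (1 + 2 * k * Q + Q ^ 2) ^ 3.

(** With [C = (1 + Q^2)/(2 Q)], the derivative in [k] has the sign opposite to
[C^2 - 4 C k + k^2 - 6], which for [k <= 1] is at least [(C - 5) (C + 1)], and [C >= 5] by hypothesis. *)
Lemma factor_core_decr Q k l : 0 < Q < 1 -> 10 * Q <= 1 + Q ^ 2 -> -1 <= k -> k <= l -> l <= 1 ->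
  factor_core Q l <= factor_core Q k.
Proof.
intros HQ H10 Hk Hkl Hl.
assert (HD : forall y, -1 <= y -> 0 < 1 + 2 * y * Q + Q ^ 2) by (intros y Hy; simpl; nra).
assert (- factor_core Q k <= - factor_core Q l); [|lra].
apply (is_derive_nonneg_le (fun y => - factor_core Q y) (fun y =>
  ((1 + Q ^ 2) ^ 2 - 8 * Q * y * (1 + Q ^ 2) + 4 * Q ^ 2 * y ^ 2 - 24 * Q ^ 2) / (1 + 2 * y * Q + Q ^ 2) ^ 4)); trivial.
- intros y Hy. specialize (HD y ltac:(lra)). unfold factor_core. auto_derive.
  + simpl in HD. repeat split; trivial. repeat apply Rmult_integral_contrapositive_currified; lra.
  + field. simpl in HD |- *. lra.
- intros y Hy. specialize (HD y ltac:(lra)).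
  apply Rmult_le_pos; [|left; apply Rinv_0_lt_compat; now apply pow_lt].
  set (B := 1 + Q ^ 2) in *.
  replace (B ^ 2 - 8 * Q * y * B + 4 * Q ^ 2 * y ^ 2 - 24 * Q ^ 2) with
   ((B - 10 * Q) * (B + 2 * Q) + 8 * Q * (1 - y) * (B - 10 * Q) + 4 * Q ^ 2 * ((1 - y) * (19 - y))) by ring.
  assert (0 <= B - 10 * Q) by lra.
  assert (0 <= (B - 10 * Q) * (B + 2 * Q)) by (apply Rmult_le_pos; lra).
  assert (0 <= 8 * Q * (1 - y) * (B - 10 * Q)) by (repeat apply Rmult_le_pos; lra).
  assert (0 <= 4 * Q ^ 2 * ((1 - y) * (19 - y))).
  { apply Rmult_le_pos; [assert (P := pow2_ge_0 Q); lra|apply Rmult_le_pos; lra]. }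
  lra.
Qed.

Definition factor_d3 (c k t : R) : R :=
  c ^ 3 * (2 * exp (- c * t) * (1 - exp (- c * t) ^ 2)) * factor_core (exp (- c * t)) k.

Lemma third_deriv_factor c k lo hi : 0 <= lo -> 0 < c -> -1 <= k ->
  third_deriv_on lo hi (fun t => ln (1 + 2 * k * exp (- c * t) + exp (- c * t) ^ 2)) (factor_d3 c k).
Proof.
intros Hlo Hc Hk.
exists (fun t => - c * ((2 * k * exp (- c * t) + 2 * exp (- c * t) ^ 2) / (1 + 2 * k * exp (- c * t) + exp (- c * t) ^ 2))).
exists (fun t => c ^ 2 * (2 * exp (- c * t) * (k + 2 * exp (- c * t) + k * exp (- c * t) ^ 2) /
   (1 + 2 * k * exp (- c * t) + exp (- c * t) ^ 2) ^ 2)).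
intros t Ht.
assert (HQ : 0 < exp (- c * t) < 1).
{ split; [apply exp_pos|]. rewrite <- exp_0. apply exp_increasing. nra. }
assert (HD : 0 < 1 + 2 * k * exp (- c * t) + exp (- c * t) ^ 2) by (simpl; nra).
unfold factor_d3, factor_core. simpl in HD.
split; [|split]; auto_derive.
- repeat split; trivial; lra.
- field. lra.
- repeat split; trivial; lra.
- field. lra.
- repeat split; trivial; repeat apply Rmult_integral_contrapositive_currified; lra.
- field. lra.
Qed.

Lemma exp_30_13 : 9.9 <= exp (30 / 13).
Proof.
assert (H := exp_ge_taylor (15 / 13) ltac:(lra)).
replace (30 / 13) with (15 / 13 + 15 / 13) by field. rewrite exp_plus.
apply Rle_trans with (3.16 * 3.16); [lra|]. apply Rmult_le_compat; lra.
Qed.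

Lemma factor_d3_decr c k l t : 30 / 13 <= c * t -> 0 < c -> 0 < t -> -1 <= k -> k <= l -> l <= 1 ->
  factor_d3 c l t - factor_d3 c k t <= 0.
Proof.
intros Hct Hc Ht Hk Hkl Hl. unfold factor_d3.
assert (HE : 9.9 <= exp (c * t)).
{ apply Rle_trans with (1 := exp_30_13). now apply exp_le. }
assert (EQ : exp (- c * t) = / exp (c * t)) by (rewrite <- exp_Ropp; f_equal; ring).
set (E := exp (c * t)) in *.
assert (HQ : 0 < / E < 1).
{ split; [apply Rinv_0_lt_compat; lra|]. rewrite <- Rinv_1. apply Rinv_lt_contravar; lra. }
assert (H10 : 10 * / E <= 1 + (/ E) ^ 2).
{ apply (Rmult_le_reg_r (E ^ 2)); [apply pow_lt; lra|].
  replace (10 * / E * E ^ 2) with (10 * E) by (field; lra).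
  replace ((1 + (/ E) ^ 2) * E ^ 2) with (E ^ 2 + 1) by (field; lra). simpl; nra. }
rewrite EQ. assert (H := factor_core_decr (/ E) k l HQ H10 Hk Hkl Hl).
set (Q := / E) in *.
assert (0 <= c ^ 3 * (2 * Q * (1 - Q ^ 2))).
{ apply Rmult_le_pos; [apply pow_le; lra|]. apply Rmult_le_pos; [lra|]. simpl; nra. }
nra.
Qed.

(** * The theta functions as limits of products *)

Definition cos_seq (e : nat) (y : R) (k : Z) : R := cos ((IZR k + INR e / 2) * y).

Lemma cos_seq_rec e y k : cos_seq e y (k + 1) + cos_seq e y (k - 1) = 2 * cos y * cos_seq e y k.
Proof.
unfold cos_seq. rewrite plus_IZR, minus_IZR.
replace ((IZR k + 1 + INR e / 2) * y) with ((IZR k + INR e / 2) * y + y) by ring.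
replace ((IZR k - 1 + INR e / 2) * y) with ((IZR k + INR e / 2) * y - y) by ring.
rewrite cos_plus, cos_minus. ring.
Qed.

(** With [theta_half] this treats [theta3] ([e = 0]) and [theta2] ([e = 1])
together. *)
Definition theta_exponent (e n : nat) : R := INR n ^ 2 + INR e * INR n.

Definition theta_half (e : nat) (y s : R) : R :=
  Series (fun n => cos ((INR n + INR e / 2) * y) * exp (- theta_exponent e n * s)).

Lemma theta_exponent_ge e n : INR n <= theta_exponent e n.
Proof.
unfold theta_exponent. assert (H := INR_le_sqr n).
assert (0 <= INR e * INR n) by (apply Rmult_le_pos; apply pos_INR). lra.
Qed.

Lemma ex_series_theta_half e y s : 0 < s ->
  ex_series (fun n => Rabs (cos ((INR n + INR e / 2) * y) * exp (- theta_exponent e n * s))).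
Proof.
intros Hs. apply ex_series_le_R with (fun n => exp (- s * INR n)); [|now apply ex_series_geom_exp].
intros n. rewrite Rabs_Rabsolu, Rmult_comm. apply Rabs_exp_cos_le.
assert (H := theta_exponent_ge e n). nra.
Qed.

Lemma gauss_cos_summable e y s : (e <= 1)%nat -> 0 < s ->
  bisummable (fun k => gauss s e k * cos_seq e y k).
Proof.
intros He Hs.
assert (Hee : 0 <= INR e <= 1).
{ split; [apply pos_INR|]. replace 1 with (INR 1) by reflexivity. now apply le_INR. }
split; (apply ex_series_le_R with (fun n => exp (- s * INR n)); [|now apply ex_series_geom_exp]);
 intros n; rewrite Rabs_Rabsolu; apply Rabs_exp_cos_le; rewrite ?opp_IZR, <- INR_IZR_INZ;
 assert (Hn := pos_INR n); assert (H2 := INR_le_sqr n).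
- assert (0 <= INR e * INR n) by (apply Rmult_le_pos; lra). nra.
- rewrite S_INR. assert (INR n <= (- (INR n + 1)) ^ 2 + INR e * - (INR n + 1)); [simpl; nra|nra].
Qed.

Lemma is_bisum_theta_half e y s : 0 < s -> (e <= 1)%nat ->
  is_bisum (fun k => gauss s e k * cos_seq e y k)
    (2 * theta_half e y s - (if Nat.eqb e 0 then 1 else 0)).
Proof.
intros Hs He.
assert (Hex := ex_series_Rabs _ (ex_series_theta_half e y s Hs)).
set (g := fun n => cos ((INR n + INR e / 2) * y) * exp (- theta_exponent e n * s)) in *.
exists (theta_half e y s).
exists (theta_half e y s - (if Nat.eqb e 0 then 1 else 0)).
split; [|split; [|ring]].
- apply is_series_ext with g; [|now apply Series_correct].
  intros n. unfold g, gauss, cos_seq, theta_exponent. rewrite <- INR_IZR_INZ, Rmult_comm.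
  f_equal. f_equal. ring.
- destruct e as [|[|e]]; [| |lia]; simpl Nat.eqb; cbv iota.
  + apply is_series_ext with (fun n => g (S n)).
    { intros n. unfold g, gauss, cos_seq, theta_exponent. rewrite opp_IZR, <- INR_IZR_INZ, Rmult_comm.
      rewrite <- (cos_neg ((INR (S n) + _) * y)). f_equal; f_equal; simpl (INR 0); field. }
    apply (is_series_incr_1 (V := R_NormedModule) g).
    change (is_series g (theta_half 0 y s - 1 + g 0%nat)).
    replace (theta_half 0 y s - 1 + g 0%nat) with (theta_half 0 y s); [now apply Series_correct|].
    unfold g, theta_exponent. simpl (INR 0). replace ((0 + 0 / 2) * y) with 0 by field.
    replace (- (0 ^ 2 + 0 * 0) * s) with 0 by ring. rewrite cos_0, exp_0. ring.
  + apply is_series_ext with g; [|rewrite Rminus_0_r; now apply Series_correct].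
    intros n. unfold g, gauss, cos_seq, theta_exponent. rewrite opp_IZR, <- INR_IZR_INZ, (Rmult_comm (cos _)), (S_INR n).
    rewrite <- (cos_neg ((INR n + _) * y)). f_equal; f_equal; simpl (INR 1); [ring|field].
Qed.

Lemma theta3_half z t : 0 < t -> theta3 z t = 2 * theta_half 0 (2 * PI * z) (PI ^ 2 * t) - 1.
Proof.
intros Ht. rewrite theta3_alt by trivial. unfold theta_half. do 2 f_equal. apply Series_ext.
intros n. unfold theta_exponent. rewrite Rmult_comm. simpl (INR 0). f_equal; f_equal; field.
Qed.

Lemma theta2_half z t : theta2 z t = exp (- (PI ^ 2 * t) / 4) * (2 * theta_half 1 (2 * PI * z) (PI ^ 2 * t)).
Proof.
unfold theta2, theta_half.
rewrite (Series_ext _ (fun n => exp (- (PI ^ 2 * t) / 4) *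
  (cos ((INR n + INR 1 / 2) * (2 * PI * z)) * exp (- theta_exponent 1 n * (PI ^ 2 * t))))).
- rewrite Series_scal_l. ring.
- intros n. unfold Rpower, nome, theta_exponent. rewrite ln_exp.
  replace ((INR n + 1 / 2) ^ 2 * (- PI ^ 2 * t)) with
    (- (PI ^ 2 * t) / 4 + - (INR n ^ 2 + INR 1 * INR n) * (PI ^ 2 * t)) by (simpl (INR 1); field).
  rewrite exp_plus. simpl (INR 1).
  replace ((INR n + 1 / 2) * (2 * PI * z)) with ((2 * INR n + 1) * PI * z) by field. ring.
Qed.

(** [theta3] for [e = 0], and [theta2] without its factor [q^(1/4)] for [e = 1], at
[y = 2 PI z] and [s = PI^2 t]. *)
Definition theta_full (e : nat) (y s : R) : R :=
  2 * theta_half e y s - (if Nat.eqb e 0 then 1 else 0).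

(** What the triple product leaves besides the factors: the zero of [theta2] at
[y = PI] appears here. *)
Definition theta_base (e : nat) (y : R) : R := if Nat.eqb e 0 then 1 else 2 * cos (y / 2).

Lemma qprod_pos s e x n : 0 < s -> -1 <= x -> 0 < qprod s e x n.
Proof.
intros Hs Hx. destruct (qprod_lower s e Hs) as (B & HB & H).
apply Rlt_le_trans with B; auto.
Qed.

Lemma theta_base_pos e y : 0 <= y < PI -> 0 < theta_base e y.
Proof.
intros Hy. unfold theta_base. destruct (Nat.eqb e 0); [lra|].
assert (0 < cos (y / 2)); [|lra]. apply cos_gt_0; lra.
Qed.

Lemma theta_product_limit e s : (e <= 1)%nat -> 0 < s -> exists kap : nat -> R,
  (forall n, 0 < kap n) /\ forall y, 0 <= y < PI -> 0 < theta_full e y s /\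
  is_lim_seq (fun n => kap n * (qprod s e (cos y) n * theta_base e y)) (theta_full e y s).
Proof.
intros He Hs. destruct (triple_product_limit s e Hs) as (kap & k0 & Hk0 & Hkap & Hlim).
exists kap. split; [intros n; specialize (Hkap n); lra|]. intros y Hy.
assert (L : is_lim_seq (fun n => kap n * (qprod s e (cos y) n * theta_base e y)) (theta_full e y s)).
{ set (base := fun c : Z -> R => if Nat.eqb e 0 then c 0%Z else c 0%Z + c (-1)%Z).
  replace (theta_base e y) with (base (cos_seq e y)).
  - apply Hlim.
    + unfold base. intros c. destruct e as [|[|e]]; [apply qbinom_base0|now apply qbinom_base1|lia].
    + apply cos_seq_rec.
    + now apply gauss_cos_summable.
    + now apply is_bisum_theta_half.
  - unfold base, theta_base, cos_seq. destruct e as [|[|e]]; [| |lia]; simpl Nat.eqb; cbv iota; simpl INR.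
    + replace ((0 + 0 / 2) * y) with 0 by field. apply cos_0.
    + replace ((-1 + 1 / 2) * y) with (- (y / 2)) by field. rewrite cos_neg.
      replace ((0 + 1 / 2) * y) with (y / 2) by field. ring. }
split; trivial.
destruct (qprod_lower s e Hs) as (B & HB & HBl).
assert (Hb := theta_base_pos e y Hy).
apply Rlt_le_trans with (k0 * (B * theta_base e y)).
- apply Rmult_lt_0_compat; trivial. now apply Rmult_lt_0_compat.
- apply (is_lim_seq_le (fun _ => k0 * (B * theta_base e y)) (fun n => kap n * (qprod s e (cos y) n * theta_base e y))
    (k0 * (B * theta_base e y)) (theta_full e y s)); trivial; [|apply is_lim_seq_const].
  intros n. assert (Hc := COS_bound y). specialize (HBl (cos y) n ltac:(lra)). specialize (Hkap n).
  apply Rmult_le_compat; try lra.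
  + apply Rmult_le_pos; lra.
  + apply Rmult_le_compat_r; lra.
Qed.

Lemma theta_full_pos e y s : (e <= 1)%nat -> 0 < s -> 0 <= y < PI -> 0 < theta_full e y s.
Proof.
intros He Hs Hy. destruct (theta_product_limit e s He Hs) as (kap & _ & H). now apply H.
Qed.

Definition theta_log (e : nat) (y y' s : R) : R :=
  ln (theta_full e y s / theta_full e y' s).

Lemma theta_log_eq e y y' s : (e <= 1)%nat -> 0 < s -> 0 <= y < PI -> 0 <= y' < PI ->
  theta_log e y y' s = ln (theta_full e y s) - ln (theta_full e y' s).
Proof.
intros He Hs Hy Hy'. unfold theta_log. apply ln_div; now apply theta_full_pos.
Qed.

Lemma theta_log_product_limit e s y y' : (e <= 1)%nat -> 0 < s -> 0 <= y < PI -> 0 <= y' < PI ->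
  is_lim_seq (fun n => ln (qprod s e (cos y) n) - ln (qprod s e (cos y') n))
    (theta_log e y y' s - (ln (theta_base e y) - ln (theta_base e y'))).
Proof.
intros He Hs Hy Hy'.
destruct (theta_product_limit e s He Hs) as (kap & Hk & H).
destruct (H y Hy) as [P L], (H y' Hy') as [P' L'].
assert (Hb := theta_base_pos e y Hy). assert (Hb' := theta_base_pos e y' Hy').
assert (Hq : forall y n, 0 < qprod s e (cos y) n).
{ intros x n. apply qprod_pos; trivial. apply COS_bound. }
assert (LL := is_lim_seq_ln_quotient kap _ _ _ _ Hk
  (fun n => Rmult_lt_0_compat _ _ (Hq y n) Hb) (fun n => Rmult_lt_0_compat _ _ (Hq y' n) Hb') P P' L L').
rewrite <- theta_log_eq in LL by trivial.
apply is_lim_seq_ext with (fun n => ln (qprod s e (cos y) n * theta_base e y) - ln (qprod s e (cos y') n * theta_base e y') -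
   (ln (theta_base e y) - ln (theta_base e y'))).
- intros n. rewrite !ln_mult by auto. ring.
- apply is_lim_seq_minus'; trivial. apply is_lim_seq_const.
Qed.

(** * Two approximations of the logarithm for the third theta function *)

Lemma direct_limit t y y' : 0 < t -> 0 <= y < PI -> 0 <= y' < PI ->
  is_lim_seq (fun n => sum_n (fun j =>
     ln (1 + 2 * cos y * exp (- (PI ^ 2 * INR (2 * j + 1)) * t) + exp (- (PI ^ 2 * INR (2 * j + 1)) * t) ^ 2)) n -
     sum_n (fun j =>
     ln (1 + 2 * cos y' * exp (- (PI ^ 2 * INR (2 * j + 1)) * t) + exp (- (PI ^ 2 * INR (2 * j + 1)) * t) ^ 2)) n)
   (theta_log 0 y y' (PI ^ 2 * t)).
Proof.
intros Ht Hy Hy'. assert (Hs : 0 < PI ^ 2 * t) by (assert (P := PI2_gt_9); nra).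
assert (L := theta_log_product_limit 0 (PI ^ 2 * t) y y' ltac:(lia) Hs Hy Hy').
replace (theta_log 0 y y' (PI ^ 2 * t) - (ln (theta_base 0 y) - ln (theta_base 0 y'))) with
  (theta_log 0 y y' (PI ^ 2 * t)) in L by (unfold theta_base; simpl Nat.eqb; cbv iota; ring).
apply is_lim_seq_incr_1 in L. eapply is_lim_seq_ext; [|exact L].
assert (E : forall x n, -1 <= x -> ln (qprod (PI ^ 2 * t) 0 x (S n)) = sum_n (fun j =>
     ln (1 + 2 * x * exp (- (PI ^ 2 * INR (2 * j + 1)) * t) + exp (- (PI ^ 2 * INR (2 * j + 1)) * t) ^ 2)) n).
{ intros x n Hx.
  assert (EQ : forall i, qfactor (PI ^ 2 * t) 0 i = exp (- (PI ^ 2 * INR (2 * i + 1)) * t)).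
  { intros i. unfold qfactor. rewrite Nat.add_0_r. f_equal. ring. }
  unfold qprod. rewrite ln_prodn.
  - apply sum_n_ext. intros j. now rewrite EQ.
  - intros i. assert (HQ : 0 < qfactor (PI ^ 2 * t) 0 i < 1).
    { unfold qfactor. split; [apply exp_pos|]. rewrite <- exp_0. apply exp_increasing.
      assert (0 < INR (2 * i + 1 + 0)) by (apply lt_0_INR; lia). nra. }
    set (Q := qfactor _ _ _) in *. nra. }
intros n. cbv beta. rewrite !E by apply COS_bound. reflexivity.
Qed.

Lemma cosh_rec b k : cosh (IZR (k + 1) * b) + cosh (IZR (k - 1) * b) = 2 * cosh b * cosh (IZR k * b).
Proof.
unfold cosh. rewrite plus_IZR, minus_IZR.
replace ((IZR k + 1) * b) with (IZR k * b + b) by ring.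
replace ((IZR k - 1) * b) with (IZR k * b + - b) by ring.
rewrite !Ropp_plus_distr, !exp_plus, Ropp_involutive. field.
Qed.

(** Completing the square: the terms [k] and [- k] of the Gaussian series combine
into a hyperbolic cosine. *)
Lemma gauss_cosh t w k : 0 < t -> gauss (/ t) 0 k * cosh (IZR k * (w / t)) =
  exp (w ^ 2 / 4 / t) * / 2 * (exp (- ((w / 2 + IZR k) ^ 2 / t)) + exp (- ((w / 2 + IZR (- k)) ^ 2 / t))).
Proof.
intros Ht. unfold gauss, cosh. simpl (INR 0). rewrite opp_IZR.
replace (- ((w / 2 + IZR k) ^ 2 / t)) with (- (w ^ 2 / 4 / t) + (- / t * (IZR k ^ 2 + 0 * IZR k) + - (IZR k * (w / t)))) by (field; lra).
replace (- ((w / 2 + - IZR k) ^ 2 / t)) with (- (w ^ 2 / 4 / t) + (- / t * (IZR k ^ 2 + 0 * IZR k) + IZR k * (w / t))) by (field; lra).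
rewrite (exp_plus (- (w ^ 2 / 4 / t))), (exp_plus (- (w ^ 2 / 4 / t))).
rewrite (exp_plus (- / t * _)), (exp_plus (- / t * _)).
rewrite (exp_Ropp (w ^ 2 / 4 / t)). assert (P := exp_pos (w ^ 2 / 4 / t)). field. lra.
Qed.

Lemma gauss_cosh_summable t w : 0 < t -> 0 <= w <= 1 ->
  bisummable (fun k => gauss (/ t) 0 k * cosh (IZR k * (w / t))).
Proof.
intros Ht Hw.
assert (H : forall k, exp (- ((w / 2 + IZR k) ^ 2 / t)) <= heat_bound t k).
{ intros k. eapply Rle_trans; [|apply (exp_sqr_le_heat_bound t (w / 2)); trivial; lra].
  apply exp_le, Ropp_le_contravar, Rmult_le_compat_l; [apply pow2_ge_0|].
  apply Rinv_le_contravar; lra. }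
assert (H' : forall k, exp (- ((w / 2 + IZR (- k)) ^ 2 / t)) <= heat_bound t k).
{ intros k. replace (heat_bound t k) with (heat_bound t (- k)); [apply H|].
  unfold heat_bound. now rewrite opp_IZR, Rabs_Ropp. }
assert (HH : forall k, Rabs (Rabs (gauss (/ t) 0 k * cosh (IZR k * (w / t)))) <= exp (w ^ 2 / 4 / t) * Rabs (heat_bound t k)).
{ intros k. rewrite Rabs_Rabsolu, gauss_cosh by trivial.
  assert (P := exp_pos (w ^ 2 / 4 / t)). specialize (H k). specialize (H' k).
  assert (P1 := exp_pos (- ((w / 2 + IZR k) ^ 2 / t))). assert (P2 := exp_pos (- ((w / 2 + IZR (- k)) ^ 2 / t))).
  set (e0 := exp (w ^ 2 / 4 / t)) in *. set (e1 := exp _) in *. set (e2 := exp _) in *.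
  rewrite (Rabs_pos_eq (heat_bound t k)) by lra. rewrite Rabs_pos_eq; nra. }
destruct (heat_bound_summable t Ht) as [S1 S2]. split.
- apply ex_series_le_R with (1 := fun n => HH (Z.of_nat n)). now apply ex_series_scal_R.
- apply ex_series_le_R with (1 := fun n => HH (- Z.of_nat (S n))%Z). now apply ex_series_scal_R.
Qed.

Lemma theta_full_theta3 w t : 0 < t -> theta_full 0 (PI * w) (PI ^ 2 * t) = theta3 (w / 2) t.
Proof.
intros Ht. rewrite theta3_half by trivial. unfold theta_full. simpl Nat.eqb. cbv iota.
do 3 f_equal. field.
Qed.

(** The triple product with [x = cosh (w/t)] applied to the Gaussian series of
[theta3_heat]. *)
Lemma dual_limit t u v : 0 < t -> 0 <= u <= 1 -> 0 <= v <= 1 ->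
  is_lim_seq (fun n => dual_log n u t - dual_log n v t) (theta_log 0 (PI * u) (PI * v) (PI ^ 2 * t)).
Proof.
intros Ht Hu Hv.
destruct (theta3_heat t Ht) as (C & HC & Hheat).
assert (Hit : 0 < / t) by now apply Rinv_0_lt_compat.
destruct (triple_product_limit (/ t) 0 Hit) as (kap & k0 & Hk0 & Hkap & Hlim).
set (X := fun w => exp (w ^ 2 / 4 / t) * (C * theta3 (w / 2) t)).
assert (HX : forall w, 0 <= w <= 1 -> 0 < X w /\
   is_lim_seq (fun n => kap n * qprod (/ t) 0 (cosh (w / t)) n) (X w)).
{ intros w Hw. destruct (Hheat (w / 2) ltac:(lra)) as [Hb Hp]. split.
  - unfold X. apply Rmult_lt_0_compat; [apply exp_pos|]. now apply Rmult_lt_0_compat.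
  - apply is_lim_seq_ext with (fun n => kap n * (qprod (/ t) 0 (cosh (w / t)) n * cosh (IZR 0 * (w / t)))).
    { intros n. rewrite Rmult_0_l, cosh_0, Rmult_1_r. reflexivity. }
    apply (Hlim (cosh (w / t)) (fun c => c 0%Z) (fun k => cosh (IZR k * (w / t)))).
    + intros c. apply qbinom_base0.
    + intros k. apply cosh_rec.
    + now apply gauss_cosh_summable.
    + (* average the Gaussian series with its reflection *)
      assert (H2 := is_bisum_plus _ _ _ _ Hb (is_bisum_opp _ _ Hb)).
      apply (is_bisum_scal (exp (w ^ 2 / 4 / t) * / 2)) in H2.
      replace (X w) with (exp (w ^ 2 / 4 / t) * / 2 * (C * theta3 (w / 2) t + C * theta3 (w / 2) t)) by (unfold X; field).
      eapply is_bisum_ext; [|exact H2]. intros k. cbv beta. now rewrite gauss_cosh. }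
destruct (HX u Hu) as [Pu Lu], (HX v Hv) as [Pv Lv].
assert (Hq : forall w n, 0 < qprod (/ t) 0 (cosh (w / t)) n).
{ intros w n. apply qprod_pos; trivial. unfold cosh.
  assert (P1 := exp_pos (w / t)). assert (P2 := exp_pos (- (w / t))). lra. }
assert (LL := is_lim_seq_ln_quotient kap _ _ _ _ (fun n => Rlt_le_trans _ _ _ Hk0 (Hkap n)) (Hq u) (Hq v) Pu Pv Lu Lv).
apply is_lim_seq_incr_1 in LL.
assert (E : forall w n, ln (qprod (/ t) 0 (cosh (w / t)) (S n)) =
   sum_n (fun j => softplus ((INR (2 * j + 1) - w) / t) + softplus ((INR (2 * j + 1) + w) / t)) n).
{ intros w n.
  assert (EQ : forall i, 1 + 2 * cosh (w / t) * qfactor (/ t) 0 i + qfactor (/ t) 0 i ^ 2 =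
    (1 + exp (- ((INR (2 * i + 1) - w) / t))) * (1 + exp (- ((INR (2 * i + 1) + w) / t)))).
  { intros i. unfold qfactor, cosh. rewrite Nat.add_0_r. set (m := INR (2 * i + 1)).
    replace (- ((m - w) / t)) with (- / t * m + w / t) by (field; lra).
    replace (- ((m + w) / t)) with (- / t * m + - (w / t)) by (field; lra).
    rewrite !exp_plus, (exp_Ropp (w / t)). assert (P := exp_pos (w / t)). field. lra. }
  assert (EP : forall x, 0 < 1 + exp (- x)) by (intros x; assert (P := exp_pos (- x)); lra).
  unfold qprod. rewrite ln_prodn.
  - apply sum_n_ext. intros j. rewrite EQ. unfold softplus. now rewrite ln_mult.
  - intros i. rewrite EQ. now apply Rmult_lt_0_compat. }
assert (Hi : is_lim_seq (fun n => 1 + 20 / (INR n + 1)) 1).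
{ replace (Finite 1) with (Finite (1 + 20 * 0)) by (f_equal; ring).
  apply is_lim_seq_plus'; [apply is_lim_seq_const|].
  apply is_lim_seq_mult'; [apply is_lim_seq_const|].
  apply is_lim_seq_ext with (fun n => / INR (S n)); [intros n; now rewrite S_INR|].
  apply (is_lim_seq_incr_1 (fun n => / INR n)).
  apply (is_lim_seq_inv INR p_infty); [apply is_lim_seq_INR|easy]. }
assert (LF := is_lim_seq_plus' _ _ _ _ LL (is_lim_seq_mult' _ _ _ _ Hi (is_lim_seq_const ((v ^ 2 - u ^ 2) / 4 / t)))).
replace (theta_log 0 (PI * u) (PI * v) (PI ^ 2 * t)) with (ln (X u) - ln (X v) + 1 * ((v ^ 2 - u ^ 2) / 4 / t)).
- eapply is_lim_seq_ext; [|exact LF]. intros n. cbv beta. rewrite !E. unfold dual_log.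
  set (S1 := sum_n _ n). set (S2 := sum_n _ n).
  change (S1 - S2 + (1 + 20 / (INR n + 1)) * ((v ^ 2 - u ^ 2) / 4 / t) =
   S1 - (1 + 20 / (INR n + 1)) * u ^ 2 / 4 * / t - (S2 - (1 + 20 / (INR n + 1)) * v ^ 2 / 4 * / t)).
  field. assert (P := pos_INR n). lra.
- unfold theta_log. rewrite !theta_full_theta3 by trivial.
  destruct (Hheat (u / 2) ltac:(lra)) as [_ Tu], (Hheat (v / 2) ltac:(lra)) as [_ Tv].
  unfold X. rewrite !ln_mult by (try apply exp_pos; try apply Rmult_lt_0_compat; trivial).
  rewrite !ln_exp, ln_div by trivial. field. lra.
Qed.

(** * Regularity and large times *)

Lemma smooth_third_deriv f : smooth 4 f -> exists f1 f2 f3,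
  (forall s, 0 < s -> is_derive f s (f1 s) /\ is_derive f1 s (f2 s) /\ is_derive f2 s (f3 s)) /\
  forall s, 0 < s -> continuous f3 s.
Proof.
intros (f1 & H1 & f2 & H2 & f3 & H3 & f4 & H4 & _). exists f1, f2, f3. split.
- intros s Hs. auto.
- intros s Hs. apply (ex_derive_continuous f3). exists (f4 s). auto.
Qed.

Lemma smooth_theta_full k e y : smooth k (fun t => theta_full e y (PI ^ 2 * t)).
Proof.
assert (P := PI2_gt_9).
apply smooth_ext with (fun t => 2 * Series (fun n => cos ((INR n + INR e / 2) * y) *
   exp (- (PI ^ 2 * theta_exponent e n) * t)) + - (if Nat.eqb e 0 then 1 else 0)).
- intros t Ht. unfold theta_full, theta_half, Rminus. do 2 f_equal. apply Series_ext.
  intros n. do 2 f_equal. ring.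
- apply smooth_plus; [|apply smooth_const]. apply smooth_scal.
  assert (Hge : forall n, INR n <= PI ^ 2 * theta_exponent e n).
  { intros n. assert (H := theta_exponent_ge e n). assert (Hn := pos_INR n). nra. }
  apply (smooth_dirichlet k (fun n => cos ((INR n + INR e / 2) * y)) (fun n => PI ^ 2 * theta_exponent e n)).
  + intros n. specialize (Hge n). assert (Hn := pos_INR n). lra.
  + intros d Hd. apply ex_series_le_R with (fun n => exp (- d * INR n)); [|now apply ex_series_geom_exp].
    intros n. specialize (Hge n). rewrite Rabs_mult, Rabs_Rabsolu, (Rabs_pos_eq (exp _)) by (left; apply exp_pos).
    rewrite <- (Rmult_1_l (exp (- d * INR n))). apply Rmult_le_compat.
    * apply Rabs_pos.
    * left; apply exp_pos.
    * apply Rabs_le, COS_bound.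
    * apply exp_le. nra.
Qed.

Lemma smooth_theta_quotient k e y y' : (e <= 1)%nat -> 0 <= y' < PI ->
  smooth k (fun t => theta_full e y (PI ^ 2 * t) / theta_full e y' (PI ^ 2 * t)).
Proof.
intros He Hy'. assert (P := PI2_gt_9). apply smooth_mult; [apply smooth_theta_full|].
apply smooth_inv; [|apply smooth_theta_full].
intros t Ht. assert (H := theta_full_pos e y' (PI ^ 2 * t) He ltac:(nra) Hy'). lra.
Qed.

Lemma smooth_theta_log k e y y' : (e <= 1)%nat -> 0 <= y < PI -> 0 <= y' < PI ->
  smooth k (fun t => theta_log e y y' (PI ^ 2 * t)).
Proof.
intros He Hy Hy'. assert (P := PI2_gt_9). unfold theta_log.
apply (smooth_ln k (fun t => theta_full e y (PI ^ 2 * t) / theta_full e y' (PI ^ 2 * t))).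
- intros t Ht. apply Rdiv_lt_0_compat; apply theta_full_pos; trivial; nra.
- now apply smooth_theta_quotient.
Qed.

Lemma theta_half_lim e y t : 0 < t ->
  is_lim_seq (fun k => theta_half e y (PI ^ 2 * (2 ^ k * t))) (cos (INR e / 2 * y)).
Proof.
intros Ht. assert (P := PI2_gt_9). unfold theta_half.
assert (Hs : 0 < PI ^ 2 * t) by nra.
replace (cos (INR e / 2 * y)) with (Series (fun n => if Nat.eqb n 0 then cos (INR e / 2 * y) else 0)).
2:{ rewrite (Series_finite _ 0); [now rewrite sum_O|]. intros [|k] Hk; [lia|easy]. }
apply (is_lim_seq_Series_dominated _ _ (fun n => exp (- (PI ^ 2 * t) * INR n))).
- intros k n. rewrite Rmult_comm. apply Rabs_exp_cos_le.
  assert (H := theta_exponent_ge e n). assert (Hn := pos_INR n).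
  assert (H1 : 1 <= 2 ^ k) by (apply pow_R1_Rle; lra).
  assert (PI ^ 2 * t * INR n <= (PI ^ 2 * t * 2 ^ k) * theta_exponent e n); [|lra].
  apply Rmult_le_compat; nra.
- now apply ex_series_geom_exp.
- intros n. destruct n as [|n].
  + simpl Nat.eqb. cbv iota. eapply is_lim_seq_ext; [|apply is_lim_seq_const].
    intros k. unfold theta_exponent. simpl (INR 0).
    replace (- (0 ^ 2 + INR e * 0) * (PI ^ 2 * (2 ^ k * t))) with 0 by ring.
    rewrite exp_0, Rplus_0_l. ring.
  + simpl Nat.eqb. cbv iota.
    apply (is_lim_seq_abs_0 (fun k => cos ((INR (S n) + INR e / 2) * y) *
      exp (- theta_exponent e (S n) * (PI ^ 2 * (2 ^ k * t))))).
    apply is_lim_seq_le_le with (fun _ => 0) (fun k => / (PI ^ 2 * t) * / INR (S k)).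
    * intros k. split; [apply Rabs_pos|]. rewrite Rmult_comm.
      eapply Rle_trans; [apply (Rabs_exp_cos_le _ (- ((PI ^ 2 * t) * (2 ^ k))))|].
      { assert (H := theta_exponent_ge e (S n)). rewrite S_INR in H. assert (Hn := pos_INR n).
        assert (H1 : 0 < 2 ^ k) by (apply pow_lt; lra).
        assert (H2 : 0 < PI ^ 2 * t * 2 ^ k) by now apply Rmult_lt_0_compat.
        assert (1 <= theta_exponent e (S n)) by lra. nra. }
      rewrite exp_Ropp, <- Rinv_mult.
      assert (H2 := pow2_ge_INR k). assert (Hk : 0 < INR (S k)) by (apply lt_0_INR; lia).
      apply Rinv_le_contravar; [now apply Rmult_lt_0_compat|].
      assert (H3 := exp_ineq1_le (PI ^ 2 * t * 2 ^ k)).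
      assert (H4 : PI ^ 2 * t * INR (S k) <= PI ^ 2 * t * 2 ^ k) by (apply Rmult_le_compat_l; lra). lra.
    * apply is_lim_seq_const.
    * replace (Finite 0) with (Finite (/ (PI ^ 2 * t) * 0)) by (f_equal; ring).
      apply is_lim_seq_mult'; [apply is_lim_seq_const|].
      apply (is_lim_seq_incr_1 (fun n => / INR n)).
      apply (is_lim_seq_inv INR p_infty); [apply is_lim_seq_INR|easy].
Qed.

Lemma theta_log_lim e y y' t : (e <= 1)%nat -> 0 < t -> 0 <= y < PI -> 0 <= y' < PI ->
  is_lim_seq (fun k => theta_log e y y' (PI ^ 2 * (2 ^ k * t))) (ln (theta_base e y) - ln (theta_base e y')).
Proof.
intros He Ht Hy Hy'. assert (P := PI2_gt_9).
assert (L : forall x, is_lim_seq (fun k => theta_full e x (PI ^ 2 * (2 ^ k * t))) (theta_base e x)).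
{ intros x. assert (H := theta_half_lim e x t Ht).
  assert (E : theta_base e x = 2 * cos (INR e / 2 * x) - (if Nat.eqb e 0 then 1 else 0)).
  { unfold theta_base. destruct e as [|[|e]]; [| |lia]; simpl Nat.eqb; cbv iota; simpl INR.
    - replace (0 / 2 * x) with 0 by field. rewrite cos_0. ring.
    - replace (1 / 2 * x) with (x / 2) by field. ring. }
  rewrite E. apply is_lim_seq_minus'; [|apply is_lim_seq_const].
  apply is_lim_seq_mult'; [apply is_lim_seq_const|trivial]. }
assert (Hp : forall k, 0 < PI ^ 2 * (2 ^ k * t)).
{ intros k. assert (0 < 2 ^ k) by (apply pow_lt; lra). apply Rmult_lt_0_compat; [lra|].
  now apply Rmult_lt_0_compat. }
eapply is_lim_seq_ext; [intros k; symmetry; apply theta_log_eq; trivial|].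
apply (is_lim_seq_ln_quotient (fun _ => 1) (fun k => theta_full e y (PI ^ 2 * (2 ^ k * t)))
   (fun k => theta_full e y' (PI ^ 2 * (2 ^ k * t)))); try (now apply theta_base_pos).
- intros; lra.
- intros k. now apply theta_full_pos.
- intros k. now apply theta_full_pos.
- eapply is_lim_seq_ext; [|apply (L y)]. intros k. cbv beta. ring.
- eapply is_lim_seq_ext; [|apply (L y')]. intros k. cbv beta. ring.
Qed.

(** * The sign of the third derivative for the third theta function *)

(** Small times by the dual product, the others by the direct one. *)
Lemma theta3_log_third_nonpos u v f1 f2 f3 : 0 <= u -> u <= v -> v < 1 ->
  (forall s, 0 < s -> is_derive (fun t => theta_log 0 (PI * u) (PI * v) (PI ^ 2 * t)) s (f1 s) /\
     is_derive f1 s (f2 s) /\ is_derive f2 s (f3 s)) ->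
  (forall s, 0 < s -> continuous f3 s) ->
  forall t, 0 < t -> f3 t <= 0.
Proof.
intros Hu Huv Hv Hd Hc t Ht. assert (P := PI2_gt_9). assert (Pp := PI_RGT_0).
assert (Hy : 0 <= PI * u < PI) by nra. assert (Hy' : 0 <= PI * v < PI) by nra.
destruct (Rlt_le_dec t (5 / 19)) as [H|H].
- apply (third_deriv_limit_nonpos 0 (5 / 19) (fun n t => dual_log n u t - dual_log n v t)
    (fun n t => dual_log3 n u (/ t) / t ^ 3 - dual_log3 n v (/ t) / t ^ 3)
    (fun t => theta_log 0 (PI * u) (PI * v) (PI ^ 2 * t)) f3).
  + intros n. apply third_deriv_on_minus; apply third_deriv_dual_log.
  + intros n s Hs. apply dual_log_nonpos; lra.
  + intros s Hs. apply dual_limit; lra.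
  + exists f1, f2. intros s Hs. apply Hd. lra.
  + intros s Hs. apply Hc. lra.
  + lra.
- set (fac := fun (w : R) (j : nat) (t : R) =>
    ln (1 + 2 * cos (PI * w) * exp (- (PI ^ 2 * INR (2 * j + 1)) * t) + exp (- (PI ^ 2 * INR (2 * j + 1)) * t) ^ 2)).
  assert (Hm : forall j, 1 <= INR (2 * j + 1)).
  { intros j. replace 1 with (INR 1) by reflexivity. apply le_INR. lia. }
  apply (third_deriv_limit_nonpos (10 / 39) (t + 1)
    (fun n t => sum_n (fun j => fac u j t) n - sum_n (fun j => fac v j t) n)
    (fun n t => sum_n (fun j => factor_d3 (PI ^ 2 * INR (2 * j + 1)) (cos (PI * u)) t) n -
       sum_n (fun j => factor_d3 (PI ^ 2 * INR (2 * j + 1)) (cos (PI * v)) t) n)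
    (fun t => theta_log 0 (PI * u) (PI * v) (PI ^ 2 * t)) f3).
  + intros n. apply third_deriv_on_minus;
    [apply (third_deriv_on_sum _ _ (fac u) (fun j => factor_d3 (PI ^ 2 * INR (2 * j + 1)) (cos (PI * u))))|
     apply (third_deriv_on_sum _ _ (fac v) (fun j => factor_d3 (PI ^ 2 * INR (2 * j + 1)) (cos (PI * v))))];
    (intros j; apply third_deriv_factor; [lra|specialize (Hm j); nra|apply COS_bound]).
  + intros n s Hs.
    assert (Hcos : cos (PI * v) <= cos (PI * u)).
    { destruct (Req_dec u v) as [->|Hne]; [lra|].
      left. apply cos_decreasing_1; nra. }
    assert (B1 := COS_bound (PI * u)). assert (B2 := COS_bound (PI * v)).
    assert (T : forall j, factor_d3 (PI ^ 2 * INR (2 * j + 1)) (cos (PI * u)) s <=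
       factor_d3 (PI ^ 2 * INR (2 * j + 1)) (cos (PI * v)) s).
    { intros j. specialize (Hm j).
      assert (9 * 1 <= PI ^ 2 * INR (2 * j + 1)) by (apply Rmult_le_compat; lra).
      assert (D := factor_d3_decr (PI ^ 2 * INR (2 * j + 1)) (cos (PI * v)) (cos (PI * u)) s ltac:(nra)
        ltac:(lra) ltac:(lra) ltac:(lra) Hcos ltac:(lra)). lra. }
    assert (Q : sum_n (fun j => factor_d3 (PI ^ 2 * INR (2 * j + 1)) (cos (PI * u)) s) n <=
      sum_n (fun j => factor_d3 (PI ^ 2 * INR (2 * j + 1)) (cos (PI * v)) s) n).
    { apply sum_n_m_le. exact T. }
    lra.
  + intros s Hs. apply direct_limit; lra.
  + exists f1, f2. intros s Hs. apply Hd. lra.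
  + intros s Hs. apply Hc. lra.
  + lra.
Qed.

(** * Doubling of time and the second theta function *)

(** The even exponents up to [4n] are the doubles of the even and of the odd
numbers up to [2n]. *)
Lemma qprod_double s x n : qprod s 1 x (2 * n) = qprod (2 * s) 1 x n * qprod (2 * s) 0 x n.
Proof.
induction n as [|n IH]; [unfold qprod; simpl; ring|].
replace (2 * S n)%nat with (S (S (2 * n))) by lia. rewrite !qprod_succ, IH.
assert (E0 : qfactor s 1 (2 * n) = qfactor (2 * s) 0 n).
{ unfold qfactor. f_equal. rewrite !plus_INR, !mult_INR. simpl (INR 2). simpl (INR 1). simpl (INR 0). ring. }
assert (E1 : qfactor s 1 (S (2 * n)) = qfactor (2 * s) 1 n).
{ unfold qfactor. f_equal. rewrite !plus_INR, !mult_INR, (S_INR (2 * n)), mult_INR. simpl (INR 2). simpl (INR 1). ring. }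
rewrite E0, E1. ring.
Qed.

Lemma theta_log_double s y y' : 0 < s -> 0 <= y < PI -> 0 <= y' < PI ->
  theta_log 1 y y' s = theta_log 1 y y' (2 * s) + theta_log 0 y y' (2 * s).
Proof.
intros Hs Hy Hy'.
assert (L := theta_log_product_limit 1 s y y' ltac:(lia) Hs Hy Hy').
assert (L1 := theta_log_product_limit 1 (2 * s) y y' ltac:(lia) ltac:(lra) Hy Hy').
assert (L0 := theta_log_product_limit 0 (2 * s) y y' ltac:(lia) ltac:(lra) Hy Hy').
assert (L2 := is_lim_seq_plus' _ _ _ _ L1 L0).
apply (is_lim_seq_subseq _ _ (fun n => (2 * n)%nat)) in L.
2:{ apply eventually_subseq. intros n. lia. }
assert (E : Finite (theta_log 1 y y' s - (ln (theta_base 1 y) - ln (theta_base 1 y'))) =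
  Finite (theta_log 1 y y' (2 * s) - (ln (theta_base 1 y) - ln (theta_base 1 y')) +
   (theta_log 0 y y' (2 * s) - (ln (theta_base 0 y) - ln (theta_base 0 y'))))).
{ apply is_lim_seq_unique in L. apply is_lim_seq_unique in L2. rewrite <- L, <- L2.
  apply Lim_seq_ext. intros n. rewrite !qprod_double.
  assert (Hq : forall e x, 0 < qprod (2 * s) e (cos x) n).
  { intros e x. apply qprod_pos; [lra|apply COS_bound]. }
  rewrite !ln_mult by apply Hq. ring. }
injection E. unfold theta_base. simpl Nat.eqb. cbv iota. lra.
Qed.

(** Iterating [theta_log_double] expresses the logarithm for [theta2] as a constant
plus the sum of the logarithms for [theta3] at the times [2^k t], [k >= 1]. *)
Lemma theta2_log_third_nonpos u v f1 f2 f3 : 0 <= u -> u <= v -> v < 1 ->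
  (forall s, 0 < s -> is_derive (fun t => theta_log 1 (PI * u) (PI * v) (PI ^ 2 * t)) s (f1 s) /\
     is_derive f1 s (f2 s) /\ is_derive f2 s (f3 s)) ->
  (forall s, 0 < s -> continuous f3 s) ->
  forall t, 0 < t -> f3 t <= 0.
Proof.
intros Hu Huv Hv Hd Hc t Ht. assert (P := PI2_gt_9). assert (Pp := PI_RGT_0).
set (y := PI * u) in *. set (y' := PI * v) in *.
assert (Hy : 0 <= y < PI) by (unfold y; nra). assert (Hy' : 0 <= y' < PI) by (unfold y'; nra).
destruct (smooth_third_deriv _ (smooth_theta_log 4 0 y y' ltac:(lia) Hy Hy')) as (g1 & g2 & g3 & Hg & Hgc).
assert (Hg3 := theta3_log_third_nonpos u v g1 g2 g3 Hu Huv Hv Hg Hgc).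
set (g := fun t => theta_log 0 y y' (PI ^ 2 * t)) in *.
set (f := fun t => theta_log 1 y y' (PI ^ 2 * t)) in *.
set (c := ln (theta_base 1 y) - ln (theta_base 1 y')).
assert (Hp : forall k, 0 < 2 ^ k) by (intros k; apply pow_lt; lra).
apply (third_deriv_limit_nonpos 0 (t + 1) (fun n t => sum_n (fun k => g (2 ^ S k * t)) n)
  (fun n t => sum_n (fun k => (2 ^ S k) ^ 3 * g3 (2 ^ S k * t)) n) (fun t => f t - c) f3).
- intros n. apply (third_deriv_on_sum 0 (t + 1) (fun k t => g (2 ^ S k * t)) (fun k t => (2 ^ S k) ^ 3 * g3 (2 ^ S k * t))).
  intros k. set (b := 2 ^ S k). assert (Hb : 0 < b) by apply Hp.
  exists (fun t => b * g1 (b * t)), (fun t => b ^ 2 * g2 (b * t)). intros s Hs.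
  assert (Hbs : 0 < b * s) by nra. destruct (Hg (b * s) Hbs) as (A1 & A2 & A3).
  assert (Cmp : forall h h' d, is_derive h (b * s) h' -> is_derive (fun x => d * h (b * x)) s (b * d * h')).
  { intros h h' d Hh. replace (b * d * h') with (d * (b * h')) by ring.
    apply (is_derive_scal (fun x => h (b * x))).
    apply (is_derive_comp h (fun x => b * x) s h' b); trivial. auto_derive; trivial. ring. }
  split; [|split].
  + apply Cmp with (d := 1) in A1. eapply is_derive_ext; [|replace (b * g1 (b * s)) with (b * 1 * g1 (b * s)) by ring; exact A1].
    intros x. exact (Rmult_1_l (g (b * x))).
  + apply Cmp with (d := b) in A2. now replace (b ^ 2 * g2 (b * s)) with (b * b * g2 (b * s)) by ring.
  + apply Cmp with (d := b ^ 2) in A3. now replace (b ^ 3 * g3 (b * s)) with (b * b ^ 2 * g3 (b * s)) by ring.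
- intros n s Hs.
  assert (T : forall k, (2 ^ S k) ^ 3 * g3 (2 ^ S k * s) <= 0).
  { intros k. assert (H := Hp (S k)). assert (H3 : 0 < (2 ^ S k) ^ 3) by now apply pow_lt.
    assert (H4 := Hg3 (2 ^ S k * s) ltac:(nra)). nra. }
  clear - T. induction n as [|n IH]; [rewrite sum_O; apply T|].
  rewrite sum_Sn. specialize (T (S n)). apply Rplus_le_compat with (1 := IH) in T.
  rewrite Rplus_0_r in T. exact T.
- intros s Hs.
  assert (E : forall n, sum_n (fun k => g (2 ^ S k * s)) n = f s - f (2 ^ S n * s)).
  { assert (D : forall x, 0 < x -> g (2 * x) = f x - f (2 * x)).
    { intros x Hx. unfold f, g. rewrite (theta_log_double (PI ^ 2 * x)) by (trivial; nra).
      replace (2 * (PI ^ 2 * x)) with (PI ^ 2 * (2 * x)) by ring. ring. }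
    induction n as [|n IH].
    - rewrite sum_O. replace (2 ^ 1 * s) with (2 * s) by ring. apply D. lra.
    - rewrite sum_Sn, IH. replace (2 ^ S (S n) * s) with (2 * (2 ^ S n * s)) by (simpl; ring).
      rewrite D by (specialize (Hp (S n)); nra).
      change (f s - f (2 ^ S n * s) + (f (2 ^ S n * s) - f (2 * (2 ^ S n * s))) = f s - f (2 * (2 ^ S n * s))). ring. }
  eapply is_lim_seq_ext; [intros n; symmetry; apply E|].
  apply is_lim_seq_minus'; [apply is_lim_seq_const|].
  apply (is_lim_seq_incr_1 (fun n => f (2 ^ n * s))). apply theta_log_lim; trivial; lra.
- exists f1, f2. intros s Hs. destruct (Hd s ltac:(lra)) as (A1 & A2 & A3). split; [|split]; trivial.
  replace (f1 s) with (f1 s - 0) by ring.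
  apply (is_derive_minus (V := R_NormedModule)); trivial.
  apply (is_derive_const (V := R_NormedModule)).
- intros s Hs. apply Hc. lra.
- lra.
Qed.

(** * Conclusion *)

Lemma theta_quotient_conclusion e u v : (e <= 1)%nat -> 0 <= u -> u <= v -> v < 1 ->
  forall t, 0 < t -> forall S : R -> R,
  (forall s, 0 < s -> S s = theta_full e (PI * u) (PI ^ 2 * s) / theta_full e (PI * v) (PI ^ 2 * s)) ->
  (forall k, (k <= 3)%nat -> ex_derive_n S k t) /\ Derive_n S 3 t <= 0.
Proof.
intros He Hu Huv Hv t Ht S HS. assert (P := PI2_gt_9). assert (Pp := PI_RGT_0).
assert (Hy : 0 <= PI * u < PI) by nra. assert (Hy' : 0 <= PI * v < PI) by nra.
split.
- assert (Hsm : smooth 4 S).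
  { eapply smooth_ext; [intros s Hs; symmetry; now apply HS|].
    now apply smooth_theta_quotient. }
  intros k Hk. apply (smooth_ex_derive_n k 4); [trivial|lia|trivial].
- destruct (smooth_third_deriv _ (smooth_theta_log 4 e (PI * u) (PI * v) He Hy Hy')) as (f1 & f2 & f3 & Hd & Hc).
  assert (H3 : forall s, 0 < s -> f3 s <= 0).
  { destruct e as [|[|e]]; [| |lia].
    - exact (theta3_log_third_nonpos u v f1 f2 f3 Hu Huv Hv Hd Hc).
    - exact (theta2_log_third_nonpos u v f1 f2 f3 Hu Huv Hv Hd Hc). }
  assert (Hl := theta_log_lim e (PI * u) (PI * v) 1 He ltac:(lra) Hy Hy').
  assert (Hsg := third_deriv_bounded_signs _ f1 f2 f3 (fun k => 2 ^ k * 1) (ln (theta_base e (PI * u)) - ln (theta_base e (PI * v))) Hd H3).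
  assert (Hinf : is_lim_seq (fun k => 2 ^ k * 1) p_infty).
  { apply is_lim_seq_le_p_loc with INR; [|apply is_lim_seq_INR].
    exists O. intros n _. assert (H := pow2_ge_INR n). rewrite S_INR in H. lra. }
  destruct (Hsg Hinf Hl t Ht) as [H1 H2].
  apply (third_deriv_exp_nonpos S _ f1 f2 f3 t Hd); trivial; [|now apply H3].
  intros s Hs. unfold theta_log. rewrite exp_ln, HS by (trivial; apply Rdiv_lt_0_compat; apply theta_full_pos; trivial; nra).
  reflexivity.
Qed.

Theorem corollary7 :
  forall (u v : R), 0 < u -> u < v -> v < 1 ->
  forall (j : nat), j = 2%nat \/ j = 3%nat ->
  forall (t : R), 0 < t ->
    (forall k : nat, (k <= 3)%nat ->
       ex_derive_n (fun s : R => theta_quotient j u v s) k t) /\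
    Derive_n (fun s : R => theta_quotient j u v s) 3 t <= 0.
Proof.
intros u v Hu Huv Hv j Hj t Ht.
assert (P := PI2_gt_9). assert (Pp := PI_RGT_0).
assert (Hy' : 0 <= PI * v < PI) by nra.
destruct Hj as [-> | ->].
- apply (theta_quotient_conclusion 1 u v ltac:(lia) ltac:(lra) ltac:(lra) Hv t Ht).
  intros s Hs. unfold theta_quotient, theta. rewrite !theta2_half.
  assert (E : forall w, 2 * theta_half 1 (2 * PI * (w / 2)) (PI ^ 2 * s) = theta_full 1 (PI * w) (PI ^ 2 * s)).
  { intros w. unfold theta_full. simpl Nat.eqb. cbv iota. replace (2 * PI * (w / 2)) with (PI * w) by field. ring. }
  rewrite !E. assert (H := theta_full_pos 1 (PI * v) (PI ^ 2 * s) ltac:(lia) ltac:(nra) Hy').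
  assert (He := exp_pos (- (PI ^ 2 * s) / 4)). field. lra.
- apply (theta_quotient_conclusion 0 u v ltac:(lia) ltac:(lra) ltac:(lra) Hv t Ht).
  intros s Hs. unfold theta_quotient, theta. now rewrite !theta_full_theta3.
Qed.
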